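(* Let $\alpha > -1$ and $0 < \sigma < \alpha+1$. Assume that $1\le p,q \le \infty$. (i) If $\alpha \ge -1/2$, then $L^p(dx) \subset \mathrm{Dom}\, \mathcal{I}^{\alpha,\sigma}$ if and only if $\frac{1}p > 2\sigma-\alpha-1/2$ ($\ge$ if $p=1$), and $\mathcal{I}^{\alpha,\sigma}$ is bounded from $L^p(dx)$ to $L^q(dx)$ if and only if $$\frac{1}q=\frac{1}p - 2\sigma \quad \text{and} \quad p>1 \quad \text{and} \quad q < \infty.$$ (ii) If $\alpha < -1/2$, then $L^p(dx) \subset \mathrm{Dom}\, \mathcal{I}^{\alpha,\sigma}$ if and only if $\alpha+3/2 > \frac{1}p > 2\sigma-\alpha-1/2$ (both inequalities being $\ge$ if $p=1$), and $\mathcal{I}^{\alpha,\sigma}$ is bounded from $L^p(dx)$ to $L^q(dx)$ if and only if $$\frac{1}q = \frac{1}p - 2\sigma \quad \text{and} \quad \frac{1}{p'} > -\alpha-\frac{1}2 \quad \text{and} \quad \frac{1}q > -\alpha-\frac{1}2.$$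
   Context: For $\alpha>-1$ let $I_\alpha$ denote the modified Bessel function of the first kind of order $\alpha$, and for $t,x,y>0$ let $$\mathcal W_t^{\alpha}(x,y)=\frac{(xy)^{1/2}}{2t}\exp\Big(-\frac{x^2+y^2}{4t}\Big)I_\alpha\Big(\frac{xy}{2t}\Big).$$ For $\sigma>0$ define $$\mathcal K^{\alpha,\sigma}(x,y)=\frac1{\Gamma(\sigma)}\int_0^\infty \mathcal W_t^\alpha(x,y)\,t^{\sigma-1}\,dt,\qquad \mathcal I^{\alpha,\sigma}f(x)=\int_0^\infty \mathcal K^{\alpha,\sigma}(x,y)f(y)\,dy,\qquad x,y>0.$$ The natural domain $\mathrm{Dom}\,\mathcal I^{\alpha,\sigma}$ consists of those functions $f$ on $\mathbb{R}_+=(0,\infty)$ for which the last integral converges for a.e. $x>0$. All $L^p$ spaces are over $\mathbb{R}_+$ with Lebesgue measure. $p'$ is the conjugate exponent, $1/p+1/p'=1$, and $1/\infty=0$. Boundedness from $L^p$ to $L^q$ means that the operator is defined on all of $L^p$ and the norm inequality holds with a constant independent of $f$. *)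

(* Defs.v *)
From mathcomp Require Import all_boot all_order all_algebra.
From mathcomp Require Import all_classical all_reals all_analysis.

Set Implicit Arguments.
Unset Strict Implicit.
Unset Printing Implicit Defensive.

Import Order.TTheory GRing.Theory Num.Theory.
Import numFieldNormedType.Exports.

Local Open Scope classical_set_scope.
Local Open Scope ring_scope.

Definition Rpos (R : realType) : set R := `]0, +oo[.
Arguments Rpos R : clear implicits.

(* Euler's integral; it is the Gamma function for 0 < s only, and all the
   arguments used below are positive. *)
Definition Gamma (R : realType) (s : R) : R :=
  \int[@lebesgue_measure R]_(t in Rpos R) (t `^ (s - 1) * expR (- t)).

(* I_a(z) for -1 < a and 0 < z, by its power series. *)
Definition besselI (R : realType) (a z : R) : R :=
  limn (series (fun k : nat =>
    (z / 2) `^ (a + 2 * k%:R) / (k`!%:R * Gamma (a + k%:R + 1)))).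

Definition heat_kernel (R : realType) (a t x y : R) : R :=
  Num.sqrt (x * y) / (2 * t) * expR (- (x ^+ 2 + y ^+ 2) / (4 * t)) *
  besselI a (x * y / (2 * t)).

(* The kernel is extended-real valued because the integral is +oo on the
   diagonal x = y when s <= 1/2. *)
Definition potential_kernel (R : realType) (a s x y : R) : \bar R :=
  ((Gamma s)^-1%:E *
   \int[@lebesgue_measure R]_(t in Rpos R)
     (heat_kernel a t x y * t `^ (s - 1))%:E)%E.

Definition potential (R : realType) (a s : R) (f : R -> R) (x : R) : \bar R :=
  (\int[@lebesgue_measure R]_(y in Rpos R)
     (potential_kernel a s x y * (f y)%:E))%E.

(* Functions on (0, +oo) are represented by functions on R whose values
   outside (0, +oo) are irrelevant; convergence is that of the Lebesgue
   integral. *)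
Definition Dom_potential (R : realType) (a s : R) : set (R -> R) :=
  [set f | {ae @lebesgue_measure R, forall x, Rpos R x ->
    (@lebesgue_measure R).-integrable (Rpos R)
      (fun y => (potential_kernel a s x y * (f y)%:E)%E)}].

(* L^p(0, +oo), through the extension by 0 to R. *)
Definition Lp_pos (R : realType) (p : \bar R) : set (R -> R) :=
  [set f | f \_ (Rpos R) \in Lfun (@lebesgue_measure R) p].

Definition norm_pos (R : realType) (p : \bar R) (g : R -> \bar R) : \bar R :=
  'N[@lebesgue_measure R]_p[g \_ (Rpos R)]%E.

Definition potential_bounded (R : realType) (a s : R) (p q : \bar R) : Prop :=
  Lp_pos p `<=` Dom_potential a s /\
  exists C : R, forall f : R -> R, Lp_pos p f ->
    (norm_pos q (potential a s f) <= C%:E * norm_pos p (EFin \o f))%E.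

(* Main.v *)
Require Import Defs.
From mathcomp Require Import all_boot all_order all_algebra.
From mathcomp Require Import all_classical all_reals all_analysis.
From mathcomp Require Import measurable_realfun measurable_fun_approximation ess_sup_inf.
From mathcomp Require Import ring lra.

(** Write b = a + 1/2. Expanding the Bessel function and integrating in time term
by term turns the kernel into an explicit power series ([potential_kernelE]),
    K(x, y) = C (x y)^b (x^2 + y^2)^(-(a + 1 - s)) sum_k c_k r^k,
with r = (2 x y / (x^2 + y^2))^2 and positive coefficients c_k, which are
comparable to (k + 1)^(-s - 1/2) ([kcoef_bound]). All the estimates of the kernel
are read off this series. When one variable dominates, r is away from 1 and
    K(x, y) ~ x^(2 s - 1 - b) y^b for y << x, and symmetrically for x << y.
Near the diagonal 1 - r is of order (x - y)^2 / x^2, so that for s < 1/2 the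
kernel behaves like the Riesz kernel |x - y|^(2 s - 1), for s = 1/2 like a
logarithm ([kser_upper_split], [kser_lower], [kser_lower_dist], [kser_lower_log]).

Since the kernel is positive, f is in the domain when the potential of |f| is
finite almost everywhere. The part of the integral near the diagonal is harmless
by Tonelli's theorem ([near_integral_fin]). What remains is that y^b at the origin
and y^(2 s - 1 - b) at infinity be in the dual of L^p ([weight_cond]): this is the
condition on 1/p. If one of the two fails, a power of y, with a logarithmic
correction when p > 1, has an infinite potential on an interval
([weight_necessary], [domain_necessary]).

For boundedness, the near part of the kernel is controlled by the
Hardy-Littlewood-Sobolev inequality and the two off-diagonal parts by
weighted Hardy operators ([hardy_littlewood_sobolev], [hardy], [strong_type]).
Conversely, the homogeneity of the kernel forces 1/q = 1/p - 2 s
([bounded_exponents]); the endpoints p = 1 and q = +oo are ruled out by the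
failure of the Hardy-Littlewood-Sobolev inequality there ([unbounded_from_L1],
[unbounded_to_Loo]); and the potential of a bump is of order x^b at the origin,
where it must be in L^q ([bounded_at_origin]). The condition dual to the last one
is the domain condition at the origin. This gives one characterization for all a
([potential_boundedP]), of which the two parts of the theorem are special cases:
the conditions at the origin are vacuous for a >= -1/2, and imply 1 < p and
q < +oo for a < -1/2. *)

Set Implicit Arguments.
Unset Strict Implicit.
Unset Printing Implicit Defensive.

Import Order.TTheory GRing.Theory Num.Theory.
Import numFieldNormedType.Exports.

Local Open Scope classical_set_scope.
Local Open Scope ring_scope.

Lemma le_of_eq d (T : porderType d) (x y : T) : x = y -> (x <= y)%O.
Proof. by move=> ->. Qed.

(** * Calculus and changes of variables *)

Section FTC.
Context {R : realType}.
Local Notation mu := (@lebesgue_measure R).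
Implicit Types (F f : R -> R) (a b l : R).

Lemma integral_derive F f a b : a < b ->
  (forall x, a <= x <= b -> is_derive x 1 F (f x)) ->
  (forall x, a <= x <= b -> {for x, continuous f}) ->
  (\int[mu]_(x in `[a, b]) (f x)%:E = (F b - F a)%:E)%E.
Proof.
move=> ab dF cf.
have cF x : a <= x <= b -> {for x, continuous F}.
  move=> /dF ?; apply: differentiable_continuous.
  by apply/derivable1_diffP/ex_derive.
rewrite (@continuous_FTC2 _ f F)//.
- by apply: continuous_in_subspaceT => x /set_mem/= /[!in_itv]/=; exact: cf.
- split.
  + move=> x /[!in_itv]/= /andP[ax xb].
    by have H := dF x; apply: ex_derive; apply: H; rewrite !ltW.
  + by apply: cvg_at_right_filter; apply: cF; rewrite lexx ltW.
  + by apply: cvg_at_left_filter; apply: cF; rewrite lexx ltW.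
- move=> x /[!in_itv]/= /andP[ax xb]; rewrite derive1E.
  by have H := dF x; apply: derive_val; apply: H; rewrite !ltW.
Qed.

Lemma integral_derive_pinfty F f a l :
  (forall x, a <= x -> is_derive x 1 F (f x)) ->
  (forall x, a <= x -> {for x, continuous f}) ->
  (forall x, a <= x -> 0 <= f x) -> F x @[x --> +oo] --> l ->
  (\int[mu]_(x in `[a, +oo[) (f x)%:E = (l - F a)%:E)%E.
Proof.
move=> dF cf f0 Fl.
rewrite (@ge0_continuous_FTC2y _ f F a l)//.
- apply: continuous_in_subspaceT => x /set_mem/= /[!in_itv]/= /andP[? _].
  exact: cf.
- move=> x ax; have H := dF x; apply: ex_derive; apply: H; exact: ltW.
- apply: cvg_at_right_filter; apply: differentiable_continuous.
  by apply/derivable1_diffP; have H := dF a; apply: ex_derive; apply: H.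
- move=> x /[!in_itv]/= /andP[ax _]; rewrite derive1E.
  by have H := dF x; apply: derive_val; apply: H; rewrite ltW.
Qed.

End FTC.

Lemma mem_Rpos (R : realType) (x : R) : (x \in Rpos R) = (0 < x).
Proof. by apply/idP/idP; rewrite inE /Rpos/= in_itv/= andbT. Qed.

Lemma RposE (R : realType) (x : R) : Rpos R x = (0 < x) :> Prop.
Proof. by rewrite /Rpos/= in_itv/= andbT. Qed.

Lemma measurable_Rpos (R : realType) : measurable (Rpos R).
Proof. exact: measurable_itv. Qed.
#[local] Hint Extern 0 (measurable (Rpos _)) => solve [apply: measurable_Rpos] : core.

Section affine.
Context {R : realType}.
Local Notation mu := (@lebesgue_measure R).

Lemma ge0_integral_affine (c d : R) (f : R -> \bar R) : 0 < c ->
  measurable_fun [set: R] f -> (forall x, 0 <= f x)%E ->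
  (\int[mu]_x f x = c%:E * \int[mu]_x f (c * x + d)%R)%E.
Proof.
move=> c0 mf f0.
pose phi (x : R) : measurableTypeR R := c * x + d.
have mphi : measurable_fun [set: R] phi.
  by apply: measurable_funD => //; exact: measurable_funM.
pose nu : {measure set (measurableTypeR R) -> \bar R} :=
  measure_function_pushforward__canonical__measure_function_Measure mu mphi.
pose m : {measure set (measurableTypeR R) -> \bar R} :=
  mscale (NngNum (ltW c0)) nu.
transitivity (\int[m]_x f x)%E.
  apply: eq_measure_integral => A mA _; apply: lebesgue_measure_unique => //.
  move=> _ [[a b]] _ <-.
  transitivity (c%:E * mu (phi @^-1` `]a, b]%classic))%E; last by [].
  have -> : phi @^-1` `]a, b] = [set` `](a - d) / c, (b - d) / c]].
    apply/seteqP; split => x /=; rewrite !in_itv/= /phi ltr_pdivrMr// ler_pdivlMr//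
      mulrC => /andP[h1 h2]; apply/andP; split; lra.
  rewrite !lebesgue_measure_itv/= !lte_fin ltr_pM2r ?invr_gt0// ltrD2r.
  case: ifPn => _; last by rewrite mule0.
  rewrite -!EFinB -EFinM; congr EFin; field; exact: lt0r_neq0.
rewrite ge0_integral_mscale//=; congr (_ * _)%E.
by rewrite /nu ge0_integral_pushforward.
Qed.

Lemma ge0_integral_opp (f : R -> \bar R) :
  measurable_fun [set: R] f -> (forall x, 0 <= f x)%E ->
  (\int[mu]_x f x = \int[mu]_x f (- x)%R)%E.
Proof.
move=> mf f0.
transitivity (\int[pushforward mu (-%R : _ -> measurableTypeR R)]_x f x)%E.
  by apply: eq_measure_integral => A mA _; exact/esym/lebesgue_measureN.
by rewrite ge0_integral_pushforward.
Qed.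

Lemma ge0_integral_dist (x : R) (f : R -> \bar R) :
  measurable_fun [set: R] f -> (forall x, 0 <= f x)%E ->
  (\int[mu]_y f `|x - y|%R = 2%:E * \int[mu]_(t in Rpos R) f t)%E.
Proof.
move=> mf f0.
have mfa : measurable_fun [set: R] (fun t : R => f `|t|).
  by apply: measurableT_comp => //.
rewrite (@ge0_integral_affine 1 x)//; last first.
  apply: (measurableT_comp mfa); exact: measurable_funB.
rewrite mul1e.
under eq_integral do rewrite mul1r opprD addrCA subrr addr0 normrN.
rewrite -(setvU (Rpos R : set R)) ge0_integral_setU//=; last 3 first.
- by apply: measurableC; exact: measurable_itv.
- exact: measurable_funTS.
- by apply/disj_setPS; rewrite setICl.
have -> : (\int[mu]_(y in ~` Rpos R) f `|y|%R = \int[mu]_(t in Rpos R) f t)%E.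
  have -> : ~` Rpos R = `]-oo, 0]%classic.
    by apply/seteqP; split => t/=; rewrite /Rpos/= !in_itv/= andbT leNgt => /negP.
  rewrite -integral_itv_bndo_bndc; last exact: measurable_funTS.
  rewrite integral_mkcond ge0_integral_opp; last 2 first.
  - by apply/(measurable_restrictT _ _).1; [exact: measurable_itv|exact: measurable_funTS].
  - by move=> t; apply: erestrict_ge0.
  rewrite [RHS]integral_mkcond; apply: eq_integral => t _.
  rewrite /patch mem_Rpos.
  have -> : (- t \in `]-oo, 0[%classic) = (0 < t).
    by apply/idP/idP; rewrite inE/= in_itv/= oppr_lt0.
  by case: ifPn => // t0; rewrite normrN gtr0_norm.
rewrite -[in RHS](mule1 2%:E) -muleA mul1e -[2%R]/(1 + 1)%R EFinD.
rewrite ge0_muleDl// !mul1e; congr (_ + _)%E.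
apply: eq_integral => t; rewrite mem_Rpos => t0.
by rewrite gtr0_norm.
Qed.

Lemma ge0_integral_Rpos_scale (c : R) (f : R -> \bar R) : 0 < c ->
  measurable_fun [set: R] f -> (forall x, 0 <= f x)%E ->
  (\int[mu]_(x in Rpos R) f x = c%:E * \int[mu]_(x in Rpos R) f (c * x)%R)%E.
Proof.
move=> c0 mf f0; rewrite integral_mkcond (ge0_integral_affine 0 c0); last 2 first.
- by apply/(measurable_restrictT _ _).1; [exact: measurable_itv|exact: measurable_funTS].
- by move=> t; apply: erestrict_ge0.
congr (_ * _)%E; rewrite [RHS]integral_mkcond; apply: eq_integral => t _.
by rewrite addr0 /patch !mem_Rpos pmulr_rgt0.
Qed.

End affine.

(** * Integrals of powers *)

Section power_integrals.
Context {R : realType}.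
Local Notation mu := (@lebesgue_measure R).

Lemma powRDp (x r t : R) : 0 < x -> x `^ (r + t) = x `^ r * x `^ t.
Proof. by move=> x0; rewrite powRD// (gt_eqF x0) implybT. Qed.

Lemma continuous_at_powR (a x : R) : 0 < x -> {for x, continuous (@powR R ^~ a)}.
Proof.
move=> x0; apply: differentiable_continuous; apply/derivable1_diffP.
exact: (@ex_derive _ _ _ _ _ _ _ (is_derive1_powR a x0)).
Qed.

Lemma is_derive_scale_powR (k a t : R) : 0 < t ->
  is_derive t 1 (fun u : R => k * u `^ a) (k * a * t `^ (a - 1)).
Proof.
move=> t0; have D := is_deriveM (is_derive_cst k t 1) (is_derive1_powR a t0).
have E : cst k t *: (a * t `^ (a - 1)) + t `^ a *: 0 = k * a * t `^ (a - 1) :> R.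
  by rewrite scaler0 addr0 /GRing.scale/= mulrA.
by rewrite -E; exact: D.
Qed.

Lemma powR_cvgy (a : R) : 0 < a -> t `^ (- a) @[t --> +oo] --> (0 : R).
Proof.
move=> a0; apply/cvgrPdist_lt => e e0; near=> t.
have t0 : 0 < t by near: t; exact: nbhs_pinfty_gt.
rewrite sub0r normrN ger0_norm ?powR_ge0// powRN invf_plt ?posrE ?powR_gt0//.
have -> : e^-1 = (e^-1 `^ a^-1) `^ a.
  by rewrite -powRrM mulVf ?gt_eqF// powRr1// invr_ge0 ltW.
apply: gt0_ltr_powR => //; rewrite ?nnegrE ?powR_ge0// ?ltW//.
Unshelve. all: by end_near. Qed.

Lemma integral_powR_pinfty (a x : R) : 0 < a -> 0 < x ->
  (\int[mu]_(t in `[x, +oo[) (t `^ (- a - 1))%:E = (x `^ (- a) / a)%:E)%E.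
Proof.
move=> a0 x0.
have -> : x `^ (- a) / a = 0 - (- a^-1 * x `^ (- a)).
  by rewrite sub0r mulNr opprK mulrC.
apply: (@integral_derive_pinfty _ (fun t => - a^-1 * t `^ (- a))).
- move=> t xt; have t0 := lt_le_trans x0 xt.
  have -> : t `^ (- a - 1) = - a^-1 * - a * t `^ (- a - 1).
    by rewrite mulrNN mulVf ?mul1r ?gt_eqF.
  exact: is_derive_scale_powR.
- by move=> t xt; apply: continuous_at_powR; exact: lt_le_trans xt.
- by move=> t _; exact: powR_ge0.
- rewrite -(mulr0 (- a^-1)); apply: cvgM; [exact: cvg_cst|exact: powR_cvgy].
Qed.

Lemma integral_powR_0 (a x : R) : 0 < a -> 0 < x ->
  (\int[mu]_(t in `]0%R, x]) (t `^ (a - 1))%:E <= (x `^ a / a)%:E)%E.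
Proof.
move=> a0 x0.
pose F (n : nat) : set R := `[n.+2%:R^-1 * x, x]%classic.
have FE : `]0, x]%classic = \bigcup_i F i.
  apply/seteqP; split => t /=.
    rewrite in_itv/= => /andP[t0 tx]; have [n _ nE] := (@near_infty_natSinv_lt R (PosNum (divr_gt0 t0 x0))).
    exists n => //; rewrite /F/= in_itv/= tx andbT -ler_pdivlMr//.
    apply: ltW; apply: le_lt_trans (nE n (leqnn _)).
    by rewrite lef_pV2 ?posrE// ler_nat.
  move=> [n _]; rewrite /F/= !in_itv/= => /andP[nt ->]; rewrite andbT.
  by apply: lt_le_trans nt; rewrite mulr_gt0// invr_gt0.
rewrite FE.
have cF := @ge0_nondecreasing_set_cvg_integral _ (measurableTypeR R) R F (fun t => (t `^ (a - 1))%:E) mu.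
rewrite -(cvg_lim _ (cF _ _ _ _))//.
- apply: lime_le.
    apply/cvg_ex; eexists; apply: cF => //.
    + apply/nondecreasing_seqP => n; rewrite subsetEset => t; rewrite /F/= !in_itv/= => /andP[h ->]; rewrite andbT.
      by apply: le_trans h; rewrite ler_pM2r// lef_pV2 ?posrE// ler_nat.
    + by move=> n; exact: measurable_itv.
    + move=> n; apply/measurable_funTS/measurable_EFinP; exact: measurable_powR.
    + by move=> n t _; rewrite lee_fin powR_ge0.
  apply: nearW => n.
  have n0 : 0 < (n.+2%:R^-1 : R) by rewrite invr_gt0.
  apply: (@le_trans _ _ (a^-1 * x `^ a - a^-1 * (n.+2%:R^-1 * x) `^ a)%:E); last first.
    by rewrite lee_fin (mulrC _ a^-1) gerBl mulr_ge0 ?powR_ge0// invr_ge0 ltW.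
  apply: le_of_eq.
  apply: (@integral_derive _ (fun t => a^-1 * t `^ a)).
  + by rewrite gtr_pMl// invf_lt1// ltr1n.
  + move=> t /andP[xt _]; have t0 : 0 < t by apply: lt_le_trans xt; rewrite mulr_gt0.
    have -> : t `^ (a - 1) = a^-1 * a * t `^ (a - 1) by rewrite mulVf ?mul1r ?gt_eqF.
    exact: is_derive_scale_powR.
  + move=> t /andP[xt _]; apply: continuous_at_powR.
    by apply: lt_le_trans xt; rewrite mulr_gt0.
- apply/nondecreasing_seqP => n; rewrite subsetEset => t; rewrite /F/= !in_itv/= => /andP[h ->]; rewrite andbT.
  by apply: le_trans h; rewrite ler_pM2r// lef_pV2 ?posrE// ler_nat.
- by move=> n; exact: measurable_itv.
- by move=> n; apply/measurable_funTS/measurable_EFinP; exact: measurable_powR.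
- by move=> n t _; rewrite lee_fin powR_ge0.
Qed.

End power_integrals.

(** * Measurability and Tonelli *)

Ltac mfun_step := lazymatch goal with
  | |- measurable_fun _ (fun _ => ?c) => exact: measurable_cst
  | |- measurable_fun _ (fun x => x) => exact: measurable_id
  | |- measurable_fun _ fst => exact: measurable_fst
  | |- measurable_fun _ snd => exact: measurable_snd
  | |- measurable_fun _ (fun x => fst x) => exact: measurable_fst
  | |- measurable_fun _ (fun x => snd x) => exact: measurable_snd
  | |- measurable_fun _ (fun x => EFin (@?f x)) =>
      refine ((measurable_EFinP _ f).2 _)
  | |- measurable_fun _ (fun x => GRing.add (@?f x) (GRing.opp (@?g x))) =>
      refine (@measurable_funB _ _ _ _ f g _ _)
  | |- measurable_fun _ (fun x => GRing.add (@?f x) (@?g x)) =>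
      first [refine (@measurable_funD _ _ _ _ f g _ _)
            | apply: (@emeasurable_funD _ _ _ _ f g)]
  | |- measurable_fun _ (fun x => GRing.mul (@?f x) (@?g x)) =>
      first [refine (@measurable_funM _ _ _ _ f g _ _)
            | apply: (@emeasurable_funM _ _ _ _ f g)]
  | |- measurable_fun _ (fun x => GRing.opp (@?f x)) =>
      refine (@measurable_funN _ _ _ _ f _)
  | |- measurable_fun _ (fun x => GRing.exp (@?f x) ?n) =>
      apply: (@measurable_funX _ _ _ _ f n)
  | |- measurable_fun _ (fun x => powR (@?f x) ?p) =>
      refine (@measurableT_comp _ _ _ _ _ _ (@powR _ ^~ p) _ f _ _);
      [exact: measurable_powR|]
  | |- measurable_fun _ (fun x => poweR (@?f x) ?p) =>
      refine (@measurableT_comp _ _ _ _ _ _ (@poweR _ ^~ p) _ f _ _);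
      [exact: measurable_poweR|]
  | |- measurable_fun _ (fun x => powR ?b (@?f x)) =>
      refine (@measurableT_comp _ _ _ _ _ _ (@powR _ b) _ f _ _);
      [exact: measurable_powRr|]
  | |- measurable_fun _ (fun x => expR (@?f x)) =>
      refine (@measurableT_comp _ _ _ _ _ _ expR _ f _ _);
      [exact: measurable_expR|]
  | |- measurable_fun _ (fun x => ln (@?f x)) =>
      refine (@measurableT_comp _ _ _ _ _ _ (@ln _) _ f _ _);
      [exact: measurable_ln|]
  | |- measurable_fun _ (fun x => Num.norm (@?f x)) =>
      apply: (@measurableT_comp _ _ _ _ _ _ _ _ f (@normr_measurable _ setT))
  | |- measurable_fun _ (fun x => mule (@?f x) (@?g x)) =>
      refine (@emeasurable_funM _ _ _ _ f g _ _)
  | |- measurable_fun _ (fun x => adde (@?f x) (@?g x)) =>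
      refine (@emeasurable_funD _ _ _ _ f g _ _)
  | |- measurable_fun _ (fun x => andb (@?f x) (@?g x)) =>
      apply: measurable_and
  | |- measurable_fun _ (fun x => Order.lt (EFin (@?f x)) (@?g x)) =>
      apply: measurable_fun_lte
  | |- measurable_fun _ (fun x => Order.lt (@?f x) (@?g x)) =>
      refine (@measurable_fun_ltr _ _ _ _ f g _ _)
  | |- measurable_fun _ (fun x => Order.le (@?f x) (@?g x)) =>
      refine (@measurable_fun_ler _ _ _ _ f g _ _)
  | |- measurable_fun _ (Order.le ?c) =>
      refine (@measurable_fun_ler _ _ _ _ (fun=> c) (fun x => x) _ _)
  | |- measurable_fun _ (Order.lt ?c) =>
      refine (@measurable_fun_ltr _ _ _ _ (fun=> c) (fun x => x) _ _)
  | |- measurable_fun _ (GRing.mul ?c) =>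
      refine (@measurable_funM _ _ _ _ (fun=> c) (fun x => x) _ _)
  | |- measurable_fun _ (GRing.add ?c) =>
      refine (@measurable_funD _ _ _ _ (fun=> c) (fun x => x) _ _)
  | |- measurable_fun _ (fun x => ?h (@?f x)) =>
      match goal with H : measurable_fun setT h |- _ =>
        refine (@measurableT_comp _ _ _ _ _ _ h _ f H _) end
  | |- measurable_fun _ ?h => first [assumption | apply: measurable_fun_ifT]
  end.
(** Proves measurability by descending through the head symbols of the function. *)
Ltac mfun := cbv beta; repeat mfun_step.

Section tools.
Context {R : realType}.
Local Notation mu := (@lebesgue_measure R).

Lemma tonelli_in (D1 D2 : set R) (f : R -> R -> \bar R) :
  measurable D1 -> measurable D2 ->
  measurable_fun [set: R * R] (fun z => f z.1 z.2) -> (forall x y, 0 <= f x y)%E ->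
  (\int[mu]_(x in D1) \int[mu]_(y in D2) f x y =
   \int[mu]_(y in D2) \int[mu]_(x in D1) f x y)%E.
Proof.
move=> mD1 mD2 mf f0.
pose g := (fun z : R * R => f z.1 z.2) \_ (D1 `*` D2).
have mg : measurable_fun [set: measurableTypeR R * measurableTypeR R] g.
  apply/(measurable_restrictT _ _).1; first exact: measurableX.
  exact: measurable_funTS.
have g0 z : (0 <= g z)%E by apply: erestrict_ge0 => ? _; exact: f0.
transitivity (\int[mu]_x \int[mu]_y g (x, y))%E.
  rewrite integral_mkcond; apply: eq_integral => x _.
  rewrite /patch; case: ifPn => xD; last first.
    rewrite integral0_eq// => y _; rewrite /g/= /patch; case: ifPn => //.
    by rewrite inE => -[/= /mem_set]; rewrite (negbTE xD).
  rewrite integral_mkcond; apply: eq_integral => y _.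
  by rewrite /g /patch/= in_setX/= xD.
rewrite (@fubini_tonelli _ _ _ _ _ mu mu g mg g0).
rewrite [RHS]integral_mkcond; apply: eq_integral => y _.
rewrite /patch; case: ifPn => yD; last first.
  rewrite integral0_eq// => x _; rewrite /g/= /patch; case: ifPn => //.
  by rewrite inE => -[/= _ /mem_set]; rewrite (negbTE yD).
rewrite [RHS]integral_mkcond; apply: eq_integral => x _.
by rewrite /g /patch/= in_setX/= yD andbT.
Qed.

Lemma measurable_integral_in (D2 : set R) (f : R -> R -> \bar R) :
  measurable D2 ->
  measurable_fun [set: R * R] (fun z => f z.1 z.2) -> (forall x y, 0 <= f x y)%E ->
  measurable_fun [set: R] (fun x => \int[mu]_(y in D2) f x y)%E.
Proof.
move=> mD2 mf f0.
pose g := (fun z : R * R => f z.1 z.2) \_ (setT `*` D2).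
have mg : measurable_fun [set: measurableTypeR R * measurableTypeR R] g.
  apply/(measurable_restrictT _ _).1; first exact: measurableX.
  exact: measurable_funTS.
have g0 z : (0 <= g z)%E by apply: erestrict_ge0 => ? _; exact: f0.
have := @measurable_fun_fubini_tonelli_F _ _ _ _ _ mu g mg g0.
apply: eq_measurable_fun => x _; rewrite /fubini_F [in RHS]integral_mkcond.
by apply: eq_integral => y _; rewrite /g /patch/= in_setX/= in_setT.
Qed.

Lemma ge0_integral_lower (D E : set R) (f : R -> \bar R) (c : R) :
  measurable D -> measurable E -> E `<=` D -> measurable_fun D f ->
  (forall x, D x -> 0 <= f x)%E -> 0 <= c -> (forall x, E x -> c%:E <= f x)%E ->
  (c%:E * mu E <= \int[mu]_(x in D) f x)%E.
Proof.
move=> mD mE ED mf f0 c0 cf.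
apply: (@le_trans _ _ (\int[mu]_(x in E) f x)%E); last exact: ge0_subset_integral.
rewrite -integral_cst//; apply: ge0_le_integral => //.
by apply: measurable_funS mf.
Qed.

Lemma ge0_integralZ (D : set R) (k : R) (f : R -> R) : measurable D ->
  measurable_fun [set: R] f -> (forall x, 0 <= f x) -> 0 <= k ->
  (\int[mu]_(x in D) (k * f x)%:E = k%:E * \int[mu]_(x in D) (f x)%:E)%E.
Proof.
move=> mD mf f0 k0; under eq_integral do rewrite EFinM.
apply: ge0_integralZl_EFin => //.
- by move=> x _; rewrite lee_fin.
- by apply/measurable_funTS/measurable_EFinP.
Qed.

Lemma ge0_integral_Rpos_scaleR (c : R) (f : R -> R) : 0 < c ->
  measurable_fun [set: R] f -> (forall x, 0 <= f x) ->
  (\int[mu]_(x in Rpos R) (f x)%:E =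
   \int[mu]_(x in Rpos R) (c * f (c * x))%:E)%E.
Proof.
move=> c0 mf f0; rewrite (ge0_integral_Rpos_scale c0); last 2 first.
- exact/measurable_EFinP.
- by move=> x; rewrite lee_fin.
have mc : measurable_fun [set: R] (fun x => f (c * x)).
  by apply: (measurableT_comp mf); exact: measurable_funM.
by rewrite ge0_integralZ// ltW.
Qed.

Lemma lebesgue_measure_segment (a b : R) : a < b ->
  mu `[a, b]%classic = (b - a)%:E.
Proof. by move=> ab; rewrite lebesgue_measure_itv/= lte_fin ab. Qed.

End tools.

Section mellin.
#[local] Opaque powR expR ln integral.
Context {R : realType}.
Local Notation mu := (@lebesgue_measure R).

(** For e = 1 this is the integral of Gamma a (rescaled by b), and for e = -1 the
integral in time of a Gaussian heat factor; both get the same recurrence. *)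
Definition mellin (e a b : R) : \bar R :=
  (\int[mu]_(t in Rpos R)
     (t `^ (-1) * (t `^ e) `^ a * expR (- (b * t `^ e)))%:E)%E.

Lemma mellin_scale (e a b : R) : e != 0 -> 0 < b ->
  mellin e a b = ((b `^ (- a))%:E * mellin e a 1)%E.
Proof.
move=> e0 b0; rewrite /mellin.
have c0 : 0 < b `^ (- e^-1) by exact: powR_gt0.
have mg : measurable_fun [set: R]
    (fun x => x `^ (-1) * (x `^ e) `^ a * expR (- (b * x `^ e))) by mfun.
have mh : measurable_fun [set: R]
    (fun x => x `^ (-1) * (x `^ e) `^ a * expR (- (1 * x `^ e))) by mfun.
have g0 x : 0 <= x `^ (-1) * (x `^ e) `^ a * expR (- (b * x `^ e)).
  by rewrite !mulr_ge0 ?powR_ge0 ?expR_ge0.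
have h0 x : 0 <= x `^ (-1) * (x `^ e) `^ a * expR (- (1 * x `^ e)).
  by rewrite !mulr_ge0 ?powR_ge0 ?expR_ge0.
have H1 := ge0_integral_Rpos_scaleR c0 mg g0; cbv beta in H1.
have H2 := ge0_integralZ (@measurable_Rpos R) mh h0 (powR_ge0 b (- a)).
cbv beta in H2; rewrite H1 -H2.
apply: eq_integral => t; rewrite mem_Rpos => t0; apply: congr1.
have -> : (b `^ (- e^-1) * t) `^ e = b^-1 * t `^ e.
  rewrite powRM ?powR_ge0 ?(ltW t0)//; congr (_ * _).
  by rewrite -powRrM mulNr mulVf// powR_inv1// ltW.
rewrite powRM ?powR_ge0 ?(ltW t0)// powRM ?powR_ge0 ?invr_ge0 ?(ltW b0)//.
have -> : b^-1 `^ a = b `^ (- a).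
  by rewrite -powR_inv1 ?(ltW b0)// -powRrM mulN1r.
rewrite mul1r (mulrA b) mulfV ?mul1r ?gt_eqF//.
have -> : (b `^ (- e^-1)) `^ (-1) = (b `^ (- e^-1))^-1 by rewrite powR_inv1 ?powR_ge0.
field; exact: lt0r_neq0.
Qed.

(** The exponential as a superposition of exponentials of larger rate. With Tonelli's
theorem and [mellin_scale] it replaces an integration by parts in [mellin_rec]. *)
Lemma expRN_integral (w : R) : 0 < w ->
  (\int[mu]_(v in `[1%R, +oo[) (w * expR (- (v * w)))%:E = (expR (- w))%:E)%E.
Proof.
move=> w0.
have E : expR (- w) = 0 - (- expR (- (1 * w))) by rewrite mul1r sub0r opprK.
rewrite [in RHS]E.
have D (t : R) : is_derive t 1 (fun v : R => - expR (- (v * w))) (w * expR (- (t * w))).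
  have -> : (fun v : R => - expR (- (v * w))) = - (expR \o (fun v => - w * v)).
    by apply/funext => v; rewrite /= /GRing.opp/= mulNr (mulrC v).
  apply: is_derive_eq; rewrite /GRing.scale/=.
  by rewrite !mulr1 mulrN opprK mulNr (mulrC w t) [LHS]mulrC.
apply: (@integral_derive_pinfty _ (fun v => - expR (- (v * w)))).
- move=> t _ /=; apply: continuousM; first exact: cst_continuous.
  apply: (continuous_comp (f := fun v : R => - (v * w))); last exact: continuous_expR.
  by apply: continuousN; apply: continuousM; [exact: cvg_id|exact: cst_continuous].
- by move=> t _; rewrite mulr_ge0 ?expR_ge0 ?ltW.
- rewrite -oppr0; apply: cvgN.
  apply: (@cvg_comp _ _ _ (fun v : R => v * w) (fun u => expR (- u)) _ +oo%R); last exact: cvgr_expR.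
  exact: (gt0_cvgMly w0 cvg_id).
Qed.

Lemma mellin_rec (e a : R) : e != 0 -> 0 < a ->
  mellin e (a + 1) 1 = (a%:E * mellin e a 1)%E.
Proof.
move=> e0 a0.
have E : (mellin e a 1 = (a^-1)%:E * mellin e (a + 1) 1)%E.
  transitivity (\int[mu]_(t in Rpos R) \int[mu]_(v in `[1%R, +oo[)
     (t `^ (-1) * (t `^ e) `^ (a + 1) * expR (- (v * t `^ e)))%:E)%E.
    apply: eq_integral => t; rewrite mem_Rpos => t0.
    rewrite mul1r EFinM -expRN_integral ?powR_gt0//.
    rewrite -ge0_integralZ//; last 3 first.
    + by mfun.
    + by move=> v; rewrite mulr_ge0 ?powR_ge0 ?expR_ge0.
    + by rewrite mulr_ge0 ?powR_ge0.
    apply: eq_integral => v _; congr EFin.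
    rewrite powRDp ?powR_gt0//.
    by rewrite powRr1 ?powR_ge0// !mulrA.
  rewrite tonelli_in//; last 2 first.
  - by mfun.
  - by move=> x y; rewrite lee_fin !mulr_ge0 ?powR_ge0 ?expR_ge0.
  transitivity (\int[mu]_(v in `[1%R, +oo[) ((v `^ (- a - 1))%:E * mellin e (a + 1) 1))%E.
    apply: eq_integral => v; rewrite inE/= in_itv/= andbT => v1.
    rewrite -opprD -mellin_scale ?(lt_le_trans ltr01)//.
  rewrite ge0_integralZr//.
  - by rewrite integral_powR_pinfty// powR1 mul1r.
  - by apply: measurable_funTS; mfun.
  - by move=> v _; rewrite lee_fin powR_ge0.
  - apply: integral_ge0 => t _.
    by rewrite lee_fin !mulr_ge0 ?powR_ge0 ?expR_ge0.
by rewrite E muleA -EFinM mulfV ?gt_eqF// mul1e.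
Qed.

End mellin.

(** * Gamma functions *)

Section gamma.
Context {R : realType}.
Local Notation mu := (@lebesgue_measure R).

(** The first bound is used at the origin, the second one at infinity. *)
Lemma powR_expRN_le (a : R) : 0 < a -> exists2 C : R, 0 < C &
  forall w, 0 < w -> w `^ a * expR (- w) <= C * w `^ a /\
                     w `^ a * expR (- w) <= C * w `^ (- a).
Proof.
move=> a0; pose n := Num.truncn (2 * a).
have C1 : 1 <= 1 + (n.+1)`!%:R :> R by rewrite lerDl ler0n.
exists (1 + (n.+1)`!%:R) => [|w w0]; first exact: lt_le_trans C1.
have e1 : expR (- w) <= 1 by rewrite expR_le1 oppr_le0 ltW.
split.
  rewrite mulrC; apply: ler_wpM2r; first exact: powR_ge0.
  exact: le_trans C1.
have -> : w `^ a = w `^ (2 * a) * w `^ (- a).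
  by rewrite -powRDp//; congr (_ `^ _); ring.
rewrite mulrAC; apply: ler_wpM2r; first exact: powR_ge0.
have [w1|w1] := leP w 1.
  apply: le_trans C1; rewrite -[leRHS]mulr1; apply: ler_pM; rewrite ?powR_ge0 ?expR_ge0//.
  rewrite -[leRHS](powRr0 w); apply: ger_powR; [by rewrite w0 w1|by rewrite mulr_ge0// ltW].
have wn : w `^ (2 * a) <= w ^+ n.+1.
  rewrite -powR_mulrn ?(ltW w0)//; apply: ler_powR; first exact: ltW.
  by rewrite ltW// truncnS_gt.
rewrite expRN ler_pdivrMr ?expR_gt0//; apply: (le_trans wn).
have f0 : 0 < (n.+1)`!%:R :> R by rewrite ltr0n fact_gt0.
rewrite mulrDl mul1r; apply: (@le_trans _ _ ((n.+1)`!%:R * expR w)); last first.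
  by rewrite lerDr expR_ge0.
rewrite mulrC -ler_pdivrMr//; apply: le_trans (expR_ge1Dxn n (ltW w0)).
by rewrite lerDr.
Qed.

Lemma Rpos_split (f : R -> \bar R) : measurable_fun [set: R] f ->
  (forall x, 0 <= f x)%E ->
  (\int[mu]_(x in Rpos R) f x <=
   \int[mu]_(x in `]0%R, 1%R]) f x + \int[mu]_(x in `[1%R, +oo[) f x)%E.
Proof.
move=> mf f0.
have -> : Rpos R = `]0, 1]%classic `|` `]1, +oo[%classic.
  apply/seteqP; split => x; rewrite /Rpos/= !in_itv/= !andbT.
    by move=> ->/=; have [|] := leP x 1; [left|right].
  by move=> [/andP[]//|]; exact: lt_trans.
rewrite ge0_integral_setU//=; last 2 first.
- exact: measurable_funTS.
- apply/disj_setPS => x [] /=; rewrite !in_itv/= andbT => /andP[_ x1].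
  by rewrite ltNge x1.
apply: leeD => //; apply: ge0_subset_integral => //; first exact: measurable_funTS.
by move=> x; rewrite /= !in_itv/= !andbT; exact: ltW.
Qed.

Lemma mellin_lty (e a : R) : (e == 1) || (e == -1) -> 0 < a ->
  (mellin e a 1 < +oo)%E.
Proof.
move=> e1 a0; have [C C0 HC] := powR_expRN_le a0.
apply: le_lt_trans (Rpos_split _ _) _.
- by mfun.
- by move=> x; rewrite lee_fin !mulr_ge0 ?powR_ge0 ?expR_ge0.
have key t : 0 < t ->
    (t `^ e) `^ a * expR (- (1 * t `^ e)) <= C * t `^ a /\
    (t `^ e) `^ a * expR (- (1 * t `^ e)) <= C * t `^ (- a).
  move=> t0; have [h1 h2] := HC _ (powR_gt0 e t0); rewrite mul1r.
  move/orP: e1 => [|] /eqP ee; move: h1 h2; rewrite -2!powRrM ee ?mul1r//.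
  by rewrite mulN1r mulrN mulN1r opprK => h1 h2.
apply: (@le_lt_trans _ _ (C%:E * (1 `^ a / a)%:E + C%:E * (1 `^ (- a) / a)%:E)%E);
  last by rewrite -!EFinM -EFinD ltry.
apply: leeD.
  apply: (@le_trans _ _ (C%:E * \int[mu]_(t in `]0%R, 1%R]) (t `^ (a - 1))%:E)%E); last first.
    by apply: lee_pmul => //; [by rewrite lee_fin ltW|by apply: integral_ge0 => ? _; rewrite lee_fin powR_ge0|exact: integral_powR_0].
  rewrite -ge0_integralZl//; last 3 first.
  - by apply: measurable_funTS; mfun.
  - by move=> x _; rewrite lee_fin powR_ge0.
  - by rewrite lee_fin ltW.
  apply: ge0_le_integral => //.
  - by move=> x _; rewrite lee_fin !mulr_ge0 ?powR_ge0 ?expR_ge0.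
  - by apply: measurable_funTS; mfun.
  - by apply: measurable_funTS; mfun.
  - move=> t; rewrite /= in_itv/= => /andP[t0 _].
    rewrite lee_fin [a - 1]addrC powRDp//.
    rewrite mulrCA -mulrA; apply: ler_wpM2l; first exact: powR_ge0.
    by have [] := key t t0.
rewrite -integral_powR_pinfty// -ge0_integralZl//; last 3 first.
- by apply: measurable_funTS; mfun.
- by move=> x _; rewrite lee_fin powR_ge0.
- by rewrite lee_fin ltW.
apply: ge0_le_integral => //.
- by move=> x _; rewrite lee_fin !mulr_ge0 ?powR_ge0 ?expR_ge0.
- by apply: measurable_funTS; mfun.
- by apply: measurable_funTS; mfun.
- move=> t; rewrite /= in_itv/= andbT => t1; have t0 : 0 < t by exact: lt_le_trans t1.
  rewrite lee_fin [- a - 1]addrC powRDp//.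
  rewrite mulrCA -mulrA; apply: ler_wpM2l; first exact: powR_ge0.
  by have [] := key t t0.
Qed.

(** On [1, 2] all factors are exponentials of bounded quantities. *)
Lemma mellin_gt0 (e a : R) : (0 < mellin e a 1)%E.
Proof.
pose g (t : R) := t `^ (-1) * (t `^ e) `^ a * expR (- (1 * t `^ e)).
have g0 t : 0 < t -> 0 < g t by move=> t0; rewrite !mulr_gt0 ?powR_gt0 ?expR_gt0.
pose m := `|e| * ln 2.
have ln2 : 0 < ln 2 :> R by rewrite ln_gt0// ltr1n.
have lnb t : 1 <= t <= 2 -> `|e * ln t| <= m.
  move=> /andP[t1 t2]; rewrite normrM ler_wpM2l// ger0_norm ?ln_ge0//.
  by rewrite ler_ln ?posrE//; exact: lt_le_trans t1.
pose c := expR (- ln 2 - `|a| * m - expR m).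
apply: (@lt_le_trans _ _ (c%:E * mu `[1%R, 2%R]%classic)%E).
  by rewrite lebesgue_measure_segment ?ltr1n// -EFinM lte_fin mulr_gt0 ?expR_gt0// subr_gt0 ltr1n.
apply: ge0_integral_lower => //.
- by move=> x; rewrite /= RposE in_itv/= => /andP[x1 _]; exact: lt_le_trans x1.
- by apply: measurable_funTS; mfun.
- by move=> x _; rewrite lee_fin !mulr_ge0 ?powR_ge0 ?expR_ge0.
- exact: expR_ge0.
move=> t; rewrite /= in_itv/= => t12; rewrite lee_fin.
have /andP[t1 t2] := t12; have t0 : 0 < t by exact: lt_le_trans t1.
have E b : t `^ b = expR (b * ln t) by rewrite /powR gt_eqF.
rewrite -powRrM !E -!expRD ler_expR mul1r.
have := lnb _ t12; rewrite ler_norml => /andP[_ em].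
have : ln t <= ln 2 by rewrite ler_ln ?posrE.
have : - (`|a| * m) <= e * a * ln t.
  have : `|e * a * ln t| <= `|a| * m.
    by rewrite mulrAC normrM mulrC ler_wpM2l// lnb.
  by rewrite ler_norml => /andP[].
have : expR (e * ln t) <= expR m by rewrite ler_expR.
lra.
Qed.

Lemma Gamma_mellin (s : R) : 0 < s -> (Gamma s)%:E = mellin 1 s 1.
Proof.
move=> s0; rewrite /Gamma /Rintegral fineK.
  apply: eq_integral => t; rewrite mem_Rpos => t0.
  by rewrite mul1r powRr1 ?ltW// [s - 1]addrC powRDp.
have -> : (\int[mu]_(x in Rpos R) (x `^ (s - 1) * expR (- x))%:E = mellin 1 s 1)%E.
  apply: eq_integral => t; rewrite mem_Rpos => t0.
  by rewrite mul1r powRr1 ?ltW// [s - 1]addrC powRDp.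
by rewrite ge0_fin_numE ?mellin_lty ?eqxx// ltW// mellin_gt0.
Qed.

Lemma Gamma_gt0 (s : R) : 0 < s -> 0 < Gamma s.
Proof. by move=> s0; rewrite -lte_fin Gamma_mellin// mellin_gt0. Qed.

Lemma Gamma_rec (s : R) : 0 < s -> Gamma (s + 1) = s * Gamma s.
Proof.
move=> s0; apply: EFin_inj; rewrite EFinM !Gamma_mellin ?addr_gt0//.
by rewrite mellin_rec ?oner_eq0.
Qed.

(** The integral of t^(-a-1) exp(-1/t), which is Gamma a; its recurrence comes from
[mellin_rec] just as that of [Gamma]. *)
Definition invGamma (a : R) := fine (mellin (-1) a 1).

Lemma invGammaE (a : R) : 0 < a -> (invGamma a)%:E = mellin (-1) a 1.
Proof.
move=> a0; rewrite /invGamma fineK// ge0_fin_numE ?mellin_lty ?eqxx ?orbT//.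
by rewrite ltW// mellin_gt0.
Qed.

Lemma invGamma_gt0 (a : R) : 0 < a -> 0 < invGamma a.
Proof. by move=> a0; rewrite -lte_fin invGammaE// mellin_gt0. Qed.

Lemma invGamma_rec (a : R) : 0 < a -> invGamma (a + 1) = a * invGamma a.
Proof.
move=> a0; apply: EFin_inj; rewrite EFinM !invGammaE ?addr_gt0//.
by rewrite mellin_rec ?oppr_eq0 ?oner_eq0.
Qed.

End gamma.

(** * Growth of the coefficients *)

Section coefficients.
Context {R : realType}.

(** Young's inequality for x^t and 1. *)
Lemma powR_bernoulli (x t : R) : 0 < x -> 0 <= t <= 1 -> x `^ t <= 1 + t * (x - 1).
Proof.
move=> x0 /andP[]; rewrite le_eqVlt => /predU1P[<- _|t0].
  by rewrite powRr0 mul0r addr0.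
rewrite le_eqVlt => /predU1P[->|t1].
  by rewrite powRr1 ?(ltW x0)// mul1r addrCA subrr addr0.
have t1' : 0 < 1 - t by rewrite subr_gt0.
have := @conjugate_powR R (x `^ t) 1 t^-1 (1 - t)^-1.
rewrite !invrK powR_ge0 ler01 !invr_gt0 t0 t1' addrCA subrr addr0 => /(_ isT isT isT isT erefl).
rewrite -powRrM mulfV ?gt_eqF// powRr1 ?(ltW x0)// powR1 mulr1 mul1r.
by move=> /le_trans; apply; apply: le_of_eq; ring.
Qed.

(** The quotient (a)_k / k! of a rising factorial. *)
Definition pochR (a : R) (k : nat) : R := \prod_(j < k) ((j%:R + a) / (j%:R + 1)).

Lemma pochR0 a : pochR a 0 = 1. Proof. by rewrite /pochR big_ord0. Qed.

Lemma pochRS a k : pochR a k.+1 = pochR a k * ((k%:R + a) / (k%:R + 1)).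
Proof. by rewrite /pochR big_ord_recr. Qed.

Lemma pochR_shift a k : 0 < a -> pochR (a + 1) k = pochR a k * ((k%:R + a) / a).
Proof.
move=> a0; elim: k => [|k IH]; first by rewrite !pochR0 add0r mulfV ?gt_eqF// mulr1.
rewrite !pochRS IH -natr1.
have k1 : k%:R + 1 != 0 :> R by rewrite gt_eqF// ltr_wpDl.
have a1 : a != 0 by rewrite gt_eqF.
by field; rewrite k1 a1.
Qed.

Let kp (k : nat) : 0 < (k%:R + 1 : R). Proof. by rewrite ltr_wpDl. Qed.

(** The ratio of consecutive terms on each side compares by Bernoulli's inequality
with exponent 1 - a. *)
Lemma pochR_bound_le1 (a : R) (k : nat) : 0 < a <= 1 ->
  a * (k%:R + 1) `^ (a - 1) <= pochR a k <= (k%:R + 1) `^ (a - 1).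
Proof.
move=> /andP[a0 a1]; have t01 : 0 <= 1 - a <= 1 by rewrite subr_ge0 a1 lerBlDr lerDl ltW.
apply/andP; split.
- case: k => [|k]; first by rewrite pochR0 add0r powR1 mulr1.
  suff H : a * (k%:R + 1) `^ (a - 1) <= pochR a k.+1.
    apply: le_trans H; rewrite ler_pM2l// -(opprB 1 a) !powRN lef_pV2 ?posrE ?powR_gt0//.
    by apply: ge0_ler_powR; rewrite ?nnegrE ?(ltW (kp _))//; [by have /andP[] := t01|rewrite lerD2r ler_nat].
  elim: k => [|k IH]; first by rewrite pochRS pochR0 add0r powR1 !mul1r mulr1 add0r divr1.
  rewrite pochRS.
  have E : (k.+1%:R + 1 : R) `^ (a - 1) =
     (k%:R + 1) `^ (a - 1) * ((k%:R + 1) / (k.+1%:R + 1)) `^ (1 - a).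
    rewrite -(opprB 1 a) powRM ?invr_ge0 ?(ltW (kp _))// !powRN.
    rewrite mulrA mulVf ?mul1r; last by rewrite gt_eqF// powR_gt0.
    by rewrite -powR_inv1 ?(ltW (kp _))// powRAC powR_inv1 ?powR_ge0.
  rewrite E mulrA; apply: ler_pM => //.
  + by rewrite mulr_ge0 ?powR_ge0 ?ltW.
  apply: (le_trans (powR_bernoulli _ t01)); first by rewrite divr_gt0.
  rewrite -natr1; apply: le_of_eq.
  have := kp k.+1; rewrite -natr1 => /lt0r_neq0 k1; by field.
- elim: k => [|k IH]; first by rewrite pochR0 add0r powR1.
  rewrite pochRS.
  have E : (k.+1%:R + 1 : R) `^ (a - 1) =
     (k%:R + 1) `^ (a - 1) * (((k.+1%:R + 1) / (k%:R + 1)) `^ (1 - a))^-1.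
    rewrite -(opprB 1 a) powRM ?invr_ge0 ?(ltW (kp _))// !powRN.
    rewrite -(powR_inv1 (ltW (kp k))) (powRAC _ (-1)) powR_inv1 ?powR_ge0//.
    rewrite invfM invrK mulrCA mulVf ?mulr1//.
  rewrite E; apply: ler_pM => //.
  + by apply: prodr_ge0 => j _; rewrite divr_ge0 ?(ltW (kp _))// addr_ge0 ?ler0n ?ltW.
  + by rewrite divr_ge0 ?(ltW (kp _))// addr_ge0 ?ler0n ?ltW.
  have k1 := kp k.
  have X0 : 0 < ((k.+1%:R + 1) / (k%:R + 1) : R) by rewrite divr_gt0.
  rewrite -[leRHS]div1r ler_pdivlMr ?powR_gt0//.
  apply: (@le_trans _ _ ((k%:R + a) / (k%:R + 1) *
      (1 + (1 - a) * ((k.+1%:R + 1) / (k%:R + 1) - 1)))).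
    apply: ler_wpM2l; last exact: powR_bernoulli.
    by rewrite divr_ge0 ?(ltW (kp _))// addr_ge0 ?ler0n ?ltW.
  rewrite -natr1 -subr_ge0.
  have -> : 1 - (k%:R + a) / (k%:R + 1) *
      (1 + (1 - a) * ((k%:R + 1 + 1) / (k%:R + 1) - 1)) =
      ((1 - a) / (k%:R + 1)) ^+ 2.
    by field; exact: lt0r_neq0.
  exact: sqr_ge0.
Qed.

(** Induction on the integer part of a: the shift from a - 1 to a multiplies both
sides by a factor comparable to k + 1. *)
Lemma pochR_bound (a : R) : 0 < a -> exists c C : R, [/\ 0 < c, 0 < C &
  forall k, c * (k%:R + 1) `^ (a - 1) <= pochR a k <= C * (k%:R + 1) `^ (a - 1)].
Proof.
move=> a0; have [n] : exists n : nat, a <= n%:R + 1.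
  by exists (Num.truncn a); rewrite natr1 ltW// truncnS_gt.
elim: n a a0 => [|n IH] a a0 an.
  exists a, 1; split => // k; rewrite mul1r; apply: pochR_bound_le1.
  by rewrite a0 (le_trans an)// add0r.
have [a1|a1] := leP a 1.
  by exists a, 1; split => // k; rewrite mul1r; apply: pochR_bound_le1; rewrite a0.
have b0 : 0 < a - 1 by rewrite subr_gt0.
have [|c [C [c0 C0 H]]] := IH _ b0; first by move: an; rewrite -natr1; lra.
pose b := a - 1; have aE : a = b + 1 by rewrite /b subrK.
exists (c * Num.min 1 b^-1), (C * Num.max 1 b^-1); split.
- by rewrite mulr_gt0// lt_min ltr01 invr_gt0.
- by rewrite mulr_gt0// lt_max ltr01.
move=> k; have /andP[h1 h2] := H k; rewrite -/b in h1 h2 b0.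
rewrite -/b (_ : pochR a k = pochR b k * ((k%:R + b) / b)); last by rewrite aE pochR_shift.
have -> : (k%:R + 1 : R) `^ b = (k%:R + 1) `^ (b - 1) * (k%:R + 1).
  by rewrite -[X in _ * X](powRr1 (ltW (kp k))) -powRDp// subrK.
rewrite -!mulrA !(mulrCA (Num.min _ _)) !(mulrCA (Num.max _ _)) !(mulrA c) !(mulrA C).
have m1 : Num.min 1 b^-1 * (k%:R + 1) <= (k%:R + b) / b.
  rewrite mulrDr mulr1 mulrDl mulfV ?gt_eqF//; apply: lerD; last by rewrite ge_min lexx.
  by rewrite mulrC; apply: ler_wpM2l => //; rewrite ge_min lexx orbT.
have m2 : (k%:R + b) / b <= Num.max 1 b^-1 * (k%:R + 1).
  rewrite mulrDr mulr1 mulrDl mulfV ?gt_eqF//; apply: lerD; last by rewrite le_max lexx.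
  by rewrite [leRHS]mulrC; apply: ler_wpM2l => //; rewrite le_max lexx orbT.
apply/andP; split; apply: ler_pM => //.
- by rewrite mulr_ge0 ?powR_ge0 ?ltW.
- by rewrite mulr_ge0 ?(ltW (kp _))// le_min ler01 invr_ge0 ltW.
- by apply: le_trans h1; rewrite mulr_ge0 ?powR_ge0 ?ltW.
- by rewrite divr_ge0 ?(ltW b0)// addr_ge0 ?ler0n ?ltW.
Qed.

Lemma Gamma_poch (a : R) k : 0 < a -> Gamma (a + k%:R) = Gamma a * (pochR a k * k`!%:R).
Proof.
move=> a0; elim: k => [|k IH]; first by rewrite addr0 pochR0 fact0 !mulr1.
have ak : 0 < a + k%:R by rewrite ltr_wpDr.
rewrite -natr1 addrA Gamma_rec// IH pochRS factS natrM -natr1.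
by field; exact: lt0r_neq0.
Qed.

(** Of the 2 k factors produced by the recurrence, those of even and of odd offset
make up the rising factorials of c/2 and (c + 1)/2. *)
Lemma invGamma_poch (c : R) k : 0 < c ->
  invGamma (c + 2 * k%:R) =
  invGamma c * 4 ^+ k * (pochR (c / 2) k * pochR ((c + 1) / 2) k * k`!%:R ^+ 2).
Proof.
move=> c0; elim: k => [|k IH]; first by rewrite mulr0 addr0 !pochR0 fact0 expr0 expr1n !mulr1.
have ck : 0 < c + 2 * k%:R by rewrite ltr_wpDr// mulr_ge0.
have -> : c + 2 * k.+1%:R = c + 2 * k%:R + 1 + 1 by rewrite -[k.+1%:R]natr1; ring.
rewrite invGamma_rec; last exact: addr_gt0.
rewrite invGamma_rec// IH !pochRS factS natrM -[k.+1%:R]natr1 [4 ^+ k.+1]exprS.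
by field; exact: lt0r_neq0.
Qed.

(** Coefficient of r^k in the series of the kernel. *)
Definition kcoef (a s : R) (k : nat) : R :=
  invGamma (a + 1 - s + 2 * k%:R) / (4 ^+ k * k`!%:R * Gamma (a + k%:R + 1)).

Lemma kcoef_gt0 (a s : R) k : -1 < a -> s < a + 1 -> 0 < kcoef a s k.
Proof.
move=> a1 sa; rewrite divr_gt0 ?invGamma_gt0//.
  by rewrite ltr_wpDr ?mulr_ge0// subr_gt0.
rewrite !mulr_gt0 ?exprn_gt0 ?ltr0n ?fact_gt0// Gamma_gt0//.
have : 0 <= k%:R :> R by []. lra.
Qed.

(** With c = a + 1 - s, the coefficient is a constant times the quotient of
(c/2)_k ((c + 1)/2)_k by (a + 1)_k k!, and the growth exponents of these rising
factorials add up to - s - 1/2. *)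
Lemma kcoef_bound (a s : R) : -1 < a -> s < a + 1 ->
  exists c C : R, [/\ 0 < c, 0 < C & forall k,
    c * (k%:R + 1) `^ (- s - 1 / 2) <= kcoef a s k <= C * (k%:R + 1) `^ (- s - 1 / 2)].
Proof.
move=> a1 sa; have c0 : 0 < a + 1 - s by rewrite subr_gt0.
have a0 : 0 < a + 1 by lra.
have [c1 [C1 [c10 C10 H1]]] := @pochR_bound ((a + 1 - s) / 2) ltac:(lra).
have [c2 [C2 [c20 C20 H2]]] := @pochR_bound ((a + 1 - s + 1) / 2) ltac:(lra).
have [c3 [C3 [c30 C30 H3]]] := pochR_bound a0.
pose M := invGamma (a + 1 - s) / Gamma (a + 1).
have M0 : 0 < M by rewrite divr_gt0 ?invGamma_gt0 ?Gamma_gt0.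
exists (M * (c1 * c2 / C3)), (M * (C1 * C2 / c3)); split.
- by apply: mulr_gt0 => //; apply: divr_gt0 => //; exact: mulr_gt0.
- by apply: mulr_gt0 => //; apply: divr_gt0 => //; exact: mulr_gt0.
move=> k; have k1 := kp k.
have p1 e : 0 < (k%:R + 1 : R) `^ e by exact: powR_gt0.
have /andP[h1 h1'] := H1 k; have /andP[h2 h2'] := H2 k; have /andP[h3 h3'] := H3 k.
have P3 : 0 < pochR (a + 1) k by apply: lt_le_trans h3; rewrite mulr_gt0.
have -> : kcoef a s k = M *
    (pochR ((a + 1 - s) / 2) k * pochR ((a + 1 - s + 1) / 2) k / pochR (a + 1) k).
  rewrite /kcoef invGamma_poch// [a + k%:R + 1]addrAC Gamma_poch// /M.
  field; rewrite !gt_eqF ?Gamma_gt0 ?exprn_gt0 ?ltr0n ?fact_gt0//.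
have -> : (k%:R + 1 : R) `^ (- s - 1 / 2) =
    (k%:R + 1) `^ ((a + 1 - s) / 2 - 1) * (k%:R + 1) `^ ((a + 1 - s + 1) / 2 - 1) /
    (k%:R + 1) `^ (a + 1 - 1).
  by rewrite -powRN -!powRDp//; congr (_ `^ _); field.
move: h1 h1' h2 h2' h3 h3'.
set X := _ `^ ((a + 1 - s) / 2 - 1); set Y := _ `^ ((a + 1 - s + 1) / 2 - 1).
set Z := _ `^ (a + 1 - 1); move=> h1 h1' h2 h2' h3 h3'.
have X0 : 0 < X := p1 _; have Y0 : 0 < Y := p1 _; have Z0 : 0 < Z := p1 _.
apply/andP; split; rewrite -[M * _ * (_ / Z)]mulrA ler_pM2l//.
- apply: (@le_trans _ _ ((c1 * X) *
     (c2 * Y) / (C3 * Z))).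
    by apply: le_of_eq; field; rewrite !gt_eqF.
  apply: ler_pM; rewrite ?invr_ge0 ?mulr_ge0 ?(ltW X0) ?(ltW Y0) ?(ltW Z0) ?(ltW c10) ?(ltW c20) ?(ltW C30)//.
    by apply: ler_pM; rewrite ?mulr_ge0 ?(ltW X0) ?(ltW Y0) ?(ltW Z0) ?(ltW c10) ?(ltW c20).
  by rewrite lef_pV2 ?posrE ?mulr_gt0.
- apply: (@le_trans _ _ ((C1 * X) *
     (C2 * Y) / (c3 * Z))); last first.
    by apply: le_of_eq; field; rewrite !gt_eqF.
  have q1 : 0 < pochR ((a + 1 - s) / 2) k by apply: lt_le_trans h1; rewrite mulr_gt0.
  have q2 : 0 < pochR ((a + 1 - s + 1) / 2) k by apply: lt_le_trans h2; rewrite mulr_gt0.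
  apply: ler_pM; rewrite ?invr_ge0 ?mulr_ge0 ?(ltW q1) ?(ltW q2) ?(ltW P3)//.
    by apply: ler_pM; rewrite ?(ltW q1) ?(ltW q2).
  by rewrite lef_pV2 ?posrE ?mulr_gt0.
Qed.

End coefficients.

(** * The kernel as a power series *)

Section kernel_series.
#[local] Opaque Gamma invGamma mellin powR expR ln integral.
Context {R : realType}.
Local Notation mu := (@lebesgue_measure R).
Variables (a s : R).
Hypotheses (a1 : -1 < a) (s0 : 0 < s) (sa : s < a + 1).

Definition bessel_term (z : R) (k : nat) : R :=
  (z / 2) `^ (a + 2 * k%:R) / (k`!%:R * Gamma (a + k%:R + 1)).

Let ak0 (k : nat) : 0 < a + k%:R + 1.
Proof. by rewrite addrAC ltr_wpDr// -ltrBlDr sub0r. Qed.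

Let den0 (k : nat) : 0 < k`!%:R * Gamma (a + k%:R + 1).
Proof. by rewrite mulr_gt0 ?ltr0n ?fact_gt0// Gamma_gt0. Qed.

Let bessel_term_ge0 z k : 0 <= bessel_term z k.
Proof. by rewrite divr_ge0 ?powR_ge0// ltW. Qed.

(** Makes the Bessel series comparable with that of the exponential. *)
Lemma Gamma_shift_lb : exists2 c, 0 < c & forall k : nat, c <= Gamma (a + k%:R + 1).
Proof.
exists (Num.min (Gamma (a + 1)) (Gamma (a + 1 + 1))).
  have h1 : 0 < a + 1 by move: a1; lra.
  by rewrite lt_min !Gamma_gt0//; exact: addr_gt0.
case=> [|k]; first by rewrite addr0 ge_min lexx.
apply: (@le_trans _ _ (Gamma (a + 1 + 1))); first by rewrite ge_min lexx orbT.
elim: k => [|k IH]; first exact: lexx.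
have -> : a + k.+2%:R + 1 = a + k.+1%:R + 1 + 1 by rewrite -[k.+2%:R]natr1; ring.
rewrite [leRHS]Gamma_rec//; apply: (le_trans IH); rewrite ler_peMl//.
  by rewrite ltW// Gamma_gt0.
by rewrite -[k.+1%:R]natr1; have : 0 <= k%:R :> R by []; move: a1; lra.
Qed.

Lemma besselI_cvg z : 0 < z -> cvgn (series (bessel_term z)).
Proof.
move=> z0; have [c c0 Hc] := Gamma_shift_lb.
have z20 : 0 < z / 2 by rewrite divr_gt0.
apply: (@series_le_cvg _ _ (fun k => (z / 2) `^ a / c * exp_coeff ((z / 2) ^+ 2) k)).
- exact: bessel_term_ge0.
- move=> k; apply: mulr_ge0; first by rewrite divr_ge0 ?powR_ge0 ?(ltW c0).
  by apply: divr_ge0 => //; rewrite exprn_ge0// sqr_ge0.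
- move=> k; rewrite /bessel_term /exp_coeff /=.
  rewrite powRDp//.
  have -> : (z / 2) `^ (2 * k%:R) = ((z / 2) ^+ 2) ^+ k.
    by rewrite -natrM powR_mulrn ?(ltW z20)// exprM.
  set u := _ `^ a; set v := (_ ^+ 2) ^+ k; set f := k`!%:R; set G := Gamma _.
  have -> : u * v / (f * G) = (u * (v / f)) * G^-1 by rewrite invfM; ring.
  have -> : u / c * (v / f) = (u * (v / f)) * c^-1 by ring.
  apply: ler_wpM2l; last by rewrite lef_pV2 ?posrE ?Gamma_gt0// /G.
  by rewrite mulr_ge0 ?powR_ge0 ?divr_ge0 ?ler0n// exprn_ge0// sqr_ge0.
- exact/is_cvg_seriesZ/is_cvg_series_exp_coeff.
Qed.

Lemma besselIE z : 0 < z ->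
  ((besselI a z)%:E = \sum_(k <oo) (bessel_term z k)%:E)%E.
Proof.
move=> z0; rewrite /besselI -EFin_lim; last exact: besselI_cvg.
by apply/congr_lim/funext => n /=; rewrite sumEFin.
Qed.

Definition heat_coef (x y : R) k : R :=
  Num.sqrt (x * y) / 2 * (x * y / 4) `^ (a + 2 * k%:R) / (k`!%:R * Gamma (a + k%:R + 1)).

Let heat_coef_ge0 x y k : 0 <= heat_coef x y k.
Proof.
apply: divr_ge0; last exact: ltW.
by apply: mulr_ge0; [rewrite divr_ge0 ?sqrtr_ge0|exact: powR_ge0].
Qed.

Lemma heat_kernel_term (t x y : R) (k : nat) : 0 < t -> 0 < x -> 0 < y ->
  Num.sqrt (x * y) / (2 * t) * expR (- (x ^+ 2 + y ^+ 2) / (4 * t)) *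
    bessel_term (x * y / (2 * t)) k * t `^ (s - 1) =
  heat_coef x y k * (t `^ (-1) * (t `^ (-1)) `^ (a + 1 - s + 2 * k%:R) *
    expR (- ((x ^+ 2 + y ^+ 2) / 4 * t `^ (-1)))).
Proof.
move=> t0 x0 y0; have P0 : 0 < x * y / 4 by rewrite divr_gt0// mulr_gt0.
have ti : t `^ (-1) = t^-1 by rewrite powR_inv1// ltW.
have tN p : (t^-1) `^ p = t `^ (- p) by rewrite -ti -powRrM mulN1r.
rewrite /bessel_term /heat_coef.
have -> : x * y / (2 * t) / 2 = x * y / 4 * t^-1 by field; exact: lt0r_neq0.
rewrite powRM ?invr_ge0 ?(ltW t0) ?(ltW P0)// ti !tN.
have -> : t `^ (- (a + 1 - s + 2 * k%:R)) = t `^ (- (a + 2 * k%:R)) * t `^ (s - 1).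
  by rewrite -powRDp//; congr (_ `^ _); ring.
have -> : - (x ^+ 2 + y ^+ 2) / (4 * t) = - ((x ^+ 2 + y ^+ 2) / 4 / t).
  by field; exact: lt0r_neq0.
set E := expR _; set G := _ * Gamma _; set U := _ `^ (s - 1).
set V := _ `^ _; set W := _ `^ _.
by field; rewrite !gt_eqF// /G.
Qed.

Lemma heat_kernelE (t x y : R) : 0 < t -> 0 < x -> 0 < y ->
  ((heat_kernel a t x y * t `^ (s - 1))%:E =
   \sum_(k <oo) (heat_coef x y k * (t `^ (-1) * (t `^ (-1)) `^ (a + 1 - s + 2 * k%:R) *
    expR (- ((x ^+ 2 + y ^+ 2) / 4 * t `^ (-1)))))%:E)%E.
Proof.
move=> t0 x0 y0; rewrite /heat_kernel.
have z0 : 0 < x * y / (2 * t) by rewrite divr_gt0 ?mulr_gt0.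
rewrite -[X in (X)%:E]mulrA [besselI a _ * _]mulrC mulrA EFinM besselIE// -nneseriesZl; last first.
  by move=> k _; rewrite lee_fin bessel_term_ge0.
apply: eq_eseriesr => k _; rewrite -EFinM -heat_kernel_term//.
by rewrite mulrAC.
Qed.

Definition kconst : R := (2 * Gamma s)^-1 * 4 `^ (1 - s).

Lemma kconst_gt0 : 0 < kconst.
Proof. by rewrite mulr_gt0 ?powR_gt0// invr_gt0 mulr_gt0// Gamma_gt0. Qed.

(** The variable r of the series, at most 1, with equality on the diagonal only. *)
Definition kratio (x y : R) : R := (2 * (x * y) * (x ^+ 2 + y ^+ 2) `^ (-1)) ^+ 2.

Definition kprefac (x y : R) : R :=
  kconst * (x * y) `^ (a + 1 / 2) * (x ^+ 2 + y ^+ 2) `^ (- (a + 1 - s)).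

(** In this form the kernel is visibly measurable in (x, y) jointly, as Tonelli's
theorem requires. *)
Definition kser (x y : R) : \bar R :=
  ((kprefac x y)%:E * \sum_(k <oo) (kcoef a s k * kratio x y ^+ k)%:E)%E.

Lemma kser_coef (x y : R) k : 0 < x -> 0 < y ->
  (Gamma s)^-1 * (heat_coef x y k * (((x ^+ 2 + y ^+ 2) / 4) `^ (- (a + 1 - s + 2 * k%:R)) *
     invGamma (a + 1 - s + 2 * k%:R))) =
  kprefac x y * (kcoef a s k * kratio x y ^+ k).
Proof.
move=> x0 y0; have P0 : 0 < x * y by rewrite mulr_gt0.
have Q0 : 0 < x ^+ 2 + y ^+ 2 by rewrite addr_gt0// exprn_gt0.
have G0 := Gamma_gt0 s0.
rewrite /kprefac /heat_coef /kcoef /kratio /kconst.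
set Q := _ + _ in Q0 *; set P := x * y in P0 *.
have Q40 : 0 < Q / 4 by rewrite divr_gt0.
have P40 : 0 < P / 4 by rewrite divr_gt0.
rewrite -powR12_sqrt ?(ltW P0)// (powR_inv1 (ltW Q0)) [P `^ (a + 1 / 2)]powRDp// div1r.
rewrite (powRDp a) // opprD (powRDp _ _ Q40).
have -> : (P / 4) `^ (2 * k%:R) = ((P / 4) ^+ 2) ^+ k.
  by rewrite -natrM powR_mulrn ?(ltW P40)// exprM.
have -> : (Q / 4) `^ (- (2 * k%:R)) = ((Q / 4) ^- 2) ^+ k.
  by rewrite powRN -natrM powR_mulrn ?(ltW Q40)// exprM exprVn.
have -> : (P / 4) `^ a = P `^ a / 4 `^ a.
  by rewrite powRM ?(ltW P0) ?invr_ge0// -powRN -[4^-1]powR_inv1// -powRrM mulN1r.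
have -> : (Q / 4) `^ (- (a + 1 - s)) = Q `^ (- (a + 1 - s)) * 4 `^ a * 4 `^ (1 - s).
  rewrite powRM ?(ltW Q0) ?invr_ge0// -[4^-1]powR_inv1// -powRrM mulN1r opprK.
  by rewrite -mulrA -powRDp//; congr (_ * _ `^ _); ring.
have -> : ((2 * P / Q) ^+ 2) ^+ k = 4 ^+ k * ((P / 4) ^+ 2) ^+ k * ((Q / 4) ^- 2) ^+ k.
  rewrite -!exprMn; congr (_ ^+ _); field; exact: lt0r_neq0.
have p4 : 0 < (4 : R) `^ a by exact: powR_gt0.
set u := ((P / 4) ^+ 2) ^+ k; set v := ((Q / 4) ^- 2) ^+ k.
set w1 := P `^ a; set w2 := P `^ 2^-1; set w3 := Q `^ _; set w4 := 4 `^ (1 - s).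
set ig := invGamma _; set G1 := Gamma (a + _ + 1).
have f0 : 0 < k`!%:R :> R by rewrite ltr0n fact_gt0.
have G10 : 0 < G1 by exact: Gamma_gt0.
have p4k : 0 < (4 : R) ^+ k by exact: exprn_gt0.
by field; rewrite !gt_eqF.
Qed.

(** Every term of the series is positive, so that the sum may be exchanged with the
integral in time, and each integral is [mellin] with e = -1. *)
Lemma potential_kernelE (x y : R) : 0 < x -> 0 < y ->
  potential_kernel a s x y = kser x y.
Proof.
move=> x0 y0; rewrite /potential_kernel /kser.
have Q0 : 0 < (x ^+ 2 + y ^+ 2) / 4 by rewrite divr_gt0// addr_gt0// exprn_gt0.
have g0 k : 0 < a + 1 - s + 2 * k%:R by rewrite ltr_wpDr ?mulr_ge0// subr_gt0.
rewrite (_ : (\int[mu]_(t in Rpos R) _)%E = (\int[mu]_(t in Rpos R)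
   \sum_(k <oo) (heat_coef x y k * (t `^ (-1) * (t `^ (-1)) `^ (a + 1 - s + 2 * k%:R) *
    expR (- ((x ^+ 2 + y ^+ 2) / 4 * t `^ (-1)))))%:E)%E); last first.
  by apply: eq_integral => t; rewrite mem_Rpos => t0; exact: heat_kernelE.
rewrite integral_nneseries//; last 2 first.
- by move=> k; apply: measurable_funTS; mfun.
- by move=> k t _; rewrite lee_fin; apply: mulr_ge0; [exact: heat_coef_ge0|rewrite !mulr_ge0 ?powR_ge0 ?expR_ge0].
rewrite -!nneseriesZl; last 2 first.
- move=> k _; rewrite lee_fin mulr_ge0 ?(ltW (kcoef_gt0 _ _ _))//.
  by rewrite exprn_ge0// sqr_ge0.
- move=> k _; apply: integral_ge0 => t _.
  by rewrite lee_fin; apply: mulr_ge0; [exact: heat_coef_ge0|rewrite !mulr_ge0 ?powR_ge0 ?expR_ge0].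
apply: eq_eseriesr => k _; rewrite -EFinM -kser_coef// EFinM.
congr (_ * _)%E.
have mg : measurable_fun [set: R] (fun t => t `^ (-1) * (t `^ (-1)) `^ (a + 1 - s + 2 * k%:R) *
    expR (- ((x ^+ 2 + y ^+ 2) / 4 * t `^ (-1)))) by mfun.
have gg0 t : 0 <= t `^ (-1) * (t `^ (-1)) `^ (a + 1 - s + 2 * k%:R) *
    expR (- ((x ^+ 2 + y ^+ 2) / 4 * t `^ (-1))).
  by rewrite !mulr_ge0 ?powR_ge0 ?expR_ge0.
have H2 := ge0_integralZ (@measurable_Rpos R) mg gg0 (heat_coef_ge0 x y k).
cbv beta in H2; rewrite H2 [in RHS]EFinM; congr (_ * _)%E.
rewrite [in RHS]EFinM invGammaE// -mellin_scale ?oppr_eq0 ?oner_eq0//.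
Qed.

Lemma kratio_ge0 x y : 0 <= kratio x y. Proof. exact: sqr_ge0. Qed.

Lemma kprefac_ge0 x y : 0 <= kprefac x y.
Proof.
apply: mulr_ge0; last exact: powR_ge0.
by apply: mulr_ge0; [exact: ltW kconst_gt0|exact: powR_ge0].
Qed.

Lemma kser_ge0 x y : (0 <= kser x y)%E.
Proof.
apply: mule_ge0; first by rewrite lee_fin kprefac_ge0.
apply: nneseries_ge0 => k _ _; rewrite lee_fin mulr_ge0 ?(ltW (kcoef_gt0 _ _ _))//.
by rewrite exprn_ge0// kratio_ge0.
Qed.

Lemma measurable_kser : measurable_fun [set: R * R] (fun z => kser z.1 z.2).
Proof.
apply: emeasurable_funM; first by rewrite /kprefac; mfun.
apply: (@ge0_emeasurable_sum _ _ _ _ (fun k z => (kcoef a s k * kratio z.1 z.2 ^+ k)%:E) xpredT).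
- move=> k z _ _; rewrite lee_fin mulr_ge0 ?(ltW (kcoef_gt0 _ _ _))//.
  by rewrite exprn_ge0// kratio_ge0.
- by move=> k _; rewrite /kratio; mfun.
Qed.

End kernel_series.

(** * Power series with power weights *)

Section power_sums.
#[local] Opaque Gamma invGamma mellin powR expR ln integral.
Context {R : realType}.
Implicit Types (r t : R).

Let kp (k : nat) : 0 < (k%:R + 1 : R). Proof. by rewrite ltr_wpDl. Qed.

Lemma ler_powRp (e x y : R) : 0 <= e -> 0 <= x -> x <= y -> x `^ e <= y `^ e.
Proof.
move=> e0 x0 xy; apply: ge0_ler_powR; rewrite ?nnegrE//.
exact: le_trans xy.
Qed.

Lemma ler_powRn (e x y : R) : e <= 0 -> 0 < x -> x <= y -> y `^ e <= x `^ e.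
Proof.
move=> e0 x0 xy; have y0 : 0 < y by exact: lt_le_trans xy.
rewrite -[e]opprK !(powRN _ (- e)) lef_pV2 ?posrE ?powR_gt0//.
by apply: ler_powRp => //; rewrite ?oppr_ge0// ltW.
Qed.

Lemma powR_inv (x z : R) : 0 <= x -> x^-1 `^ z = x `^ (- z).
Proof. by move=> x0; rewrite -powR_inv1// -powRrM mulN1r. Qed.

Lemma powR_le_comparable (e m L v : R) : 0 < m -> 1 <= L -> m <= v <= L * m ->
  L `^ (- `|e|) * m `^ e <= v `^ e <= L `^ `|e| * m `^ e.
Proof.
move=> m0 L1 /andP[mv vL]; have L0 : 0 < L by exact: lt_le_trans L1.
have v0 : 0 < v by exact: lt_le_trans mv.
have ge1 z : 0 <= z -> 1 <= L `^ z.
  by move=> z0; rewrite -(powRr0 L); exact: ler_powR.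
have le1 z : 0 <= z -> L `^ (- z) <= 1.
  by move=> z0; rewrite powRN invf_le1 ?powR_gt0// ge1.
have Lm : 0 < L * m by exact: mulr_gt0.
have [e0|e0] := leP 0 e.
  rewrite ger0_norm//; apply/andP; split.
    apply: (@le_trans _ _ (m `^ e)); first by rewrite ler_piMl ?powR_ge0 ?le1.
    by apply: ler_powRp => //; exact: ltW.
  by rewrite -powRM ?(ltW m0) ?(ltW L0)//; apply: ler_powRp => //; exact: ltW.
have ne0 : 0 <= - e by rewrite oppr_ge0 ltW.
rewrite ltr0_norm// opprK; apply/andP; split.
  by rewrite -powRM ?(ltW m0) ?(ltW L0)//; apply: ler_powRn => //; exact: ltW.
apply: (@le_trans _ _ (m `^ e)); last by rewrite ler_peMl ?powR_ge0 ?ge1.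
by apply: ler_powRn => //; exact: ltW.
Qed.

Lemma geometric_sum_le r n : 0 <= r < 1 -> \sum_(k < n) r ^+ k <= (1 - r)^-1.
Proof.
move=> /andP[r0 r1]; have d0 : 0 < 1 - r by rewrite subr_gt0.
rewrite -[leRHS]div1r ler_pdivlMr//.
have -> : (\sum_(k < n) r ^+ k) * (1 - r) = 1 - r ^+ n.
  by rewrite mulrC -opprB mulNr -subrX1 opprB.
by rewrite gerBl exprn_ge0.
Qed.

(** The increment of x^t / t over [n, n + 1] dominates its derivative at the right
end, by concavity. *)
Lemma powR_sub_ge t n : 0 < t <= 1 ->
  n%:R `^ t / t + (n%:R + 1) `^ (t - 1) <= (n%:R + 1) `^ t / t.
Proof.
move=> /andP[t0 t1]; case: n => [|n].
  by rewrite powR0 ?gt_eqF// mul0r !add0r !powR1 div1r invf_ge1.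
have n1 := kp n.+1; have n0 : 0 < n.+1%:R :> R by [].
have -> : (n.+1%:R : R) `^ t = (n.+1%:R + 1) `^ t * (n.+1%:R / (n.+1%:R + 1)) `^ t.
  rewrite -powRM ?(ltW n1)// ?divr_ge0 ?(ltW n1)//; congr (_ `^ _).
  by field; exact: lt0r_neq0.
have := @powR_bernoulli R (n.+1%:R / (n.+1%:R + 1)) t.
rewrite divr_gt0// (ltW t0) t1 => /(_ isT isT) H.
rewrite powRDp// powRN powRr1 ?(ltW n1)//.
have p0 : 0 < (n.+1%:R + 1 : R) `^ t by exact: powR_gt0.
rewrite -mulrA -mulrDr ler_pM2l// -lerBrDr ler_pdivrMr//.
apply: (le_trans H); apply: le_of_eq.
by field; rewrite !gt_eqF.
Qed.

(** Below N the factor r^k is dropped, above N the weight is replaced by its value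
at N. *)
Lemma weighted_sum_le t r (N n : nat) : 0 < t <= 1 -> 0 <= r <= 1 -> (0 < N)%N ->
  \sum_(k < n) (k%:R + 1) `^ (t - 1) * r ^+ k <=
  (minn n N)%:R `^ t / t + N%:R `^ (t - 1) * \sum_(k < n) r ^+ k.
Proof.
move=> t01 /andP[r0 r1] N0; have /andP[t0 t1] := t01; elim: n => [|n IH].
  by rewrite !big_ord0 min0n powR0 ?gt_eqF// mul0r mulr0 addr0.
rewrite !big_ord_recr/= mulrDr addrA.
have [nN|Nn] := ltnP n N.
  rewrite (minn_idPl _)//; move: IH; rewrite (minn_idPl _) ?(ltnW nN)// => IH.
  have S := powR_sub_ge n t01; rewrite natr1 in S.
  have H1 : (n%:R + 1) `^ (t - 1) * r ^+ n <= n.+1%:R `^ (t - 1).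
    by rewrite natr1 ler_piMr ?powR_ge0// exprn_ile1.
  have H2 : 0 <= N%:R `^ (t - 1) * r ^+ n by rewrite mulr_ge0 ?powR_ge0 ?exprn_ge0.
  move: IH S H1 H2; rewrite !natr1; lra.
rewrite (minn_idPr _) ?(leqW Nn)//; move: IH; rewrite (minn_idPr _)// => IH.
apply: lerD => //; apply: ler_wpM2r; first exact: exprn_ge0.
apply: ler_powRn; rewrite ?subr_le0 ?ltr0n//.
by rewrite natr1 ler_nat leqW.
Qed.

(** [weighted_sum_le] with N of order 1 / (1 - r), which balances the two terms. *)
Lemma power_series_upper t : 0 < t < 1 -> exists2 C : R, 0 < C &
  forall r, 0 <= r < 1 -> (\sum_(k <oo) ((k%:R + 1) `^ (t - 1) * r ^+ k)%:E <=
    (C * (1 - r) `^ (- t))%:E)%E.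
Proof.
move=> /andP[t0 t1]; exists (2 `^ t / t + 1).
  by rewrite addr_gt0// divr_gt0// powR_gt0.
move=> r r01; have /andP[r0 r1] := r01; have d0 : 0 < 1 - r by rewrite subr_gt0.
have u0 (k : nat) : 0 <= (k%:R + 1) `^ (t - 1) * r ^+ k.
  by rewrite mulr_ge0 ?powR_ge0 ?exprn_ge0.
apply: lime_le; first by apply: is_cvg_nneseries => k _ _; rewrite lee_fin.
apply: nearW => n; rewrite sumEFin lee_fin big_mkord.
pose N := (Num.truncn (1 - r)^-1).+1.
have N1 : (1 - r)^-1 <= N%:R by rewrite ltW// truncnS_gt.
have N2 : N%:R <= 2 * (1 - r)^-1.
  rewrite /N -[X in X <= _]natr1 mulr_natl mulr2n; apply: lerD.
    by rewrite truncn_le// invr_ge0 ltW.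
  by rewrite invf_ge1// gerBl.
apply: (le_trans (weighted_sum_le (N := N) n _ _ _)) => //.
- by rewrite t0 ltW.
- by rewrite r0 ltW.
have di : 0 < (1 - r)^-1 by rewrite invr_gt0.
have diE z : (1 - r)^-1 `^ z = (1 - r) `^ (- z) by rewrite powR_inv// ltW.
rewrite mulrDl mul1r; apply: lerD.
  rewrite mulrAC ler_pM2r ?invr_gt0//.
  apply: (@le_trans _ _ (N%:R `^ t)).
    by apply: ler_powRp; rewrite ?ler_nat ?geq_minr// ltW.
  rewrite -diE -powRM ?(ltW di)//.
  by apply: ler_powRp => //; exact: ltW.
apply: (@le_trans _ _ (N%:R `^ (t - 1) * (1 - r)^-1)).
  by apply: ler_wpM2l; [exact: powR_ge0|exact: geometric_sum_le].
apply: (@le_trans _ _ ((1 - r)^-1 `^ (t - 1) * (1 - r)^-1)).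
  by apply: ler_wpM2r; [exact: ltW|apply: ler_powRn => //; rewrite subr_le0 ltW].
by rewrite -{2}[(1 - r)^-1]powRr1 ?(ltW di)// -powRDp// subrK diE.
Qed.

Let expr_ge_half r (k : nat) : 0 <= r <= 1 -> k%:R * (1 - r) <= 1 / 2 ->
  1 / 2 <= r ^+ k.
Proof.
move=> /andP[r0 r1] h; suff : 1 - k%:R * (1 - r) <= r ^+ k by lra.
elim: k {h} => [|k IH]; first by rewrite mul0r subr0 expr0.
have k0 : 0 <= k%:R :> R by [].
have : r * (1 - k%:R * (1 - r)) <= r ^+ k.+1 by rewrite exprS ler_wpM2l.
apply: le_trans; rewrite -subr_ge0.
have -> : r * (1 - k%:R * (1 - r)) - (1 - k.+1%:R * (1 - r)) = k%:R * (1 - r) ^+ 2.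
  by rewrite -[k.+1%:R]natr1; ring.
by rewrite mulr_ge0// sqr_ge0.
Qed.

(** For k up to 1 / (2 (1 - r)) the factor r^k is at least 1/2, and these terms
already sum to the right order. *)
Lemma power_series_lower t : 0 < t < 1 -> exists2 c : R, 0 < c &
  forall r, 0 <= r < 1 -> ((c * (1 - r) `^ (- t))%:E <=
    \sum_(k <oo) ((k%:R + 1) `^ (t - 1) * r ^+ k)%:E)%E.
Proof.
move=> /andP[t0 t1]; exists (2 `^ (- t) / 2); first by rewrite divr_gt0// powR_gt0.
move=> r r01; have /andP[r0 r1] := r01; have d0 : 0 < 1 - r by rewrite subr_gt0.
have u0 (k : nat) : 0 <= (k%:R + 1) `^ (t - 1) * r ^+ k.
  by rewrite mulr_ge0 ?powR_ge0 ?exprn_ge0.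
pose h := (2 * (1 - r))^-1; have h0 : 0 < h by rewrite invr_gt0 mulr_gt0.
pose N := (Num.truncn h).+1.
have N1 : h <= N%:R by rewrite ltW// truncnS_gt.
apply: (@le_trans _ _ (\sum_(0 <= k < N) ((k%:R + 1) `^ (t - 1) * r ^+ k)%:E)%E); last first.
  by apply: nneseries_lim_ge => k _ _; rewrite lee_fin.
rewrite sumEFin lee_fin big_mkord.
apply: (@le_trans _ _ (\sum_(k < N) N%:R `^ (t - 1) * (1 / 2))).
  rewrite sumr_const card_ord -[leRHS]mulr_natl mulrA.
  have -> : N%:R * N%:R `^ (t - 1) = N%:R `^ t :> R.
    by rewrite mulr_powRB1.
  have -> : 2 `^ (- t) / 2 * (1 - r) `^ (- t) = h `^ t * (1 / 2).
    rewrite /h powR_inv ?mulr_ge0 ?(ltW d0)//.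
    by rewrite powRM ?(ltW d0)// div1r; ring.
  by apply: ler_wpM2r => //; apply: ler_powRp => //; exact: ltW.
apply: ler_sum => k _; apply: ler_pM => //.
  apply: ler_powRn => //; first by rewrite subr_le0 ltW.
  by rewrite natr1 ler_nat.
apply: expr_ge_half; first by rewrite r0 ltW.
have kh : k%:R <= h.
  apply: (@le_trans _ _ (Num.truncn h)%:R); first by rewrite ler_nat -ltnS.
  by rewrite truncn_le ltW.
apply: (@le_trans _ _ (h * (1 - r))); first by rewrite ler_pM2r.
by rewrite /h; apply: le_of_eq; field; exact: lt0r_neq0.
Qed.

(** The borderline exponent: the harmonic series diverges. *)
Lemma log_series_lower (M : R) : exists2 d : R, 0 < d & forall r,
  0 <= r <= 1 -> 1 - r <= d ->
  (M%:E <= \sum_(k <oo) ((k%:R + 1) `^ (- 1) * r ^+ k)%:E)%E.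
Proof.
have [N HN] : exists N : nat, 2 * M <= series (@harmonic R) N.
  apply: contrapT => /forallNP H; apply: (@dvg_harmonic R).
  apply: nondecreasing_is_cvgn.
    by apply/nondecreasing_seqP => n; rewrite seriesSr lerDl harmonic_ge0.
  exists (2 * M) => _ [n _ <-]; apply: ltW; rewrite ltNge; apply/negP; exact: H.
exists (2 * (N%:R + 1))^-1; first by rewrite invr_gt0 mulr_gt0.
move=> r r01 rd; have /andP[r0 r1] := r01.
apply: (@le_trans _ _ (\sum_(0 <= k < N) ((k%:R + 1) `^ (- 1) * r ^+ k)%:E)%E); last first.
  by apply: nneseries_lim_ge => k _ _; rewrite lee_fin mulr_ge0 ?powR_ge0 ?exprn_ge0.
rewrite sumEFin lee_fin; apply: (@le_trans _ _ (series (@harmonic R) N * (1 / 2))).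
  by move: HN; lra.
rewrite seriesEnat/= mulr_suml !big_mkord; apply: ler_sum => k _.
rewrite powR_inv1 ?(ltW (kp _))// natr1; apply: ler_wpM2l; first by rewrite invr_ge0.
apply: expr_ge_half => //.
apply: (@le_trans _ _ ((N%:R + 1) * (2 * (N%:R + 1))^-1)).
  apply: ler_pM => //; first by rewrite subr_ge0.
  by rewrite natr1 ler_nat ltnW// ltnS ltnW.
by apply: le_of_eq; field; exact: lt0r_neq0.
Qed.

End power_sums.

(** * Two-sided bounds of the kernel *)

Section kernel_bounds.
#[local] Opaque Gamma invGamma mellin powR expR ln integral kconst kcoef.
Context {R : realType}.
Implicit Types (a s k x y : R).

Let kp (k : nat) : 0 < (k%:R + 1 : R). Proof. by rewrite ltr_wpDl. Qed.

Lemma sumsq_gt0 x y : 0 < x -> 0 < x ^+ 2 + y ^+ 2.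
Proof. by move=> x0; rewrite ltr_wpDr ?sqr_ge0 ?exprn_gt0. Qed.

Lemma onem_kratio x y : 0 < x -> 1 - kratio x y =
  (x - y) ^+ 2 * (x + y) ^+ 2 / (x ^+ 2 + y ^+ 2) ^+ 2.
Proof.
move=> x0; have Q0 := sumsq_gt0 y x0.
by rewrite /kratio powR_inv1 ?(ltW Q0)//; field; exact: lt0r_neq0.
Qed.

Lemma sqrB_gt0 x y : x != y -> 0 < (x - y) ^+ 2.
Proof. by move=> xy; rewrite lt0r sqr_ge0 andbT sqrf_eq0 subr_eq0. Qed.

Lemma kratio_le1 x y : 0 < x -> kratio x y <= 1.
Proof.
by move=> x0; rewrite -subr_ge0 onem_kratio// divr_ge0 ?sqr_ge0// mulr_ge0 ?sqr_ge0.
Qed.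

Lemma kratio_lt1 x y : 0 < x -> 0 < y -> x != y -> kratio x y < 1.
Proof.
move=> x0 y0 xy; rewrite -subr_gt0 onem_kratio//; apply: divr_gt0.
  by apply: mulr_gt0; [exact: sqrB_gt0|rewrite exprn_gt0// addr_gt0].
by rewrite exprn_gt0// sumsq_gt0.
Qed.

(** The condition 1/2 - s <= k makes the weight (n + 1)^(k - 1) dominate the
coefficients, and 1 - r is at least (x - y)^2 / (x^2 + y^2). *)
Lemma kser_upper a s k : -1 < a -> 0 < s -> s < a + 1 -> 0 < k < 1 -> 1 / 2 - s <= k ->
  exists2 C : R, 0 < C & forall x y, 0 < x -> 0 < y -> x != y ->
    (kser a s x y <= (C * ((x * y) `^ (a + 1 / 2) *
      (x ^+ 2 + y ^+ 2) `^ (- (a + 1 - s)) *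
      ((x - y) ^+ 2 / (x ^+ 2 + y ^+ 2)) `^ (- k)))%:E)%E.
Proof.
move=> a1 s0 sa k01 ks; have [c1 [C1 [_ C10 HC1]]] := kcoef_bound a1 sa.
have [C2 C20 HC2] := power_series_upper k01; have /andP[k0 k1] := k01.
have K0 : 0 < kconst s by exact: kconst_gt0.
exists (kconst s * (C1 * C2)).
  by apply: mulr_gt0 => //; exact: mulr_gt0.
move=> x y x0 y0 xy; have Q0 := sumsq_gt0 y x0.
have r0 : 0 <= kratio x y by exact: kratio_ge0.
have r1 : kratio x y < 1 by exact: kratio_lt1.
rewrite /kser; set S := (\sum_(_ <= _ <oo) _)%E.
have HS : (S <= (C1 * (C2 * (1 - kratio x y) `^ (- k)))%:E)%E.
  apply: (@le_trans _ _ (\sum_(n <oo) (C1%:E * ((n%:R + 1) `^ (k - 1) * kratio x y ^+ n)%:E))%E).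
    apply: lee_nneseries => [n _ _|n _].
      by rewrite lee_fin; apply: mulr_ge0; [apply/ltW/kcoef_gt0|exact: exprn_ge0 r0].
    rewrite -EFinM lee_fin mulrA ler_wpM2r ?(exprn_ge0 _ r0)//.
    have /andP[_ h] := HC1 n; apply: (le_trans h); rewrite ler_pM2l//.
    by apply: ler_powR; [rewrite lerDr|lra].
  rewrite nneseriesZl; last by move=> n _; rewrite lee_fin mulr_ge0 ?powR_ge0 ?(exprn_ge0 _ r0).
  by rewrite EFinM lee_pmul2l ?lte_fin// HC2// r0.
apply: (@le_trans _ _ ((kprefac a s x y)%:E * (C1 * (C2 * (1 - kratio x y) `^ (- k)))%:E)%E).
  by apply: lee_wpmul2l => //; rewrite lee_fin kprefac_ge0.
rewrite -EFinM lee_fin /kprefac.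
set u := _ `^ (a + 1 / 2); set v := _ `^ (- (a + 1 - s)).
have -> : kconst s * u * v * (C1 * (C2 * (1 - kratio x y) `^ (- k))) =
  kconst s * (C1 * C2) * (u * v) * (1 - kratio x y) `^ (- k) by ring.
rewrite [leRHS]mulrA; apply: ler_wpM2l.
  apply: mulr_ge0; last by apply: mulr_ge0; exact: powR_ge0.
  by apply: mulr_ge0; [exact: ltW|apply: mulr_ge0; exact: ltW].
apply: ler_powRn; first by rewrite oppr_le0 ltW.
  by rewrite divr_gt0// sqrB_gt0.
rewrite -subr_ge0 onem_kratio//.
have -> : (x - y) ^+ 2 * (x + y) ^+ 2 / (x ^+ 2 + y ^+ 2) ^+ 2 -
    (x - y) ^+ 2 / (x ^+ 2 + y ^+ 2) =
  (x - y) ^+ 2 * (2 * x * y) / (x ^+ 2 + y ^+ 2) ^+ 2 by field; exact: lt0r_neq0.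
by rewrite divr_ge0 ?sqr_ge0// mulr_ge0 ?sqr_ge0// !mulr_ge0 ?(ltW x0) ?(ltW y0).
Qed.

Lemma sqr_powR x e : (x ^+ 2) `^ e = `|x| `^ (2 * e).
Proof. by rewrite -real_normK ?num_real// -powR_mulrn// -powRrM. Qed.

(** The singular part of the kernel. For k = 1/2 - s it is the Riesz kernel, cut off
to the cone where x and y are comparable. *)
Definition near_kernel (s k x y : R) : R :=
  if (x / 2 < y) && (y < 2 * x) then x `^ (2 * s - 1 + 2 * k) * `|x - y| `^ (- (2 * k))
  else 0.

(** Inside the cone x/2 < y < 2 x, the quantities x y and x^2 + y^2 are comparable to
x^2. Outside it (x - y)^2 >= (x^2 + y^2) / 5, and the kernel is bounded by
(x y)^b (x^2 + y^2)^(-(a + 1 - s)). *)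
Lemma kser_upper_split a s k : -1 < a -> 0 < s -> s < a + 1 -> 0 < k < 1 ->
  1 / 2 - s <= k -> exists2 C : R, 0 < C & forall x y, 0 < x -> 0 < y -> x != y ->
    (kser a s x y <= (C * (near_kernel s k x y
       + (if y <= x then x `^ (2 * s - 1 - (a + 1 / 2)) * y `^ (a + 1 / 2) else 0)
       + (if x <= y then x `^ (a + 1 / 2) * y `^ (2 * s - 1 - (a + 1 / 2)) else 0)))%:E)%E.
Proof.
move=> a1 s0 sa k01 ks; have /andP[k0 k1] := k01.
have [C C0 HC] := kser_upper a1 s0 sa k01 ks.
set b := a + 1 / 2 in HC *; set g := a + 1 - s in HC.
have g0 : 0 < g by rewrite subr_gt0.
have bg : 2 * b - 2 * g = 2 * s - 1 by rewrite /b /g; field.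
pose M1 : R := 4 `^ `|b| * 2 `^ (- b) * 5 `^ `|k - g|; pose M2 : R := 5 `^ k.
have M10 : 0 < M1 by rewrite !mulr_gt0 ?powR_gt0.
have M20 : 0 < M2 by rewrite powR_gt0.
exists (C * (M1 + M2)); first by rewrite mulr_gt0// addr_gt0.
move=> x y x0 y0 xy; apply: (le_trans (HC x y x0 y0 xy)).
have Q0 := sumsq_gt0 y x0; have P0 : 0 < x * y by exact: mulr_gt0.
have x20 : 0 < x ^+ 2 by exact: exprn_gt0.
have y20 : 0 < y ^+ 2 by exact: exprn_gt0.
rewrite lee_fin -[leRHS]mulrA ler_pM2l//.
set N := near_kernel _ _ _ _; set l := if y <= x then _ else _.
set r := if x <= y then _ else _.
have N0 : 0 <= N by rewrite /N /near_kernel; case: ifP => // _; rewrite mulr_ge0 ?powR_ge0.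
have l0 : 0 <= l by rewrite /l; case: ifP => // _; rewrite mulr_ge0 ?powR_ge0.
have r0 : 0 <= r by rewrite /r; case: ifP => // _; rewrite mulr_ge0 ?powR_ge0.
set T := (X in X <= _).
suff : [|| T <= M1 * N, T <= M2 * l | T <= M2 * r].
  have := mulr_ge0 (ltW M10) N0; have := mulr_ge0 (ltW M20) l0.
  have := mulr_ge0 (ltW M20) r0; have := mulr_ge0 (ltW M10) l0.
  have := mulr_ge0 (ltW M10) r0; have := mulr_ge0 (ltW M20) N0.
  move=> h1 h2 h3 h4 h5 h6.
  have -> : (M1 + M2) * (N + l + r) =
    M1 * N + M1 * l + M1 * r + M2 * N + M2 * l + M2 * r by ring.
  case/or3P => h; lra.
have [/andP[xy1 xy2]|far] := boolP ((x / 2 < y) && (y < 2 * x)).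
  apply/orP; left; rewrite /N /near_kernel xy1 xy2/= /T.
  have /andP[_ H1] : 4 `^ (- `|b|) * (x ^+ 2 / 2) `^ b <= (x * y) `^ b <=
      4 `^ `|b| * (x ^+ 2 / 2) `^ b.
    apply: powR_le_comparable; rewrite ?divr_gt0//; first by rewrite ler1n.
    have -> : x ^+ 2 / 2 = x * (x / 2) by field.
    have -> : 4 * (x * (x / 2)) = x * (2 * x) by field.
    by rewrite !ler_pM2l// !ltW.
  have /andP[_ H2] : 5 `^ (- `|k - g|) * (x ^+ 2) `^ (k - g) <=
      (x ^+ 2 + y ^+ 2) `^ (k - g) <= 5 `^ `|k - g| * (x ^+ 2) `^ (k - g).
    apply: powR_le_comparable => //; first by rewrite ler1n.
    rewrite lerDl ltW//=.
    have : y ^+ 2 <= (2 * x) ^+ 2 by rewrite ler_sqr ?nnegrE ?mulr_ge0 ?(ltW x0) ?(ltW y0)// ltW.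
    by rewrite exprMn; lra.
  rewrite [(_ / _) `^ (- k)]powRM ?sqr_ge0 ?invr_ge0 ?(ltW Q0)//.
  rewrite powR_inv ?(ltW Q0)// opprK sqr_powR mulrN.
  set D := `|x - y| `^ _; have D0 : 0 <= D by exact: powR_ge0.
  have -> : (x * y) `^ b * (x ^+ 2 + y ^+ 2) `^ (- g) * (D * (x ^+ 2 + y ^+ 2) `^ k) =
     (x * y) `^ b * (x ^+ 2 + y ^+ 2) `^ (k - g) * D.
    by rewrite [k - g]addrC (powRDp (- g))//; ring.
  rewrite mulrA; apply: ler_wpM2r => //.
  apply: (@le_trans _ _ ((4 `^ `|b| * (x ^+ 2 / 2) `^ b) * (5 `^ `|k - g| * (x ^+ 2) `^ (k - g)))).
    by apply: ler_pM; rewrite ?powR_ge0.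
  apply: le_of_eq.
  have -> : (x ^+ 2 / 2) `^ b = x `^ (2 * b) * 2 `^ (- b).
    by rewrite powRM ?sqr_ge0 ?invr_ge0// sqr_powR (gtr0_norm x0) powR_inv.
  rewrite sqr_powR (gtr0_norm x0) -bg.
  have -> : x `^ (2 * b - 2 * g + 2 * k) = x `^ (2 * b) * x `^ (2 * (k - g)).
    by rewrite -powRDp//; congr (_ `^ _); ring.
  by rewrite /M1; ring.
have fark : 1 / 5 <= (x - y) ^+ 2 / (x ^+ 2 + y ^+ 2) ->
    ((x - y) ^+ 2 / (x ^+ 2 + y ^+ 2)) `^ (- k) <= M2.
  move=> h; apply: (@le_trans _ _ ((1 / 5) `^ (- k))).
    by apply: ler_powRn => //; rewrite oppr_le0 ltW.
  by rewrite div1r powR_inv// opprK.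
have [xy1|xy1] := leP y (x / 2).
  apply/orP; right; apply/orP; left; rewrite /l ifT; last by lra.
  have H : ((x - y) ^+ 2 / (x ^+ 2 + y ^+ 2)) `^ (- k) <= M2.
    apply: fark; rewrite ler_pdivlMr//.
    have -> : (x - y) ^+ 2 = 1 / 5 * (x ^+ 2 + y ^+ 2) + 1 / 5 * (2 * x - 4 * y) * (2 * x - y) by field.
    rewrite lerDl mulr_ge0 ?mulr_ge0 ?divr_ge0//; lra.
  rewrite /T mulrC; apply: ler_pM => //; [exact: powR_ge0|by rewrite mulr_ge0 ?powR_ge0|].
  rewrite powRM ?(ltW x0) ?(ltW y0)//.
  have -> : 2 * s - 1 - b = b - 2 * g by rewrite -bg; ring.
  rewrite powRDp// [leRHS]mulrAC.
  apply: ler_wpM2l; first by rewrite mulr_ge0 ?powR_ge0.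
  rewrite -mulrN -[in leRHS](gtr0_norm x0) -sqr_powR.
  by apply: ler_powRn => //; rewrite ?oppr_le0 ?lerDl ltW.
have xy2 : 2 * x <= y by rewrite leNgt; apply: contra far => h; rewrite xy1 h.
apply/orP; right; apply/orP; right; rewrite /r ifT; last by lra.
have H : ((x - y) ^+ 2 / (x ^+ 2 + y ^+ 2)) `^ (- k) <= M2.
  apply: fark; rewrite ler_pdivlMr//.
  have -> : (x - y) ^+ 2 = 1 / 5 * (x ^+ 2 + y ^+ 2) + 1 / 5 * (2 * y - 4 * x) * (2 * y - x) by field.
  rewrite lerDl mulr_ge0 ?mulr_ge0 ?divr_ge0//; lra.
rewrite /T mulrC; apply: ler_pM => //; [exact: powR_ge0|by rewrite mulr_ge0 ?powR_ge0|].
rewrite powRM ?(ltW x0) ?(ltW y0)//.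
have -> : 2 * s - 1 - b = b - 2 * g by rewrite -bg; ring.
rewrite [y `^ (b - _)]powRDp// -mulrA.
do 2 (apply: ler_wpM2l; first exact: powR_ge0).
rewrite -mulrN -[in leRHS](gtr0_norm y0) -sqr_powR.
by apply: ler_powRn => //; rewrite ?oppr_le0 ?lerDr ltW.
Qed.

(** The first term of the series already has this size. *)
Lemma kser_lower a s : -1 < a -> 0 < s -> s < a + 1 ->
  exists2 c : R, 0 < c & forall x y, 0 < x -> 0 < y ->
    (y <= x -> ((c * (x `^ (2 * s - 1 - (a + 1 / 2)) * y `^ (a + 1 / 2)))%:E <= kser a s x y)%E)
  /\ (x <= y -> ((c * (x `^ (a + 1 / 2) * y `^ (2 * s - 1 - (a + 1 / 2))))%:E <= kser a s x y)%E).
Proof.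
move=> a1 s0 sa; set b := a + 1 / 2; pose g := a + 1 - s.
have g0 : 0 < g by rewrite subr_gt0.
have bg : 2 * s - 1 - b = b - 2 * g by rewrite /b /g; field.
have k0 : 0 < kcoef a s 0 by exact: kcoef_gt0.
have K0 : 0 < kconst s by exact: kconst_gt0.
exists (kconst s * kcoef a s 0 * 2 `^ (- g)).
  by apply: mulr_gt0; [exact: mulr_gt0|exact: powR_gt0].
move=> x y x0 y0; have Q0 := sumsq_gt0 y x0.
have L : ((kprefac a s x y * kcoef a s 0)%:E <= kser a s x y)%E.
  rewrite EFinM; apply: lee_wpmul2l; first by rewrite lee_fin kprefac_ge0.
  apply: (@le_trans _ _ (\sum_(0 <= n < 1) (kcoef a s n * kratio x y ^+ n)%:E)%E).
    by rewrite big_nat1 expr0 mulr1.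
  apply: nneseries_lim_ge => n _ _.
  rewrite lee_fin; apply: mulr_ge0; first exact/ltW/kcoef_gt0.
  by apply: exprn_ge0; exact: kratio_ge0.
have E z : 0 < z -> x ^+ 2 + y ^+ 2 <= 2 * z ^+ 2 ->
    kconst s * kcoef a s 0 * 2 `^ (- g) * (x `^ b * y `^ b * z `^ (- (2 * g))) <=
    kprefac a s x y * kcoef a s 0.
  move=> z0 h; rewrite /kprefac -/b -/g powRM ?(ltW x0) ?(ltW y0)//.
  have H : 2 `^ (- g) * z `^ (- (2 * g)) <= (x ^+ 2 + y ^+ 2) `^ (- g).
    rewrite -mulrN -[in z `^ _](gtr0_norm z0) -sqr_powR -powRM ?sqr_ge0//.
    by apply: ler_powRn => //; rewrite oppr_le0 ltW.
  set A := x `^ b * y `^ b; have A0 : 0 <= A by rewrite mulr_ge0 ?powR_ge0.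
  have -> : kconst s * kcoef a s 0 * 2 `^ (- g) * (A * z `^ (- (2 * g))) =
    (kconst s * kcoef a s 0 * A) * (2 `^ (- g) * z `^ (- (2 * g))) by ring.
  have -> : kconst s * A * (x ^+ 2 + y ^+ 2) `^ (- g) * kcoef a s 0 =
    (kconst s * kcoef a s 0 * A) * (x ^+ 2 + y ^+ 2) `^ (- g) by ring.
  apply: ler_wpM2l => //; apply: mulr_ge0 => //; apply: mulr_ge0; exact: ltW.
split=> h; apply: le_trans L; rewrite lee_fin bg.
- rewrite powRDp// [x `^ b * _ * y `^ b]mulrAC.
  apply: E => //; rewrite mulr_natl mulr2n lerD2l ler_sqr ?nnegrE ?(ltW x0) ?(ltW y0)//.
- rewrite [y `^ (b - _)]powRDp// [x `^ b * _]mulrA.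
  by apply: E => //; rewrite mulr_natl mulr2n lerD2r ler_sqr ?nnegrE ?(ltW x0) ?(ltW y0).
Qed.

Lemma kprefac_lower a s : 0 < s -> s < a + 1 -> exists2 c : R, 0 < c &
  forall x y, 1 <= x <= 2 -> 1 <= y <= 2 -> c <= kprefac a s x y.
Proof.
move=> s0 sa; have K0 : 0 < kconst s by exact: kconst_gt0.
exists (kconst s * 4 `^ (- `|a + 1 / 2|) * 8 `^ (- `|- (a + 1 - s)|)).
  by apply: mulr_gt0; [apply: mulr_gt0 => //|]; exact: powR_gt0.
move=> x y /andP[x1 x2] /andP[y1 y2]; have x0 : 0 < x by lra. have y0 : 0 < y by lra.
rewrite /kprefac; apply: ler_pM.
- by rewrite mulr_ge0 ?powR_ge0// ltW.
- exact: powR_ge0.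
- rewrite ler_pM2l//.
  have /andP[h _] : 4 `^ (- `|a + 1 / 2|) * 1 `^ (a + 1 / 2) <= (x * y) `^ (a + 1 / 2)
     <= 4 `^ `|a + 1 / 2| * 1 `^ (a + 1 / 2).
    apply: powR_le_comparable => //; first by rewrite ler1n.
    rewrite mulr1 (_ : 4 = 2 * 2); last by rewrite -natrM.
    rewrite ler_pM ?(ltW x0) ?(ltW y0)// andbT.
    by rewrite -[leLHS]mulr1 ler_pM.
  by rewrite powR1 mulr1 in h.
- have /andP[h _] : 8 `^ (- `|- (a + 1 - s)|) * 1 `^ (- (a + 1 - s)) <=
     (x ^+ 2 + y ^+ 2) `^ (- (a + 1 - s))
     <= 8 `^ `|- (a + 1 - s)| * 1 `^ (- (a + 1 - s)).
    apply: powR_le_comparable => //; first by rewrite ler1n.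
    have : 1 ^+ 2 <= x ^+ 2 by rewrite ler_sqr ?nnegrE ?(ltW x0).
    have : x ^+ 2 <= 2 ^+ 2 by rewrite ler_sqr ?nnegrE ?(ltW x0).
    have : y ^+ 2 <= 2 ^+ 2 by rewrite ler_sqr ?nnegrE ?(ltW y0).
    have := sqr_ge0 y; rewrite expr1n mulr1 => h1 h2 h3 h4; lra.
  by rewrite powR1 mulr1 in h.
Qed.

Lemma onem_kratio_le x y : 1 <= x <= 2 -> 1 <= y <= 2 -> 1 - kratio x y <= 4 * (x - y) ^+ 2.
Proof.
move=> /andP[x1 x2] /andP[y1 y2]; have x0 : 0 < x by lra.
have Q0 := sumsq_gt0 y x0.
rewrite onem_kratio// ler_pdivrMr ?exprn_gt0// mulrC [leRHS]mulrAC; apply: ler_wpM2r.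
  exact: sqr_ge0.
have : 2 <= x ^+ 2 + y ^+ 2.
  have : 1 ^+ 2 <= x ^+ 2 by rewrite ler_sqr ?nnegrE ?(ltW x0).
  have : 1 ^+ 2 <= y ^+ 2 by rewrite ler_sqr ?nnegrE//; lra.
  rewrite expr1n; lra.
move=> h; have : (x + y) ^+ 2 <= 2 * (x ^+ 2 + y ^+ 2).
  rewrite -subr_ge0 (_ : _ - _ = (x - y) ^+ 2); last by ring.
  exact: sqr_ge0.
move=> /le_trans; apply; rewrite [(_ + _) ^+ 2]expr2 mulrA; apply: ler_wpM2r; first exact: ltW.
lra.
Qed.

(** On [1, 2] x [1, 2] the prefactor is bounded below and 1 - r <= 4 (x - y)^2. *)
Lemma kser_lower_dist a s : -1 < a -> 0 < s -> s < a + 1 -> s < 1 / 2 ->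
  exists2 c : R, 0 < c & forall x y, 1 <= x <= 2 -> 1 <= y <= 2 -> x != y ->
    ((c * `|x - y| `^ (2 * s - 1))%:E <= kser a s x y)%E.
Proof.
move=> a1 s0 sa s12; have t01 : 0 < 1 / 2 - s < 1 by lra.
have [c1 [C1 [c10 _ HC1]]] := kcoef_bound a1 sa.
have [c2 c20 Hc2] := power_series_lower t01.
have [c3 c30 Hc3] := kprefac_lower s0 sa.
exists (c3 * (c1 * (c2 * 4 `^ (- (1 / 2 - s))))); first by rewrite !mulr_gt0 ?powR_gt0.
move=> x y x12 y12 xy; have /andP[x1 x2] := x12; have /andP[y1 y2] := y12.
have x0 : 0 < x by lra. have y0 : 0 < y by lra.
have r0 : 0 <= kratio x y by exact: kratio_ge0.
have r1 : kratio x y < 1 by exact: kratio_lt1.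
rewrite -mulrA EFinM /kser; apply: lee_pmul.
- by rewrite lee_fin ltW.
- by rewrite lee_fin !mulr_ge0 ?powR_ge0 ?(ltW c10) ?(ltW c20).
- by rewrite lee_fin Hc3.
apply: (@le_trans _ _ (\sum_(n <oo) (c1%:E * ((n%:R + 1) `^ (1 / 2 - s - 1) * kratio x y ^+ n)%:E))%E); last first.
  apply: lee_nneseries => [n _ _|n _].
    rewrite -EFinM lee_fin; apply: mulr_ge0; first exact: ltW.
    by rewrite mulr_ge0 ?powR_ge0 ?(exprn_ge0 _ r0).
  rewrite -EFinM lee_fin mulrA ler_wpM2r ?(exprn_ge0 _ r0)//.
  have /andP[h _] := HC1 n; apply: le_trans h; rewrite ler_pM2l//.
  by apply: ler_powR; [rewrite lerDr|lra].
rewrite nneseriesZl; last by move=> n _; rewrite lee_fin mulr_ge0 ?powR_ge0 ?(exprn_ge0 _ r0).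
rewrite -mulrA EFinM; apply: lee_wpmul2l; first by rewrite lee_fin ltW.
apply: le_trans (Hc2 _ _); last by rewrite r0.
rewrite lee_fin -mulrA ler_pM2l//.
have -> : `|x - y| `^ (2 * s - 1) = ((x - y) ^+ 2) `^ (- (1 / 2 - s)).
  by rewrite sqr_powR; congr (_ `^ _); field.
rewrite -powRM ?sqr_ge0//; apply: ler_powRn; first lra.
  by rewrite subr_gt0.
exact: onem_kratio_le.
Qed.

(** For s = 1/2 the coefficients decay only like 1 / (k + 1), so that the kernel is
unbounded near the diagonal. *)
Lemma kser_lower_log a : -1 < a -> 1 / 2 < a + 1 -> forall M : R,
  exists2 e : R, 0 < e < 1 & forall x y, 1 <= x <= 1 + e -> 1 <= y <= 1 + e ->
    (M%:E <= kser a (1 / 2) x y)%E.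
Proof.
move=> a1 sa M; have s0 : 0 < 1 / 2 :> R by lra.
have [c1 [C1 [c10 _ HC1]]] := kcoef_bound a1 sa.
have [c3 c30 Hc3] := kprefac_lower s0 sa.
pose M' := `|M| / (c1 * c3).
have M'0 : 0 <= M' by rewrite divr_ge0// mulr_ge0// ltW.
have [d d0 Hd] := log_series_lower M'.
exists (Num.min (1 / 2) (d / 4)).
  by rewrite lt_min divr_gt0//= gt_min; apply/andP; split; [lra|apply/orP; left; lra].
set e := Num.min _ _ => x y /andP[x1 xe] /andP[y1 ye].
have e1 : e <= 1 / 2 by rewrite ge_min lexx.
have e2 : e <= d / 4 by rewrite ge_min lexx orbT.
have e0 : 0 < e by rewrite lt_min; apply/andP; split; lra.
have x12 : 1 <= x <= 2 by lra. have y12 : 1 <= y <= 2 by lra.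
have x0 : 0 < x by lra.
have r0 : 0 <= kratio x y by exact: kratio_ge0.
have r1 : kratio x y <= 1 by exact: kratio_le1.
have rd : 1 - kratio x y <= d.
  apply: (le_trans (onem_kratio_le x12 y12)).
  have : (x - y) ^+ 2 <= e ^+ 2.
    rewrite -subr_ge0 (_ : _ - _ = (e - (x - y)) * (e + (x - y))); last by ring.
    by apply: mulr_ge0; lra.
  move=> h; have : e ^+ 2 <= e by rewrite expr2 ler_piMl//; lra.
  lra.
apply: (@le_trans _ _ (c3 * (c1 * M'))%:E).
  rewrite lee_fin /M' [leRHS](_ : _ = `|M|) ?ler_norm//.
  by field; rewrite !gt_eqF.
rewrite EFinM /kser; apply: lee_pmul.
- by rewrite lee_fin ltW.
- by rewrite lee_fin mulr_ge0// ltW.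
- by rewrite lee_fin Hc3.
apply: (@le_trans _ _ (\sum_(n <oo) (c1%:E * ((n%:R + 1) `^ (- 1) * kratio x y ^+ n)%:E))%E); last first.
  apply: lee_nneseries => [n _ _|n _].
    rewrite -EFinM lee_fin; apply: mulr_ge0; first exact: ltW.
    by rewrite mulr_ge0 ?powR_ge0 ?(exprn_ge0 _ r0).
  rewrite -EFinM lee_fin mulrA ler_wpM2r ?(exprn_ge0 _ r0)//.
  have /andP[h _] := HC1 n; apply: le_trans h; rewrite ler_pM2l//.
  by apply: ler_powR; [rewrite lerDr|lra].
rewrite nneseriesZl; last by move=> n _; rewrite lee_fin mulr_ge0 ?powR_ge0 ?(exprn_ge0 _ r0).
rewrite EFinM; apply: lee_wpmul2l; first by rewrite lee_fin ltW.
by apply: Hd => //; rewrite r0.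
Qed.

End kernel_bounds.

(** * From weak type to strong type *)

Section weak_type.
#[local] Opaque powR expR ln integral.
Context {R : realType}.
Local Notation mu := (@lebesgue_measure R).
Implicit Types (p q r t h x y : R) (F : R -> R).

Lemma ge0_le_poweR (r : R) (u v : \bar R) : 0 <= r -> (0 <= u)%E -> (u <= v)%E ->
  (u `^ r <= v `^ r)%E.
Proof.
move=> r0 u0 uv; have v0 := le_trans u0 uv.
by apply: gt0_ler_poweR; rewrite // in_itv/= leey andbT.
Qed.

Lemma integral_if (D A : set R) (P : R -> bool) (f : R -> \bar R) :
  measurable D -> (forall x, A x <-> D x /\ P x) ->
  (\int[mu]_(x in D) (if P x then f x else 0) = \int[mu]_(x in A) f x)%E.
Proof.
move=> mD AE; rewrite integral_mkcond [RHS]integral_mkcond; apply: eq_integral => x _.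
rewrite /patch; case: (pselect (A x)) => Ax.
  by have [Dx Px] := (AE x).1 Ax; rewrite !mem_set// Px.
rewrite [in RHS]memNset//; case: ifPn => // /set_mem Dx; case: ifPn => // Px.
by exfalso; apply: Ax; apply/AE.
Qed.

Lemma integral_powR_le (t r : R) : 0 < t -> 0 <= r ->
  (\int[mu]_(h in Rpos R) (if (h < r)%R then (h `^ (t - 1))%:E else 0) <= (r `^ t / t)%:E)%E.
Proof.
move=> t0; rewrite le_eqVlt => /predU1P[<-|r0].
  rewrite integral0_eq; first by rewrite lee_fin divr_ge0 ?powR_ge0 ?(ltW t0).
  by move=> h; rewrite RposE => h0; rewrite ltNge (ltW h0).
rewrite (@integral_if _ `]0, r[%classic)//; last first.
  move=> x; rewrite RposE/= in_itv/=; split; first by move=> /andP[].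
  by move=> [-> ->].
apply: le_trans (integral_powR_0 t0 r0); apply: ge0_subset_integral => //.
- by apply: measurable_funTS; mfun.
- by move=> x _; rewrite lee_fin powR_ge0.
- by move=> x /=; rewrite !in_itv/= => /andP[-> /ltW].
Qed.

(** The integral over [r/4, r/2] already has the order of the whole. *)
Lemma integral_powR_ge t r : 0 < t -> 0 < r ->
  ((r `^ t * ((2 `^ (- t) - 4 `^ (- t)) / t))%:E <=
   \int[mu]_(h in Rpos R) (if (h < r)%R then (h `^ (t - 1))%:E else 0))%E.
Proof.
move=> t0 r0; have r40 : 0 < r / 4 by rewrite divr_gt0.
have r42 : r / 4 < r / 2 by lra.
apply: (@le_trans _ _ (\int[mu]_(h in `[(r / 4)%R, (r / 2)%R]) (h `^ (t - 1))%:E)%E); last first.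
  rewrite -(@integral_if (Rpos R) `[r / 4, r / 2]%classic (fun h => (r / 4 <= h) && (h <= r / 2)))//; last first.
    move=> x; rewrite RposE/= in_itv/=; split=> [h|[]//]; split=> //.
    by have /andP[+ _] := h; exact: lt_le_trans.
  apply: ge0_le_integral => //.
  - by move=> x _; case: ifP => // _; rewrite lee_fin powR_ge0.
  - by apply: measurable_funTS; mfun.
  - by apply: measurable_funTS; mfun.
  - move=> x _; case: ifPn => [/andP[h1 h2]|_]; last by case: ifP => // _; rewrite lee_fin powR_ge0.
    by rewrite ifT//; apply: (le_lt_trans h2); lra.
have -> : (\int[mu]_(h in `[(r / 4)%R, (r / 2)%R]) (h `^ (t - 1))%:E =
    (t^-1 * (r / 2) `^ t - t^-1 * (r / 4) `^ t)%:E)%E.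
  apply: (@integral_derive _ (fun h => t^-1 * h `^ t)) => //.
  - move=> x /andP[h _]; have x0 : 0 < x by exact: lt_le_trans h.
    have -> : x `^ (t - 1) = t^-1 * t * x `^ (t - 1) by rewrite mulVf ?mul1r ?gt_eqF.
    exact: is_derive_scale_powR.
  - move=> x /andP[h _]; have x0 : 0 < x by exact: lt_le_trans h.
    by apply: continuous_at_powR.
apply: le_of_eq; congr EFin.
by rewrite !powRM ?(ltW r0) ?invr_ge0// !powR_inv//; field; exact: lt0r_neq0.
Qed.

(** Doob's trick: a weak-type inequality that only sees the part of F above the
level h self-improves to a strong one, by integration against h^(p-2) dh. *)
Lemma weak_to_strong p : 1 < p -> exists2 C : R, 0 < C &
  forall (G : R -> \bar R) F, measurable_fun [set: R] G ->
  measurable_fun [set: R] F -> (forall x, 0 <= G x)%E -> (forall y, 0 <= F y) ->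
  (forall h, 0 < h -> (h%:E * mu [set x | h%:E < G x] <=
     \int[mu]_y (if (h < F y)%R then F y else 0)%:E)%E) ->
  (\int[mu]_x (G x `^ p) <= C%:E * \int[mu]_y (F y `^ p)%:E)%E.
Proof.
move=> p1; have p0 : 0 < p by lra. have q0 : 0 < p - 1 by lra.
pose c := (2 `^ (- p) - 4 `^ (- p)) / p.
have c0 : 0 < c.
  rewrite divr_gt0// subr_gt0 !powRN ltf_pV2 ?posrE ?powR_gt0//.
  by apply: gt0_ltr_powR; rewrite ?nnegrE// ltr_nat.
exists (c^-1 * (p - 1)^-1); first by rewrite mulr_gt0 ?invr_gt0.
move=> G F mG mF G0 F0 weak.
pose phi x h : \bar R := if (h%:E < G x)%E then (h `^ (p - 1))%:E else 0%E.
pose psi y h : \bar R := if h < F y then (h `^ (p - 1 - 1) * F y)%:E else 0%E.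
have mGz : measurable_fun [set: R * R] (fun z => G z.1) by apply: (measurableT_comp mG).
have mFz : measurable_fun [set: R * R] (fun z => F z.1) by apply: (measurableT_comp mF).
have mphi : measurable_fun [set: R * R] (fun z => phi z.1 z.2) by rewrite /phi; mfun.
have mpsi : measurable_fun [set: R * R] (fun z => psi z.1 z.2) by rewrite /psi; mfun.
have phi0 x h : (0 <= phi x h)%E by rewrite /phi; case: ifP => // _; rewrite lee_fin powR_ge0.
have psi0 x h : (0 <= psi x h)%E.
  by rewrite /psi; case: ifP => // _; rewrite lee_fin mulr_ge0 ?powR_ge0.
have lower x r : 0 < r -> (r%:E <= G x)%E ->
    ((r `^ p * c)%:E <= \int[mu]_(h in Rpos R) phi x h)%E.
  move=> r0 rG; apply: (le_trans (integral_powR_ge p0 r0)); apply: ge0_le_integral => //.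
  - by move=> h _; case: ifP => // _; rewrite lee_fin powR_ge0.
  - by apply: measurable_funTS; mfun.
  - by apply: measurable_funTS; rewrite /phi; mfun.
  - move=> h _; rewrite /phi; case: ifPn => [hr|_].
      by rewrite ifT//; apply: lt_le_trans rG; rewrite lte_fin.
    by case: ifP => // _; rewrite lee_fin powR_ge0.
have step1 x : (c%:E * (G x `^ p) <= \int[mu]_(h in Rpos R) phi x h)%E.
  have I0 : (0 <= \int[mu]_(h in Rpos R) phi x h)%E by exact: integral_ge0.
  have := lower x; have := G0 x; case: (G x) => [r|_ L|//].
    rewrite lee_fin le_eqVlt => /predU1P[<- _|r0 L].
      by rewrite poweR_EFin powR0 ?gt_eqF// mule0.
    by rewrite poweR_EFin -EFinM mulrC L.
  rewrite [X in (_ <= X)%E](_ : _ = +oo%E) ?leey//; apply/eqyP => A A0.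
  have Ac := divr_gt0 A0 c0.
  have := L ((A / c) `^ p^-1) (powR_gt0 _ Ac) (leey _).
  by rewrite -powRrM mulVf ?gt_eqF// powRr1 ?(ltW Ac)// divfK ?gt_eqF.
have mGp : measurable_fun [set: R] (fun x => (G x `^ p)%E) by mfun.
have Gp0 x : (0 <= G x `^ p)%E by exact: poweR_ge0.
have H : (c%:E * \int[mu]_x (G x `^ p) <= (p - 1)^-1%:E * \int[mu]_y (F y `^ p)%:E)%E.
  rewrite -ge0_integralZl_EFin ?(ltW c0)//.
  apply: (@le_trans _ _ (\int[mu]_x \int[mu]_(h in Rpos R) phi x h)%E).
    apply: ge0_le_integral => //.
    - by move=> x _; apply: mule_ge0 => //; rewrite lee_fin ltW.
    - by mfun.
    - exact: measurable_integral_in.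
  rewrite tonelli_in//.
  apply: (@le_trans _ _ (\int[mu]_(h in Rpos R) \int[mu]_y psi y h)%E).
    apply: ge0_le_integral => //.
    - by move=> h _; apply: integral_ge0.
    - apply: measurable_funTS; apply: (@measurable_integral_in _ setT (fun h x => phi x h)) => //.
      by rewrite /phi; mfun; apply: (measurableT_comp mG).
    - apply: measurable_funTS; apply: (@measurable_integral_in _ setT (fun h x => psi x h)) => //.
      by rewrite /psi; mfun; apply: (measurableT_comp mF).
    move=> h; rewrite RposE => h0.
    have -> : (\int[mu]_x phi x h = (h `^ (p - 1))%:E * mu [set x | h%:E < G x])%E.
      rewrite (@integral_if _ [set x | (h%:E < G x)%E] (fun x => (h%:E < G x)%E))//; last first.
        by move=> x; split => [|[]].
      rewrite integral_cst//.
      rewrite -[X in measurable X]setTI; exact: emeasurable_fun_o_infty.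
    have -> : (\int[mu]_y psi y h = (h `^ (p - 1 - 1))%:E *
        \int[mu]_y (if (h < F y)%R then F y else 0)%:E)%E.
      rewrite -ge0_integralZ//.
      + apply: eq_integral => y _; rewrite /psi; case: ifP => // _.
        by rewrite mulr0.
      + by mfun.
      + by move=> y; case: ifP.
      + exact: powR_ge0.
    have -> : h `^ (p - 1) = h `^ (p - 1 - 1) * h.
      by rewrite -[X in _ * X]powRr1 ?(ltW h0)// -powRDp// subrK.
    by rewrite EFinM -muleA; apply: lee_wpmul2l; [rewrite lee_fin powR_ge0|exact: weak].
  rewrite (tonelli_in (f := fun h y => psi y h))//; last by rewrite /psi; mfun; apply: (measurableT_comp mF).
  rewrite -ge0_integralZ; last 4 first.
  - exact: measurableT.
  - by mfun.
  - by move=> y; exact: powR_ge0.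
  - by rewrite invr_ge0 ltW.
  apply: ge0_le_integral => //.
  - by move=> y _; apply: integral_ge0.
  - exact: measurable_integral_in.
  - by mfun.
  move=> y _.
  have -> : (\int[mu]_(h in Rpos R) psi y h = (F y)%:E *
      \int[mu]_(h in Rpos R) (if (h < F y)%R then (h `^ (p - 1 - 1))%:E else 0))%E.
    rewrite -ge0_integralZl//.
    + by apply: eq_integral => h _; rewrite /psi; case: ifP => // _; rewrite ?mule0// mulrC.
    + by apply: measurable_funTS; mfun.
    + by move=> h _; case: ifP => // _; rewrite lee_fin powR_ge0.
    + by rewrite lee_fin.
  apply: (@le_trans _ _ ((F y)%:E * (F y `^ (p - 1) / (p - 1))%:E)%E).
    by apply: lee_wpmul2l; [rewrite lee_fin|exact: integral_powR_le].
  by rewrite -EFinM lee_fin mulrA mulr_powRB1// mulrC.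
have -> : (\int[mu]_x (G x `^ p) = c^-1%:E * (c%:E * \int[mu]_x (G x `^ p)))%E.
  by rewrite muleA -EFinM mulVf ?mul1e// gt_eqF.
rewrite [X in (_ <= X * _)%E]EFinM -[X in (_ <= X)%E]muleA; apply: lee_wpmul2l => //.
by rewrite lee_fin invr_ge0 ltW.
Qed.

End weak_type.

(** * The Hardy-Littlewood-Sobolev inequality *)

Section hls.
#[local] Opaque powR expR ln integral.
Context {R : realType}.
Local Notation mu := (@lebesgue_measure R).
Implicit Types (p q r t h x y : R) (F : R -> R).

Lemma integral_dist_near (t r x : R) : 0 < t -> 0 <= r ->
  (\int[mu]_y (if (`|x - y| < r)%R then (`|x - y| `^ (t - 1))%:E else 0) <=
   (2 * (r `^ t / t))%:E)%E.
Proof.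
move=> t0 r0.
pose f (u : R) : \bar R := if u < r then (u `^ (t - 1))%:E else 0%E.
have mf : measurable_fun [set: R] f by rewrite /f; mfun.
have f0 u : (0 <= f u)%E by rewrite /f; case: ifP => // _; rewrite lee_fin powR_ge0.
have := ge0_integral_dist x mf f0; rewrite /f => ->.
by rewrite EFinM; apply: lee_wpmul2l => //; exact: integral_powR_le.
Qed.

Lemma integral_dist_far (t r x : R) : 0 < t -> 0 < r ->
  (\int[mu]_y (if (r <= `|x - y|)%R then (`|x - y| `^ (- t - 1))%:E else 0) =
   (2 * (r `^ (- t) / t))%:E)%E.
Proof.
move=> t0 r0.
pose f (u : R) : \bar R := if r <= u then (u `^ (- t - 1))%:E else 0%E.
have mf : measurable_fun [set: R] f by rewrite /f; mfun.
have f0 u : (0 <= f u)%E by rewrite /f; case: ifP => // _; rewrite lee_fin powR_ge0.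
have := ge0_integral_dist x mf f0; rewrite /f => ->.
rewrite EFinM; congr (_ * _)%E.
rewrite (@integral_if _ _ `[r, +oo[%classic)//; last first.
  move=> u; rewrite RposE/= in_itv/= andbT; split=> [h|[]//].
  by split=> //; exact: lt_le_trans h.
exact: integral_powR_pinfty.
Qed.

(** Young's inequality with the relative scale of the factors left free. *)
Lemma young_scaled (p u v e : R) : 1 < p -> 0 <= u -> 0 <= v -> 0 < e ->
  u * v <= e `^ p * u `^ p + e `^ (- (p / (p - 1))) * v `^ (p / (p - 1)).
Proof.
move=> p1 u0 v0 e0; have p0 : 0 < p by lra. have q0 : 0 < p - 1 by lra.
have ei : 0 <= e^-1 by rewrite invr_ge0 ltW.
have := @conjugate_powR R (e * u) (e^-1 * v) p (p / (p - 1)).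
rewrite !mulr_ge0 ?(ltW e0)// p0 divr_gt0//.
have E : p^-1 + (p / (p - 1))^-1 = 1 by field; rewrite !gt_eqF.
move=> /(_ isT isT isT isT E).
rewrite mulrACA mulfV ?gt_eqF// mul1r => /le_trans; apply.
rewrite !powRM ?(ltW e0)// powR_inv ?(ltW e0)//.
have le1 (z w : R) : 1 <= w -> 0 <= z -> z / w <= z.
  move=> w1 z0; rewrite ler_pdivrMr; last by lra.
  by rewrite ler_peMr.
apply: lerD; apply: le1.
- exact: ltW.
- by rewrite mulr_ge0 ?powR_ge0.
- by rewrite ler_pdivlMr// mul1r gerBl.
- by rewrite mulr_ge0 ?powR_ge0.
Qed.

(** For each level h, split the integral T F at the distance h^(-p), and the near part
at F = h. The far part and the near part with F <= h are both O(h^(p/q)), so that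
T F > L h^(p/q) forces the remaining piece H h to be large. Chebyshev's inequality
for H h then gives exactly the hypothesis of [weak_to_strong] for the function
(T F / L)^(q/p). *)
Lemma hardy_littlewood_sobolev p q : 1 < p -> p < q -> exists2 C : R, 0 < C &
  forall F, measurable_fun [set: R] F -> (forall y, 0 <= F y) ->
  (\int[mu]_y (F y `^ p)%:E <= 1)%E ->
  (\int[mu]_x ((\int[mu]_y (`|x - y| `^ (p^-1 - q^-1 - 1) * F y)%:E) `^ q) <= C%:E)%E.
Proof.
move=> p1 pq; have p0 : 0 < p by lra. have q0 : 0 < q by lra.
have pm0 : 0 < p - 1 by lra.
set t := p^-1 - q^-1; have t0 : 0 < t by rewrite subr_gt0 ltf_pV2.
pose p' := p / (p - 1); have p'0 : 0 < p' by rewrite divr_gt0.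
pose e := p' / q; have e0 : 0 < e by rewrite divr_gt0.
pose A := 1 + 2 / e; pose B := 2 / t; pose L := A + 2 * B.
have B0 : 0 < B by rewrite divr_gt0.
have A0 : 0 < A by rewrite addr_gt0// divr_gt0.
have L0 : 0 < L by rewrite addr_gt0// mulr_gt0.
have [C C0 HC] := weak_to_strong p1.
exists (L `^ q * C); first by rewrite mulr_gt0 ?powR_gt0.
move=> F mF F0 F1.
pose k x y : R := `|x - y| `^ (t - 1).
have k0 x y : 0 <= k x y by exact: powR_ge0.
pose T x : \bar R := (\int[mu]_y (k x y * F y)%:E)%E.
have mF1 : measurable_fun [set: R * R] (fun z => F z.1) by apply: (measurableT_comp mF).
have mF2 : measurable_fun [set: R * R] (fun z => F z.2) by apply: (measurableT_comp mF).
have T0 x : (0 <= T x)%E by apply: integral_ge0 => y _; rewrite lee_fin mulr_ge0.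
have mT : measurable_fun [set: R] T.
  apply: (@measurable_integral_in _ setT (fun x y => (k x y * F y)%:E)) => //.
    by rewrite /k; mfun.
  by move=> x y; rewrite lee_fin mulr_ge0.
(* |x - y| >= h^(-p): Young's inequality with the scale h^(1/q) *)
have far h x : 0 < h -> (\int[mu]_y (if (h `^ (- p) <= `|x - y|)%R then k x y * F y else 0)%:E <=
    (A * h `^ (p / q))%:E)%E.
  move=> h0; pose r := h `^ (- p); have r0 : 0 < r by exact: powR_gt0.
  have eh : 0 < h `^ (q^-1) by exact: powR_gt0.
  have mk : measurable_fun [set: R] (k x) by rewrite /k; mfun.
  have E1 : h `^ q^-1 `^ p = h `^ (p / q) by rewrite -powRrM mulrC.
  have E2 : h `^ q^-1 `^ (- p') * (2 * (r `^ (- e) / e)) = 2 / e * h `^ (p / q).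
    rewrite /r -!powRrM; have -> : p / q = q^-1 * - p' + - p * - e.
      by rewrite /e /p'; field; rewrite !gt_eqF.
    by rewrite powRDp//; field; exact: lt0r_neq0.
  apply: (@le_trans _ _ ((h `^ (p / q))%:E * \int[mu]_y (F y `^ p)%:E +
     (h `^ q^-1 `^ (- p'))%:E *
     \int[mu]_y (if (r <= `|x - y|)%R then (`|x - y| `^ (- e - 1))%:E else 0))%E); last first.
    have -> : A * h `^ (p / q) = h `^ (p / q) + 2 / e * h `^ (p / q) by rewrite /A; ring.
    rewrite integral_dist_far// -EFinM E2 EFinD.
    apply: leeD => //; rewrite -[leRHS]mule1; apply: lee_wpmul2l => //.
    by rewrite lee_fin powR_ge0.
  rewrite -ge0_integralZl_EFin//; last 3 first.
  - by move=> y _; rewrite lee_fin powR_ge0.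
  - by mfun.
  - exact: powR_ge0.
  rewrite -ge0_integralZl_EFin//; last 3 first.
  - by move=> y _; case: ifP => // _; rewrite lee_fin powR_ge0.
  - by mfun.
  - exact: powR_ge0.
  rewrite -ge0_integralD//; last 4 first.
  - by move=> y _; rewrite -EFinM lee_fin mulr_ge0 ?powR_ge0.
  - by mfun.
  - by move=> y _; case: ifP => _; rewrite ?mule0// -EFinM lee_fin mulr_ge0 ?powR_ge0.
  - by mfun.
  apply: ge0_le_integral => //.
  - by move=> y _; case: ifP => // _; rewrite lee_fin mulr_ge0.
  - by mfun.
  - by mfun.
  move=> y _; case: ifP => _; last first.
    by rewrite mule0 adde0 -EFinM lee_fin mulr_ge0 ?powR_ge0.
  rewrite -!EFinM -EFinD lee_fin mulrC.
  have -> : `|x - y| `^ (- e - 1) = k x y `^ p'.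
    rewrite /k -powRrM; congr (_ `^ _).
    by rewrite /e /t /p'; field; rewrite !gt_eqF.
  by rewrite -E1; exact: young_scaled.
(* the piece to which Chebyshev's inequality applies *)
pose H h x : \bar R := (\int[mu]_y (if (`|x - y| < h `^ (- p))%R && (h < F y)%R
   then k x y * F y else 0)%:E)%E.
have H0 h x : (0 <= H h x)%E.
  by apply: integral_ge0 => y _; rewrite lee_fin; case: ifP => // _; rewrite mulr_ge0.
have mH h : measurable_fun [set: R] (H h).
  apply: (@measurable_integral_in _ setT (fun x y => (if (`|x - y| < h `^ (- p))%R && (h < F y)%R
   then k x y * F y else 0)%:E)) => //.
    by rewrite /k; mfun.
  by move=> x y; rewrite lee_fin; case: ifP => // _; rewrite mulr_ge0.
have hpq h : 0 < h -> h * (h `^ (- p)) `^ t = h `^ (p / q).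
  move=> h0; rewrite -powRrM -[X in X * _](powRr1 (ltW h0)) -powRDp//.
  by congr (_ `^ _); rewrite /t; field; rewrite !gt_eqF.
have split h x : 0 < h -> (T x <= (A * h `^ (p / q))%:E + (B * h `^ (p / q))%:E + H h x)%E.
  move=> h0.
  have mk : measurable_fun [set: R] (k x) by rewrite /k; mfun.
  pose f1 y : R := if h `^ (- p) <= `|x - y| then k x y * F y else 0.
  pose f2 y : R := if `|x - y| < h `^ (- p) then h * k x y else 0.
  pose f3 y : R := if (`|x - y| < h `^ (- p)) && (h < F y) then k x y * F y else 0.
  have mf1 : measurable_fun [set: R] f1 by rewrite /f1; mfun.
  have mf2 : measurable_fun [set: R] f2 by rewrite /f2; mfun.
  have mf3 : measurable_fun [set: R] f3 by rewrite /f3; mfun.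
  have f10 y : 0 <= f1 y by rewrite /f1; case: ifP => // _; rewrite mulr_ge0.
  have f20 y : 0 <= f2 y by rewrite /f2; case: ifP => // _; rewrite mulr_ge0// ltW.
  have f30 y : 0 <= f3 y by rewrite /f3; case: ifP => // _; rewrite mulr_ge0.
  apply: (@le_trans _ _ (\int[mu]_y (f1 y)%:E + \int[mu]_y (f2 y)%:E + \int[mu]_y (f3 y)%:E)%E).
    rewrite -ge0_integralD//; last 4 first.
    - by move=> y _; rewrite lee_fin.
    - by mfun.
    - by move=> y _; rewrite lee_fin.
    - by mfun.
    rewrite -ge0_integralD//; last 4 first.
    - by move=> y _; rewrite -EFinD lee_fin addr_ge0.
    - by mfun.
    - by move=> y _; rewrite lee_fin.
    - by mfun.
    apply: ge0_le_integral => //.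
    - by move=> y _; rewrite lee_fin mulr_ge0.
    - by mfun.
    - by mfun.
    move=> y _; rewrite -!EFinD lee_fin /f1 /f2 /f3.
    have [h1|h1] := ltP; rewrite /= ?addr0//.
    have [h2|h2] := ltP; rewrite ?add0r ?addr0.
      by rewrite lerDr mulr_ge0// ltW.
    by rewrite mulrC ler_wpM2r.
  apply: leeD => //; apply: leeD; first exact: far.
  have r0 : 0 <= h `^ (- p) by exact: powR_ge0.
  apply: (@le_trans _ _ (h%:E * \int[mu]_y (if (`|x - y| < h `^ (- p))%R then (k x y)%:E else 0))%E).
    rewrite -ge0_integralZl_EFin ?(ltW h0)//.
    - apply: ge0_le_integral => //.
      + by move=> y _; rewrite lee_fin.
      + by mfun.
      + by mfun.
      + by move=> y _; rewrite /f2; case: ifP => _; rewrite ?mule0// -EFinM.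
    - by move=> y _; case: ifP => // _; rewrite lee_fin.
    - by mfun.
  apply: (@le_trans _ _ (h%:E * (2 * ((h `^ (- p)) `^ t / t))%:E)%E).
    by apply: lee_wpmul2l; [rewrite lee_fin ltW|exact: integral_dist_near].
  rewrite -EFinM lee_fin -hpq// /B; apply: le_of_eq.
  by field; exact: lt0r_neq0.
have Hint h : 0 < h -> (\int[mu]_x H h x <= (B * (h `^ (- p)) `^ t)%:E *
     \int[mu]_y (if (h < F y)%R then F y else 0)%:E)%E.
  move=> h0; rewrite /H tonelli_in//; last 2 first.
  - by rewrite /k; mfun.
  - by move=> x y; rewrite lee_fin; case: ifP => // _; rewrite mulr_ge0.
  have Br0 : 0 <= B * (h `^ (- p)) `^ t by rewrite mulr_ge0 ?powR_ge0 ?(ltW B0).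
  rewrite -ge0_integralZl_EFin//; last 2 first.
  - by move=> y _; rewrite lee_fin; case: ifP.
  - by mfun.
  apply: ge0_le_integral => //.
  - move=> y _; apply: integral_ge0 => x _.
    by rewrite lee_fin; case: ifP => // _; rewrite mulr_ge0.
  - apply: (@measurable_integral_in _ setT (fun y x => (if (`|x - y| < h `^ (- p))%R && (h < F y)%R
      then k x y * F y else 0)%:E)) => //.
      by rewrite /k; mfun.
    by move=> x y; rewrite lee_fin; case: ifP => // _; rewrite mulr_ge0.
  - by mfun.
  move=> y _; case: ifPn => hF; last first.
    rewrite mule0 integral0_eq// => x _.
    by rewrite andbF.
  apply: (@le_trans _ _ ((F y)%:E * \int[mu]_x (if (`|y - x| < h `^ (- p))%R then
     (`|y - x| `^ (t - 1))%:E else 0))%E).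
    rewrite -ge0_integralZl_EFin//; last 2 first.
    - by move=> x _; case: ifP => // _; rewrite lee_fin powR_ge0.
    - by mfun.
    apply: ge0_le_integral => //.
    - by move=> x _; rewrite lee_fin; case: ifP => // _; rewrite mulr_ge0.
    - by rewrite /k; mfun.
    - by mfun.
    - move=> x _; rewrite andbT distrC; case: ifP => _; rewrite ?mule0//.
      by rewrite /k distrC -EFinM mulrC.
  rewrite -EFinM mulrC EFinM; apply: lee_wpmul2l; first by rewrite lee_fin.
  apply: (le_trans (integral_dist_near _ t0 (powR_ge0 _ _))).
  by rewrite lee_fin /B; apply: le_of_eq; field; exact: lt0r_neq0.
(* where G > h the first two pieces are at most (A + B) h^(p/q), and L = A + 2 B
leaves more than B h^(p/q) for H h *)
pose G x : \bar R := (((L^-1)%:E * T x) `^ (q / p))%E.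
have Li : 0 <= L^-1 by rewrite invr_ge0 ltW.
have mLT : measurable_fun [set: R] (fun x => ((L^-1)%:E * T x)%E) by mfun.
have G0 x : (0 <= G x)%E by exact: poweR_ge0.
have mG : measurable_fun [set: R] G by rewrite /G; mfun.
have weak h : 0 < h -> (h%:E * mu [set x | h%:E < G x] <=
     \int[mu]_y (if (h < F y)%R then F y else 0)%:E)%E.
  move=> h0; have hp0 : 0 < h `^ (p / q) by exact: powR_gt0.
  have sub : [set x | (h%:E < G x)%E] `<=` [set x | ((B * h `^ (p / q))%:E <= `|H h x|)%E].
    move=> x /=; rewrite gee0_abs// => hG; rewrite leNgt; apply/negP => hH.
    move: hG; apply/negP; rewrite -leNgt /G.
    have TL : (T x <= (L * h `^ (p / q))%:E)%E.
      apply: (le_trans (split h x h0)).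
      apply: (@le_trans _ _ ((A * h `^ (p / q))%:E + (B * h `^ (p / q))%:E + (B * h `^ (p / q))%:E)%E).
        by apply: leeD => //; exact: ltW.
      by rewrite -!EFinD lee_fin /L; apply: le_of_eq; ring.
    have : ((L^-1)%:E * T x <= (h `^ (p / q))%:E)%E.
      apply: (@le_trans _ _ ((L^-1)%:E * (L * h `^ (p / q))%:E)%E).
        by apply: lee_wpmul2l => //; rewrite lee_fin.
      by rewrite -EFinM mulrA mulVf ?mul1r// gt_eqF.
    move=> /(ge0_le_poweR (ltW (divr_gt0 q0 p0)) (mule_ge0 _ (T0 x))).
    rewrite lee_fin => /(_ Li) /le_trans; apply.
    rewrite /= -powRrM (_ : p / q * (q / p) = 1) ?powRr1 ?(ltW h0)//.
    by field; rewrite !gt_eqF.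
  have mset : measurable [set x | ((B * h `^ (p / q))%:E <= `|H h x|)%E].
    rewrite -[X in measurable X]setTI; apply: measurable_lee => //.
    by apply: measurableT_comp => //; exact: mH.
  have mset2 : measurable [set x | (h%:E < G x)%E].
    by rewrite -[X in measurable X]setTI; exact: emeasurable_fun_o_infty.
  have Bh : 0 < B * h `^ (p / q) by exact: mulr_gt0.
  have M := le_integral_abse mu measurableT (mH h) Bh; rewrite setTI in M.
  have M2 : ((B * h `^ (p / q))%:E * mu [set x | h%:E < G x] <= \int[mu]_x H h x)%E.
    apply: (@le_trans _ _ ((B * h `^ (p / q))%:E * mu [set x | ((B * h `^ (p / q))%:E <= `|H h x|)])%E).
      by apply: lee_wpmul2l; [rewrite lee_fin ltW|apply: le_measure; rewrite ?inE].
    apply: (le_trans M); apply: le_of_eq.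
    by apply: eq_integral => x _; rewrite gee0_abs.
  have M3 := le_trans M2 (Hint h h0).
  rewrite -hpq// in M3.
  have X0 : 0 < B * (h `^ (- p)) `^ t by rewrite mulr_gt0// powR_gt0// powR_gt0.
  rewrite -(@lee_pmul2l _ (B * (h `^ (- p)) `^ t)%:E) ?lte_fin//.
  apply: le_trans M3; rewrite muleA -EFinM; apply: le_of_eq.
  by congr ((_)%:E * _)%E; ring.
have := HC G F mG mF G0 F0 weak.
have -> : (\int[mu]_x (G x `^ p) = (L `^ (- q))%:E * \int[mu]_x (T x `^ q))%E.
  rewrite -ge0_integralZl_EFin//; last 3 first.
  - by move=> x _; exact: poweR_ge0.
  - by mfun.
  - exact: powR_ge0.
  apply: eq_integral => x _; rewrite /G -poweRrM divfK ?gt_eqF// poweRM ?T0 ?lee_fin//.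
  by rewrite poweR_EFin powR_inv// ltW.
move=> h.
rewrite -/(T _) -(@lee_pmul2l _ (L `^ (- q))%:E) ?lte_fin ?powR_gt0//.
apply: (le_trans h); rewrite -EFinM mulrA -powRDp// addNr powRr0 mul1r.
rewrite -[leRHS]mule1; apply: lee_wpmul2l => //; by rewrite lee_fin ltW.
Qed.

End hls.

(** * Hardy operators *)

Section hardy.
#[local] Opaque powR expR ln integral.
Context {R : realType}.
Local Notation mu := (@lebesgue_measure R).
Implicit Types (p q r t h x y : R) (F : R -> R).

Lemma hoelder_pow (p X : R) (f g : R -> R) : 1 < p ->
  measurable_fun [set: R] f -> measurable_fun [set: R] g ->
  (forall x, 0 <= f x) -> (forall x, 0 <= g x) -> 0 <= X ->
  (\int[mu]_x (g x `^ (p / (p - 1)))%:E <= X%:E)%E ->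
  ((\int[mu]_x (g x * f x)%:E) `^ p <= (X `^ (p - 1))%:E * \int[mu]_x (f x `^ p)%:E)%E.
Proof.
move=> p1 mf mg f0 g0 X0 gX; have p0 : 0 < p by lra. have q0 : 0 < p - 1 by lra.
have p'0 : 0 < p / (p - 1) by rewrite divr_gt0.
have E : (p / (p - 1))^-1 + p^-1 = 1 by field; rewrite !gt_eqF.
have := @hoelder _ (measurableTypeR R) R mu g f _ _ mg mf p'0 p0 E.
rewrite Lnorm1.
have -> : (\int[mu]_x `|(EFin \o (g \* f)%R) x| = \int[mu]_x (g x * f x)%:E)%E.
  by apply: eq_integral => x _ /=; rewrite ger0_norm ?mulr_ge0.
have I0 : (0 <= \int[mu]_x (g x * f x)%:E)%E.
  by apply: integral_ge0 => x _; rewrite lee_fin mulr_ge0.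
rewrite unlock /=.
have -> : (\int[mu]_x `|g x|%:E `^ (p / (p - 1)) = \int[mu]_x (g x `^ (p / (p - 1)))%:E)%E.
  by apply: eq_integral => x _; rewrite ger0_norm.
have -> : (\int[mu]_x `|f x|%:E `^ p = \int[mu]_x (f x `^ p)%:E)%E.
  by apply: eq_integral => x _; rewrite ger0_norm.
set A := (\int[mu]_x (g x `^ _)%:E)%E in gX *; set B := (\int[mu]_x (f x `^ p)%:E)%E.
have A0 : (0 <= A)%E by apply: integral_ge0 => x _; rewrite lee_fin powR_ge0.
have B0 : (0 <= B)%E by apply: integral_ge0 => x _; rewrite lee_fin powR_ge0.
move=> /(ge0_le_poweR (ltW p0) I0) /le_trans; apply; rewrite /=.
rewrite poweRM ?poweR_ge0// -!poweRrM mulVf ?gt_eqF// poweRe1//.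
apply: lee_wpmul2r => //.
have -> : (p / (p - 1))^-1 * p = p - 1 by field; rewrite !gt_eqF.
exact: (ge0_le_poweR (ltW q0) A0 gX).
Qed.

(** The ranges of the two Hardy operators, handled together: c = true integrates
from the origin, c = false up to infinity. *)
Definition hrange (c : bool) (x y : R) : bool := if c then (0 < y) && (y <= x) else x <= y.

Lemma hrange_gt0 c x y : 0 < x -> hrange c x y -> 0 < y.
Proof. by move=> x0; case: c => [/andP[]//|]; exact: lt_le_trans. Qed.

Lemma hrange_sym c x y : 0 < x -> 0 < y -> hrange c x y = hrange (~~ c) y x.
Proof. by move=> x0 y0; case: c; rewrite /hrange/= ?x0 ?y0. Qed.

Lemma measurable_hrange c : measurable_fun [set: R * R] (fun z => hrange c z.1 z.2).
Proof. by case: c; rewrite /hrange; mfun. Qed.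

Lemma measurable_hrange1 c x : measurable_fun [set: R] (hrange c x).
Proof. by case: c; rewrite /hrange; mfun. Qed.

(** The sign of t for which y^(t-1) is integrable over [hrange c x]. *)
Definition hsign (c : bool) (t : R) := if c then 0 < t else t < 0.

Lemma hsign_neq0 c t : hsign c t -> t != 0.
Proof. by case: c => /= h; [rewrite gt_eqF|rewrite lt_eqF]. Qed.

Lemma hsign_opp c t : hsign c t -> hsign (~~ c) (- t).
Proof. by case: c => /=; rewrite ?oppr_lt0 ?oppr_gt0. Qed.

Lemma integral_hrange c (t x : R) : 0 < x -> hsign c t ->
  (\int[mu]_y (if hrange c x y then y `^ (t - 1) else 0)%:E <= (x `^ t / `|t|)%:E)%E.
Proof.
move=> x0; case: c => /= t0.
  rewrite gtr0_norm//; apply: le_trans (integral_powR_0 t0 x0).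
  rewrite -(@integral_if _ setT `]0, x]%classic (hrange true x))//; last first.
    by move=> y; rewrite /= in_itv/=; split=> [|[]].
  by apply: le_of_eq; apply: eq_integral => y _; rewrite /hrange; case: ifP.
have nt0 : 0 < - t by rewrite oppr_gt0.
have := integral_powR_pinfty nt0 x0; rewrite opprK ltr0_norm// => <-.
rewrite -(@integral_if _ setT `[x, +oo[%classic (hrange false x))//; last first.
  by move=> y; rewrite /= in_itv/= andbT; split=> [|[]].
by apply: le_of_eq; apply: eq_integral => y _; rewrite /hrange; case: ifP.
Qed.

(** Hoelder's inequality gives the pointwise decay x^(-1/q). With it, all but the
first p powers of the potential are absorbed, and the rest is a Schur test with
the auxiliary weight y^t. *)
Lemma hardy c p q (r t : R) : 1 < p -> p < q ->
  hsign c (r * (p / (p - 1)) + 1) -> hsign c (r - t * (p / (p - 1)) + 1) ->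
  hsign c (r + t * p) -> exists2 C : R, 0 < C &
  forall F, measurable_fun [set: R] F -> (forall y, 0 <= F y) ->
  (\int[mu]_y (F y `^ p)%:E <= 1)%E ->
  (\int[mu]_(x in Rpos R)
     ((\int[mu]_y (if hrange c x y then x `^ (p^-1 - q^-1 - 1 - r) * y `^ r * F y else 0)%:E)
        `^ q) <= C%:E)%E.
Proof.
move=> p1 pq; have p0 : 0 < p by lra. have q0 : 0 < q by lra.
have pm0 : 0 < p - 1 by lra.
set p' := p / (p - 1) => s1 s2 s3; have p'0 : 0 < p' by rewrite divr_gt0.
set a := p^-1 - q^-1.
have p'p : p' * (p - 1) = p by rewrite /p'; field; exact: lt0r_neq0.
have n1 : 0 < `|r * p' + 1| by rewrite normr_gt0 (hsign_neq0 s1).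
have n2 : 0 < `|r - t * p' + 1| by rewrite normr_gt0 (hsign_neq0 s2).
have n3 : 0 < `|r + t * p| by rewrite normr_gt0 (hsign_neq0 s3).
pose C1 := (`|r * p' + 1|^-1) `^ (p - 1); pose C2 := (`|r - t * p' + 1|^-1) `^ (p - 1).
have C10 : 0 < C1 by rewrite powR_gt0// invr_gt0.
have C20 : 0 < C2 by rewrite powR_gt0// invr_gt0.
pose C3 := C2 * C1 `^ ((q - p) / p).
have C30 : 0 < C3 by rewrite mulr_gt0// powR_gt0.
exists (C3 / `|r + t * p|); first by rewrite divr_gt0.
move=> F mF F0 F1.
have mF2 : measurable_fun [set: R * R] (fun z => F z.2) by apply: (measurableT_comp mF).
have mF1 : measurable_fun [set: R * R] (fun z => F z.1) by apply: (measurableT_comp mF).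
have mh := measurable_hrange c.
have mh' : measurable_fun [set: R * R] (fun z => hrange c z.2 z.1).
  have -> : (fun z : R * R => hrange c z.2 z.1) = (fun z => hrange c z.1 z.2) \o (fun z => (z.2, z.1)).
    by [].
  by apply: (measurableT_comp mh); exact: measurable_swap.
pose g x y : R := if hrange c x y then y `^ r else 0.
have mg x : measurable_fun [set: R] (g x).
  by have := measurable_hrange1 c x => mh1; rewrite /g; mfun.
have g0 x y : 0 <= g x y by rewrite /g; case: ifP => // _; exact: powR_ge0.
pose S x : \bar R := (\int[mu]_y (g x y * F y)%:E)%E.
have S0 x : (0 <= S x)%E by apply: integral_ge0 => y _; rewrite lee_fin mulr_ge0.
have HS x : (\int[mu]_y (if hrange c x y then x `^ (a - 1 - r) * y `^ r * F y else 0)%:E =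
   (x `^ (a - 1 - r))%:E * S x)%E.
  have mgx := mg x; rewrite /S -ge0_integralZl_EFin//.
  - apply: eq_integral => y _; rewrite -EFinM; congr EFin; rewrite /g.
    by case: ifP => _; rewrite ?mul0r ?mulr0// mulrA.
  - by move=> y _; rewrite lee_fin mulr_ge0.
  - by mfun.
  - exact: powR_ge0.
have P1 x : 0 < x -> (S x `^ p <= (C1 * x `^ ((r * p' + 1) * (p - 1)))%:E)%E.
  move=> x0.
  have H : (\int[mu]_y (g x y `^ p')%:E <= (x `^ (r * p' + 1) / `|r * p' + 1|)%:E)%E.
    apply: le_trans (integral_hrange x0 s1); apply: le_of_eq.
    apply: eq_integral => y _; congr EFin; rewrite /g; case: ifP => _; last first.
      by rewrite powR0// gt_eqF.
    by rewrite -powRrM addrK.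
  have X0 : 0 <= x `^ (r * p' + 1) / `|r * p' + 1| by rewrite divr_ge0 ?powR_ge0.
  apply: (le_trans (hoelder_pow p1 mF (mg x) F0 (g0 x) X0 H)).
  rewrite powRM ?powR_ge0 ?invr_ge0// -powRrM -/C1 mulrC.
  rewrite -[leRHS]mule1; apply: lee_wpmul2l => //.
  by rewrite lee_fin mulr_ge0 ?powR_ge0// ltW.
pose w := (r + t * p) / p.
have P2 x : 0 < x -> (S x `^ p <= (C2 * x `^ ((r - t * p' + 1) * (p - 1)))%:E *
    \int[mu]_y (if hrange c x y then y `^ (r + t * p) * F y `^ p else 0)%:E)%E.
  move=> x0; have mh1 := measurable_hrange1 c x.
  pose f1 y : R := if hrange c x y then y `^ w * F y else 0.
  pose g1 y : R := if hrange c x y then y `^ (r - w) else 0.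
  have mf1 : measurable_fun [set: R] f1 by rewrite /f1; mfun.
  have mg1 : measurable_fun [set: R] g1 by rewrite /g1; mfun.
  have f10 y : 0 <= f1 y by rewrite /f1; case: ifP => // _; rewrite mulr_ge0 ?powR_ge0.
  have g10 y : 0 <= g1 y by rewrite /g1; case: ifP => // _; rewrite powR_ge0.
  have H : (\int[mu]_y (g1 y `^ p')%:E <= (x `^ (r - t * p' + 1) / `|r - t * p' + 1|)%:E)%E.
    apply: le_trans (integral_hrange x0 s2); apply: le_of_eq.
    apply: eq_integral => y _; congr EFin; rewrite /g1; case: ifP => _; last first.
      by rewrite powR0// gt_eqF.
    rewrite -powRrM addrK; congr (_ `^ _); rewrite /w /p'.
    by field; rewrite !gt_eqF.
  have X0 : 0 <= x `^ (r - t * p' + 1) / `|r - t * p' + 1| by rewrite divr_ge0 ?powR_ge0.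
  have := hoelder_pow p1 mf1 mg1 f10 g10 X0 H.
  have -> : (\int[mu]_y (g1 y * f1 y)%:E = S x)%E.
    apply: eq_integral => y _; congr EFin; rewrite /g1 /f1 /g; case: ifP => hy; last by rewrite !mul0r.
    have y0 : 0 < y by exact: hrange_gt0 hy.
    by rewrite mulrA -powRDp// subrK.
  have -> : (\int[mu]_y (f1 y `^ p)%:E =
      \int[mu]_y (if hrange c x y then y `^ (r + t * p) * F y `^ p else 0)%:E)%E.
    apply: eq_integral => y _; congr EFin; rewrite /f1; case: ifP => _; last by rewrite powR0// gt_eqF.
    by rewrite powRM ?powR_ge0// -powRrM /w divfK// gt_eqF.
  by rewrite powRM ?powR_ge0 ?invr_ge0// -powRrM -/C2 [_ * C2]mulrC.
clearbody C1 C2.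
pose e := r + t * p.
have key x : 0 < x -> (((x `^ (a - 1 - r))%:E * S x) `^ q <=
    \int[mu]_y (if hrange c x y then C3 * x `^ (- e - 1) * (y `^ e * F y `^ p) else 0)%:E)%E.
  move=> x0.
  have mh1 := measurable_hrange1 c x.
  set I := (\int[mu]_y (if hrange c x y then y `^ e * F y `^ p else 0)%:E)%E.
  have I0 : (0 <= I)%E.
    by apply: integral_ge0 => y _; rewrite lee_fin; case: ifP => // _; rewrite mulr_ge0 ?powR_ge0.
  have -> : (\int[mu]_y (if hrange c x y then C3 * x `^ (- e - 1) * (y `^ e * F y `^ p) else 0)%:E
      = (C3 * x `^ (- e - 1))%:E * I)%E.
    rewrite /I -ge0_integralZl_EFin//.
    - by apply: eq_integral => y _; case: ifP => _; rewrite ?mule0// -EFinM.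
    - by move=> y _; rewrite lee_fin; case: ifP => // _; rewrite mulr_ge0 ?powR_ge0.
    - by mfun.
    - by rewrite mulr_ge0 ?powR_ge0// ltW.
  rewrite poweRM ?S0 ?lee_fin ?powR_ge0// poweR_EFin.
  have qp : 0 < q - p by rewrite subr_gt0.
  have -> : (S x `^ q = S x `^ p * (S x `^ p) `^ ((q - p) / p))%E.
    rewrite -poweRrM [p * _]mulrC divfK ?gt_eqF// -poweRD; first by rewrite addrC subrK.
    by apply: add_neq0_poweRD_def; rewrite addrC subrK gt_eqF.
  have Y0 : 0 <= C1 * x `^ ((r * p' + 1) * (p - 1)) by rewrite mulr_ge0 ?powR_ge0// ltW.
  have B1 : ((S x `^ p) `^ ((q - p) / p) <=
      ((C1 * x `^ ((r * p' + 1) * (p - 1))) `^ ((q - p) / p))%:E)%E.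
    apply: (ge0_le_poweR (v := (C1 * x `^ ((r * p' + 1) * (p - 1)))%:E)); last exact: P1.
      exact: ltW (divr_gt0 qp p0).
    exact: poweR_ge0.
  apply: (@le_trans _ _ ((x `^ (a - 1 - r) `^ q)%:E *
     (((C2 * x `^ ((r - t * p' + 1) * (p - 1)))%:E * I) *
      ((C1 * x `^ ((r * p' + 1) * (p - 1))) `^ ((q - p) / p))%:E))%E).
    apply: lee_wpmul2l; first by rewrite lee_fin powR_ge0.
    by apply: lee_pmul => //; rewrite ?poweR_ge0//; exact: P2.
  rewrite [X in (_ * X <= _)%E]muleAC -EFinM muleA -EFinM; apply: lee_wpmul2r => //.
  rewrite lee_fin powRM ?powR_ge0 ?(ltW C10)// -!powRrM; apply: le_of_eq.
  have -> : x `^ (- e - 1) = x `^ ((a - 1 - r) * q) *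
      x `^ ((r * p' + 1) * (p - 1) * ((q - p) / p)) * x `^ ((r - t * p' + 1) * (p - 1)).
    rewrite -!powRDp//; congr (_ `^ _); rewrite /e /a /p'.
    by field; rewrite !gt_eqF.
  by rewrite /C3; ring.
clearbody C3.
apply: (@le_trans _ _ (\int[mu]_(x in Rpos R)
   \int[mu]_y (if hrange c x y then C3 * x `^ (- e - 1) * (y `^ e * F y `^ p) else 0)%:E)%E).
  have mS : measurable_fun [set: R] S.
    apply: (@measurable_integral_in _ setT (fun x y => (g x y * F y)%:E)) => //.
      by rewrite /g; mfun.
    by move=> x y; rewrite lee_fin mulr_ge0.
  under eq_integral do rewrite HS.
  apply: ge0_le_integral => //.
  - by move=> x _; exact: poweR_ge0.
  - by apply: measurable_funTS; mfun.
  - apply: measurable_funTS; apply: (@measurable_integral_in _ setT (fun x y =>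
      (if hrange c x y then C3 * x `^ (- e - 1) * (y `^ e * F y `^ p) else 0)%:E)) => //.
      by mfun.
    move=> x y; rewrite lee_fin; case: ifP => // _.
    by rewrite !mulr_ge0 ?powR_ge0 ?(ltW C30).
  - by move=> x; rewrite RposE; exact: key.
rewrite tonelli_in//; last 2 first.
- by mfun.
- move=> x y; rewrite lee_fin; case: ifP => // _.
  by rewrite !mulr_ge0 ?powR_ge0 ?(ltW C30).
have C3e : 0 <= C3 / `|e| by rewrite divr_ge0 ?(ltW C30).
apply: (@le_trans _ _ ((C3 / `|e|)%:E * \int[mu]_y (F y `^ p)%:E)%E); last first.
  by rewrite -[leRHS]mule1; apply: lee_wpmul2l => //; rewrite lee_fin.
rewrite -ge0_integralZl_EFin//; last 2 first.
- by move=> y _; rewrite lee_fin powR_ge0.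
- by mfun.
apply: ge0_le_integral => //.
- move=> y _; apply: integral_ge0 => x _; rewrite lee_fin; case: ifP => // _.
  by rewrite !mulr_ge0 ?powR_ge0 ?(ltW C30).
- apply: (@measurable_integral_in _ (Rpos R) (fun y x =>
      (if hrange c x y then C3 * x `^ (- e - 1) * (y `^ e * F y `^ p) else 0)%:E)) => //.
    by mfun.
  move=> x y; rewrite lee_fin; case: ifP => // _.
  by rewrite !mulr_ge0 ?powR_ge0 ?(ltW C30).
- by mfun.
move=> y _; have [y0|y0] := leP y 0.
  rewrite integral0_eq; first by rewrite -EFinM lee_fin mulr_ge0 ?powR_ge0.
  move=> x; rewrite RposE => x0; case: ifP => // /(hrange_gt0 x0).
  by rewrite ltNge y0.
have se : hsign (~~ c) (- e).
  exact: hsign_opp s3.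
have J := integral_hrange y0 se.
have mh1 := measurable_hrange1 (~~ c) y.
apply: (@le_trans _ _ ((C3 * (y `^ e * F y `^ p))%:E *
   \int[mu]_x (if hrange (~~ c) y x then x `^ (- e - 1) else 0)%:E)%E).
  rewrite -ge0_integralZl_EFin//; last 3 first.
  - by move=> x _; rewrite lee_fin; case: ifP => // _; exact: powR_ge0.
  - by mfun.
  - by rewrite !mulr_ge0 ?powR_ge0 ?(ltW C30).
  apply: (@le_trans _ _ (\int[mu]_(x in Rpos R) ((C3 * (y `^ e * F y `^ p))%:E *
     (if hrange (~~ c) y x then x `^ (- e - 1) else 0)%:E))%E).
    apply: le_of_eq; apply: eq_integral => x.
    rewrite mem_Rpos => x0; rewrite -EFinM; congr EFin; rewrite (hrange_sym c x0 y0).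
    by case: ifP => _; rewrite ?mulr0//; ring.
  apply: ge0_subset_integral => //.
  - by mfun.
  - move=> x _; rewrite -EFinM lee_fin mulr_ge0//.
      by rewrite !mulr_ge0 ?powR_ge0 ?(ltW C30).
    by case: ifP => // _; exact: powR_ge0.
apply: (@le_trans _ _ ((C3 * (y `^ e * F y `^ p))%:E * (y `^ (- e) / `|- e|)%:E)%E).
  by apply: lee_wpmul2l => //; rewrite lee_fin !mulr_ge0 ?powR_ge0 ?(ltW C30).
rewrite -!EFinM lee_fin normrN; apply: le_of_eq.
have e0 : 0 < `|e| by [].
rewrite powRN; have ye : 0 < y `^ e by exact: powR_gt0.
by field; rewrite !gt_eqF// -normr_gt0.
Qed.

End hardy.

(** * The operator on nonnegative functions *)

#[local] Instance ae_lebesgue_filter (R : realType) :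
  Filter (nbhs (almost_everywhere (@lebesgue_measure R))) :=
  ae_filter_ringOfSetsType (@lebesgue_measure R).

Section positive_operator.
#[local] Opaque powR expR ln integral.
Context {R : realType}.
Local Notation mu := (@lebesgue_measure R).
Implicit Types (a s x y : R) (p : \bar R) (f F : R -> R).

(** |f|, extended by 0. As the kernel is positive, f is in the domain if and only if
the potential of this function is finite almost everywhere. *)
Definition abs_pos f y : R := `|(f \_ (Rpos R)) y|.

Definition pos_potential a s F x : \bar R :=
  (\int[mu]_(y in Rpos R) (kser a s x y * (F y)%:E))%E.

(** Membership in L^p for a nonnegative measurable function. *)
Definition Lp_finite p F : Prop :=
  match p with
  | r%:E => (\int[mu]_y (F y `^ r)%:E < +oo)%E
  | _ => exists M : R, {ae mu, forall y, F y <= M}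
  end.

Lemma abs_pos_ge0 f y : 0 <= abs_pos f y. Proof. exact: normr_ge0. Qed.

Lemma abs_posE f y : 0 < y -> abs_pos f y = `|f y|.
Proof. by move=> y0; rewrite /abs_pos patchE mem_set// RposE. Qed.

Lemma abs_pos_out f y : ~ 0 < y -> abs_pos f y = 0.
Proof. by move=> y0; rewrite /abs_pos patchE memNset ?normr0// RposE. Qed.

Lemma measurable_abs_pos f : measurable_fun [set: R] (f \_ (Rpos R)) ->
  measurable_fun [set: R] (abs_pos f).
Proof. by move=> mf; apply: measurableT_comp. Qed.

Lemma lebesgue_measure_setT_gt0 : (0 < mu [set: R])%E.
Proof.
apply: (@lt_le_trans _ _ (mu `[0%R, 1%R]%classic)).
  by rewrite lebesgue_measure_segment// subr0 lte01.
by apply: le_measure; rewrite ?inE.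
Qed.

Lemma norm_pos_real (r : R) f : norm_pos r%:E (EFin \o f) =
  ((\int[mu]_y (abs_pos f y `^ r)%:E) `^ r^-1)%E.
Proof.
rewrite /norm_pos unlock; congr (_ `^ _)%E; apply: eq_integral => y _.
by rewrite -poweR_EFin /abs_pos !patchE; case: ifP => _; rewrite /= ?normr0.
Qed.

Lemma Lp_posP p f : (1 <= p)%E ->
  Lp_pos p f <-> measurable_fun [set: R] (f \_ (Rpos R)) /\ Lp_finite p (abs_pos f).
Proof.
have sup_bound : (ess_sup mu (abse \o (EFin \o (f \_ (Rpos R)))) < +oo)%E <->
    (exists M : R, {ae mu, forall y, abs_pos f y <= M}).
  split=> [H|[M HM]].
    set E := ess_sup _ _ in H.
    have E0 : (0 <= E)%E.
      by apply: ess_sup_gee; [exact: lebesgue_measure_setT_gt0|apply: aeW => y /=].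
    exists (fine E); have := ess_sup_ge mu (abse \o (EFin \o (f \_ (Rpos R)))).
    apply: filterS => y; rewrite -/E /= => h.
    by rewrite -lee_fin fineK// ge0_fin_numE.
  apply: (@le_lt_trans _ _ M%:E); last exact: ltry.
  by apply/ess_supP; move: HM; apply: filterS => y; rewrite lee_fin.
move=> p1; rewrite /Lp_pos/=; split.
  rewrite inE => /andP[/set_mem/= m1 /set_mem/= fin]; split => //.
  move: p1 fin; case: p => [r| |]//=.
    rewrite lee_fin => r1; rewrite /finite_norm unlock => H.
    have r0 : 0 < r by exact: lt_le_trans r1.
    rewrite (_ : (\int[mu]_y (abs_pos f y `^ r)%:E =
      \int[mu]_y (`|(EFin \o (f \_ (Rpos R))) y| `^ r))%E); last first.
      by apply: eq_integral => y _; rewrite -poweR_EFin.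
    by apply: lty_poweRy H; rewrite gt_eqF ?invr_gt0.
  move=> _; rewrite /finite_norm unlock lebesgue_measure_setT_gt0.
  by move/sup_bound.
case=> mf fin; rewrite inE; apply/andP; split; apply: mem_set => //=.
rewrite /finite_norm unlock; case: p p1 fin => [r| |]//=.
  rewrite lee_fin => r1 H; have r0 : 0 < r by exact: lt_le_trans r1.
  apply: poweR_lty; apply: le_lt_trans H.
  apply: ge0_le_integral => //.
  - by mfun.
  - by have := measurable_abs_pos mf => ?; mfun.
by move=> _ ?; rewrite lebesgue_measure_setT_gt0; apply/sup_bound.
Qed.

Section kernel.
Variables a s : R.
Hypotheses (a1 : -1 < a) (s0 : 0 < s) (sa : s < a + 1).

Lemma measurable_kser2 x : measurable_fun [set: R] (kser a s x).
Proof.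
have := measurable_kser a1 sa => H.
exact: (measurableT_comp H (measurable_pair1 x)).
Qed.

Lemma measurable_pos_potential F : measurable_fun [set: R] F -> (forall y, 0 <= F y) ->
  measurable_fun [set: R] (pos_potential a s F).
Proof.
move=> mF F0.
apply: (@measurable_integral_in _ (Rpos R) (fun x y => (kser a s x y * (F y)%:E)%E)) => //.
  have := measurable_kser a1 sa => H.
  apply: emeasurable_funM => //; apply/measurable_EFinP.
  exact: (measurableT_comp mF).
by move=> x y; rewrite mule_ge0// ?lee_fin//; exact: kser_ge0.
Qed.

Lemma pos_potential_ge0 F x : (forall y, 0 <= F y) -> (0 <= pos_potential a s F x)%E.
Proof.
by move=> F0; apply: integral_ge0 => y _; rewrite mule_ge0// ?lee_fin//; exact: kser_ge0.
Qed.

Lemma abse_potential_integrand f x : 0 < x ->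
  (\int[mu]_(y in Rpos R) `|potential_kernel a s x y * (f y)%:E|)%E =
  pos_potential a s (abs_pos f) x.
Proof.
move=> x0; apply: eq_integral => y; rewrite mem_Rpos => y0.
by rewrite potential_kernelE// abseM gee0_abs ?kser_ge0// abs_posE.
Qed.

Lemma measurable_potential_integrand f x : measurable_fun [set: R] (f \_ (Rpos R)) -> 0 < x ->
  measurable_fun (Rpos R) (fun y => potential_kernel a s x y * (f y)%:E)%E.
Proof.
move=> mf x0.
apply: (@eq_measurable_fun _ _ _ _ _ (fun y => kser a s x y * ((f \_ (Rpos R)) y)%:E)%E).
  move=> y; rewrite mem_Rpos => y0; rewrite potential_kernelE// patchE mem_set//.
  by rewrite RposE.
apply: measurable_funTS; apply: emeasurable_funM; first exact: measurable_kser2.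
by apply/measurable_EFinP.
Qed.

Lemma Dom_potentialP f : measurable_fun [set: R] (f \_ (Rpos R)) ->
  Dom_potential a s f <->
  {ae mu, forall x, Rpos R x -> (pos_potential a s (abs_pos f) x < +oo)%E}.
Proof.
move=> mf; split; rewrite /Dom_potential/=; apply: filterS => x H x0; have := H x0.
  by move/integrableP => [_]; rewrite abse_potential_integrand -?RposE.
move: x0; rewrite RposE => x0 fin; apply/integrableP; split.
  exact: measurable_potential_integrand.
by rewrite abse_potential_integrand.
Qed.

Lemma abse_potential_le f x : measurable_fun [set: R] (f \_ (Rpos R)) -> 0 < x ->
  (`|potential a s f x| <= pos_potential a s (abs_pos f) x)%E.
Proof.
move=> mf x0; rewrite -abse_potential_integrand//; apply: le_abse_integral => //.
exact: measurable_potential_integrand.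
Qed.

Lemma ge0_potentialE f x : (forall y, 0 <= f y) -> 0 < x ->
  potential a s f x = pos_potential a s f x.
Proof.
move=> f0 x0; apply: eq_integral => y; rewrite mem_Rpos => y0.
by rewrite potential_kernelE.
Qed.

End kernel.
End positive_operator.

(** * Sufficient conditions for convergence *)

Section domain_sufficiency.
#[local] Opaque powR expR ln integral.
Context {R : realType}.
Local Notation mu := (@lebesgue_measure R).
Implicit Types (a s x y e k : R) (p : \bar R) (c : bool) (F : R -> R).

(** The weight y^e on [hrange c x] is in the dual of L^p. *)
Definition weight_cond c p e : bool :=
  if p == 1%E then (if c then 0 <= e else e <= 0) else hsign c (e + 1 - fine p^-1).

(** Young's inequality instead of Hoelder's, as only finiteness matters. *)
Lemma weighted_integral_fin c p e F : (1 <= p)%E -> weight_cond c p e ->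
  measurable_fun [set: R] F -> (forall y, 0 <= F y) -> Lp_finite p F ->
  forall x, 0 < x -> (\int[mu]_y (if hrange c x y then y `^ e * F y else 0)%:E < +oo)%E.
Proof.
move=> p1 cond mF F0 Fp x x0; have mh := measurable_hrange1 c x.
rewrite /weight_cond in cond.
have mI : measurable_fun [set: R] (fun y => (if hrange c x y then y `^ e * F y else 0)%:E).
  by mfun.
have I0 y : (0 <= (if hrange c x y then y `^ e * F y else 0)%:E)%E.
  by rewrite lee_fin; case: ifP => // _; rewrite mulr_ge0 ?powR_ge0.
case: p p1 cond Fp => [r| |]//=; last first.
  move=> _; rewrite subr0 => se [M HM].
  have se0 := integral_hrange x0 se.
  have M0 : 0 <= Num.max M 0 by rewrite le_max lexx orbT.
  apply: (@le_lt_trans _ _ (\int[mu]_y (Num.max M 0 * (if hrange c x y then y `^ (e + 1 - 1) else 0))%:E)%E).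
    apply: ae_ge0_le_integral => //.
    - by move=> y _; rewrite lee_fin mulr_ge0//; case: ifP => // _; exact: powR_ge0.
    - by mfun.
    - move: HM; apply: filterS => y Fy _; rewrite lee_fin addrK; case: ifP => _; last by rewrite mulr0.
      by rewrite mulrC ler_wpM2r ?powR_ge0// le_max Fy.
  rewrite ge0_integralZ//; last 2 first.
  - by mfun.
  - by move=> y; case: ifP => // _; exact: powR_ge0.
  apply: (@le_lt_trans _ _ ((Num.max M 0)%:E * (x `^ (e + 1) / `|e + 1|)%:E)%E); last exact: ltry.
  by apply: lee_wpmul2l.
rewrite lee_fin eqe => r1; have r0 : 0 < r by exact: lt_le_trans r1.
have [->|rn1] := eqVneq r 1.
  move=> ce; under eq_integral do rewrite powRr1//; move=> F1.
  apply: (@le_lt_trans _ _ (\int[mu]_y (x `^ e * F y)%:E)%E).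
    apply: ge0_le_integral => //.
    - by mfun.
    - move=> y _; rewrite lee_fin; case: ifP => [H|_]; last by rewrite mulr_ge0 ?powR_ge0.
      rewrite ler_wpM2r//; have y0 := hrange_gt0 x0 H.
      case: c ce H {mh mI I0} => ce /=; first by move=> /andP[_ yx]; rewrite ler_powRp// ltW.
      by move=> xy; rewrite ler_powRn.
  by rewrite ge0_integralZ// ?powR_ge0// lte_mul_pinfty ?lee_fin ?powR_ge0.
rewrite inver gt_eqF//= => se Fr.
have r1' : 1 < r by rewrite lt_neqAle eq_sym rn1.
have rr : 0 < r / (r - 1) by rewrite divr_gt0// subr_gt0.
have st : hsign c (e * (r / (r - 1)) + 1).
  have -> : e * (r / (r - 1)) + 1 = (e + 1 - r^-1) * (r / (r - 1)).
    by field; rewrite (gt_eqF r0) gt_eqF// subr_gt0.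
  by case: c se {mh mI I0} => /= h; rewrite ?(pmulr_lgt0 _ rr) ?(pmulr_llt0 _ rr).
have J := integral_hrange x0 st.
apply: (@le_lt_trans _ _ (\int[mu]_y ((F y `^ r)%:E +
    (if hrange c x y then y `^ (e * (r / (r - 1)) + 1 - 1) else 0)%:E))%E).
  apply: ge0_le_integral => //.
  - by mfun.
  - move=> y _; rewrite -EFinD lee_fin; case: ifP => [H|_]; last by rewrite addr0 powR_ge0.
    have y0 := hrange_gt0 x0 H.
    have := young_scaled r1' (F0 y) (powR_ge0 y e) ltr01.
    by rewrite !powR1 !mul1r addrK -powRrM [F y * _]mulrC.
rewrite ge0_integralD//; last 4 first.
- by move=> y _; rewrite lee_fin powR_ge0.
- by mfun.
- by move=> y _; rewrite lee_fin; case: ifP => // _; exact: powR_ge0.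
- by mfun.
by rewrite lte_add_pinfty//; apply: le_lt_trans J _; exact: ltry.
Qed.

(** The singularity is integrable in x, uniformly in y, so that by Tonelli's theorem
the integral of this potential over (0, N] is at most a constant times the
integral of F over (0, 2 N]. *)
Lemma near_integral_fin k F : 0 < k -> k < 1 / 2 ->
  measurable_fun [set: R] F -> (forall y, 0 <= F y) ->
  (forall x, 0 < x -> (\int[mu]_y (if hrange true x y then F y else 0)%:E < +oo)%E) ->
  {ae mu, forall x, 0 < x ->
    (\int[mu]_y (if ((x / 2 < y) && (y < 2 * x))%R then `|x - y| `^ (- (2 * k)) * F y else 0)%:E < +oo)%E}.
Proof.
move=> k0 k2 mF F0 loc; have t0 : 0 < 1 - 2 * k by lra.
pose G x y := if (x / 2 < y) && (y < 2 * x) then `|x - y| `^ (- (2 * k)) * F y else 0.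
have G0 x y : (0 <= (G x y)%:E)%E.
  by rewrite lee_fin /G; case: ifP => // _; rewrite mulr_ge0 ?powR_ge0.
have mG : measurable_fun [set: R * R] (fun z => (G z.1 z.2)%:E).
  by rewrite /G; mfun.
have mGint : measurable_fun [set: R] (fun x => \int[mu]_y (G x y)%:E)%E.
  exact: (@measurable_integral_in _ setT (fun x y => (G x y)%:E)).
have step (N : R) : 0 < N -> {ae mu, forall x, `]0, N]%classic x -> (\int[mu]_y (G x y)%:E)%E \is a fin_num}.
  move=> N0.
  apply: integrable_ae => //; apply/integrableP; split; first exact: measurable_funTS.
  under eq_integral do rewrite gee0_abs ?integral_ge0//.
  rewrite tonelli_in//.
  pose B := 2 * ((2 * N) `^ (1 - 2 * k) / (1 - 2 * k)).
  have B0 : 0 <= B by rewrite mulr_ge0// divr_ge0 ?powR_ge0// ltW.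
  have N20 : 0 < 2 * N by lra.
  have mh := measurable_hrange1 true (2 * N).
  apply: (@le_lt_trans _ _ (\int[mu]_y (B * (if hrange true (2 * N) y then F y else 0))%:E)%E); last first.
    rewrite ge0_integralZ//.
    - by rewrite lte_mul_pinfty ?lee_fin//; exact: loc.
    - by mfun.
    - by move=> y; case: ifP.
  apply: ge0_le_integral => //.
  - by move=> y _; apply: integral_ge0.
  - apply: (@measurable_integral_in _ `]0, N]%classic (fun y x => (G x y)%:E)) => //.
    by rewrite /G; mfun.
  - by mfun.
  move=> y _; case: ifPn => Hy; last first.
    rewrite mulr0 integral0_eq// => x /=; rewrite in_itv/= => /andP[x0 xN].
    rewrite /G ifF//; apply: contraNF Hy => /andP[h1 h2] /=; apply/andP; split.
      by apply: le_lt_trans h1; rewrite divr_ge0 ?ltW.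
    apply: (le_trans (ltW h2)); by rewrite ler_pM2l.
  have /= /andP[y0 y2N] := Hy.
  have D := @integral_dist_near R (1 - 2 * k) (2 * N) y t0 (ltW N20).
  apply: (@le_trans _ _ (\int[mu]_x (F y * (if `|y - x| < 2 * N then `|y - x| `^ (1 - 2 * k - 1) else 0))%:E)%E).
    apply: (@le_trans _ _ (\int[mu]_(x in `]0%R, N]) (F y * (if `|y - x| < 2 * N then `|y - x| `^ (1 - 2 * k - 1) else 0))%:E)%E).
      apply: ge0_le_integral => //.
      - by apply: measurable_funTS; rewrite /G; mfun.
      - by apply: measurable_funTS; mfun.
      - move=> x /=; rewrite in_itv/= => /andP[x0 xN]; rewrite /G lee_fin.
        case: ifP => [/andP[h1 h2]|_].
          rewrite ifT.
            by rewrite distrC mulrC; have -> : 1 - 2 * k - 1 = - (2 * k) by ring.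
          rewrite ltr_norml; apply/andP; split; last by lra.
          by rewrite ltrBrDr -ltrBrDl opprK; lra.
        by case: ifP => _; rewrite ?mulr0// mulr_ge0 ?powR_ge0.
    apply: ge0_subset_integral => //.
    - by mfun.
    - by move=> x _; rewrite lee_fin mulr_ge0//; case: ifP => // _; exact: powR_ge0.
  rewrite ge0_integralZ//; last 2 first.
  - by mfun.
  - by move=> x; case: ifP => // _; exact: powR_ge0.
  rewrite [B * _]mulrC EFinM; apply: lee_wpmul2l; first by rewrite lee_fin.
  apply: le_trans D; apply: le_of_eq.
  by apply: eq_integral => x _; case: ifP.
have H : {ae mu, forall x (n : nat), `]0, n.+1%:R]%classic x -> (\int[mu]_y (G x y)%:E)%E \is a fin_num}.
  by apply: ae_foralln => n; exact: step.
apply: filterS H => x Hx x0.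
have [n Hn] : exists n : nat, x <= n.+1%:R.
  by exists (Num.truncn x); apply: ltW; exact: truncnS_gt.
have := Hx n; rewrite /= in_itv/= x0 Hn => /(_ isT) h.
change (\int[mu]_y (G x y)%:E < +oo)%E.
by move: h; rewrite ge0_fin_numE//; apply: integral_ge0.
Qed.

Lemma ae_neq x : {ae mu, forall y, y != x}.
Proof.
exists [set x]; split; [exact: measurable_set1|exact: lebesgue_measure_set1|].
by move=> y /= /negP; rewrite negbK => /eqP.
Qed.

Lemma domain_sufficient a s p F : -1 < a -> 0 < s -> s < a + 1 -> (1 <= p)%E ->
  weight_cond true p (a + 1 / 2) -> weight_cond false p (2 * s - 1 - (a + 1 / 2)) ->
  measurable_fun [set: R] F -> (forall y, 0 <= F y) -> Lp_finite p F ->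
  {ae mu, forall x, Rpos R x -> (pos_potential a s F x < +oo)%E}.
Proof.
move=> a1 s0 sa p1 c1 c2 mF F0 Fp.
(* k < 1/2 keeps |x - y|^(-2 k) locally integrable *)
pose k := Num.max (1 / 2 - s) (1 / 4).
have k0 : 0 < k by rewrite lt_max; apply/orP; right; lra.
have k2 : k < 1 / 2 by rewrite gt_max; apply/andP; split; lra.
have ks : 1 / 2 - s <= k by rewrite le_max lexx.
clearbody k.
have k01 : 0 < k < 1 by rewrite k0/=; lra.
have c0 : weight_cond true p 0.
  rewrite /weight_cond; case: ifP => //= p1'; rewrite add0r.
  case: p p1 p1' {Fp c1 c2} => [r| |]//=.
  rewrite lee_fin eqe => r1 rn1; have r0 : 0 < r by exact: lt_le_trans r1.
  rewrite inver gt_eqF//= subr_gt0 invf_lt1//.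
  by rewrite lt_neqAle eq_sym rn1.
have loc x : 0 < x -> (\int[mu]_y (if hrange true x y then F y else 0)%:E < +oo)%E.
  move=> x0; have := weighted_integral_fin p1 c0 mF F0 Fp x0.
  by under eq_integral do rewrite powRr0 mul1r.
have [C C0 HC] := kser_upper_split a1 s0 sa k01 ks.
have near := near_integral_fin k0 k2 mF F0 loc.
apply: filterS near => x near; rewrite RposE => x0.
have mh := measurable_hrange1 true x; have mh' := measurable_hrange1 false x.
have w1 := weighted_integral_fin p1 c1 mF F0 Fp x0.
have w2 := weighted_integral_fin p1 c2 mF F0 Fp x0.
have {}near := near x0.
pose g0 y := if (x / 2 < y) && (y < 2 * x) then `|x - y| `^ (- (2 * k)) * F y else 0.
pose g1 y := if hrange true x y then y `^ (a + 1 / 2) * F y else 0.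
pose g2 y := if hrange false x y then y `^ (2 * s - 1 - (a + 1 / 2)) * F y else 0.
have mg0 : measurable_fun [set: R] g0 by rewrite /g0; mfun.
have mg1 : measurable_fun [set: R] g1 by rewrite /g1; mfun.
have mg2 : measurable_fun [set: R] g2 by rewrite /g2; mfun.
have g00 y : 0 <= g0 y by rewrite /g0; case: ifP => // _; rewrite mulr_ge0 ?powR_ge0.
have g10 y : 0 <= g1 y by rewrite /g1; case: ifP => // _; rewrite mulr_ge0 ?powR_ge0.
have g20 y : 0 <= g2 y by rewrite /g2; case: ifP => // _; rewrite mulr_ge0 ?powR_ge0.
have point y : 0 < y -> x != y -> (kser a s x y * (F y)%:E <=
    (C * x `^ (2 * s - 1 + 2 * k) * g0 y)%:E + ((C * x `^ (2 * s - 1 - (a + 1 / 2)) * g1 y)%:E +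
    (C * x `^ (a + 1 / 2) * g2 y)%:E))%E.
  move=> y0 xy; apply: (@le_trans _ _ (_ * (F y)%:E)%E).
    by apply: lee_wpmul2r; [rewrite lee_fin|exact: HC].
  rewrite -EFinM -!EFinD lee_fin /near_kernel /g0 /g1 /g2 /hrange y0 /=.
  apply: le_of_eq.
  by case: ifP => _; case: ifP => _; case: ifP => _; ring.
pose P0 := C * x `^ (2 * s - 1 + 2 * k); pose P1 := C * x `^ (2 * s - 1 - (a + 1 / 2)).
pose P2 := C * x `^ (a + 1 / 2).
have P00 : 0 <= P0 by rewrite (mulr_ge0 (ltW C0) (powR_ge0 _ _)).
have P10 : 0 <= P1 by rewrite (mulr_ge0 (ltW C0) (powR_ge0 _ _)).
have P20 : 0 <= P2 by rewrite (mulr_ge0 (ltW C0) (powR_ge0 _ _)).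
rewrite -/P0 -/P1 -/P2 in point; clearbody P0 P1 P2.
apply: (@le_lt_trans _ _ (\int[mu]_y ((P0 * g0 y)%:E + ((P1 * g1 y)%:E + (P2 * g2 y)%:E)))%E).
  apply: (@le_trans _ _ (\int[mu]_(y in Rpos R) ((P0 * g0 y)%:E + ((P1 * g1 y)%:E + (P2 * g2 y)%:E)))%E).
    apply: ae_ge0_le_integral => //.
    - by move=> y _; rewrite mule_ge0 ?lee_fin//; exact: kser_ge0.
    - have mk := measurable_kser2 a1 sa x; apply: measurable_funTS; apply: emeasurable_funM => //.
      exact/measurable_EFinP.
    - by move=> y _; rewrite -!EFinD lee_fin (addr_ge0 (mulr_ge0 P00 (g00 y)) (addr_ge0 (mulr_ge0 P10 (g10 y)) (mulr_ge0 P20 (g20 y)))).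
    - by apply: measurable_funTS; mfun.
    - by apply: filterS (ae_neq x) => y yx; rewrite RposE => y0; apply: point; rewrite // eq_sym.
  apply: ge0_subset_integral => //.
  - by mfun.
  - by move=> y _; rewrite -!EFinD lee_fin (addr_ge0 (mulr_ge0 P00 (g00 y)) (addr_ge0 (mulr_ge0 P10 (g10 y)) (mulr_ge0 P20 (g20 y)))).
have m0 : measurable_fun [set: R] (fun y => (P0 * g0 y)%:E) by mfun.
have m1 : measurable_fun [set: R] (fun y => (P1 * g1 y)%:E) by mfun.
have m2 : measurable_fun [set: R] (fun y => (P2 * g2 y)%:E) by mfun.
have n0 y : (0 <= (P0 * g0 y)%:E)%E by rewrite lee_fin (mulr_ge0 P00 (g00 y)).
have n1 y : (0 <= (P1 * g1 y)%:E)%E by rewrite lee_fin (mulr_ge0 P10 (g10 y)).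
have n2 y : (0 <= (P2 * g2 y)%:E)%E by rewrite lee_fin (mulr_ge0 P20 (g20 y)).
rewrite ge0_integralD//; last 2 first.
- by move=> y _; exact: adde_ge0.
- by mfun.
rewrite ge0_integralD//.
rewrite !ge0_integralZ//.
have fin (P : R) (I : \bar R) : 0 <= P -> (I < +oo)%E -> (P%:E * I < +oo)%E.
  by move=> P_ge0 Ifin; rewrite lte_mul_pinfty// lee_fin.
apply: lte_add_pinfty; first exact: fin P00 near.
by apply: lte_add_pinfty; [exact: fin P10 w1|exact: fin P20 w2].
Qed.

End domain_sufficiency.

(** * Sufficient conditions for boundedness *)

Section boundedness_sufficiency.
#[local] Opaque powR expR ln integral.
Context {R : realType}.
Local Notation mu := (@lebesgue_measure R).
Implicit Types (a s x y p q r t : R) (c : bool) (f F : R -> R).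

(** The integral of a nonnegative function is a supremum over simple functions below
it, hence monotone even without measurability. *)
Lemma ge0_integralT_mono (g h : R -> \bar R) :
  (forall x, 0 <= g x)%E -> (forall x, g x <= h x)%E ->
  (\int[mu]_x g x <= \int[mu]_x h x)%E.
Proof.
move=> g0 gh; rewrite !ge0_integralTE//; last by move=> x; exact: le_trans (gh x).
apply: le_ereal_sup => _ [u ug <-]; exists u => // x.
exact: le_trans (ug x) (gh x).
Qed.

Lemma poweR_addl q (u v : \bar R) : 0 < q -> (0 <= u)%E -> (0 <= v)%E ->
  ((u + v) `^ q <= (2 `^ q)%:E * (u `^ q + v `^ q))%E.
Proof.
move=> q0; wlog uv : u v / (u <= v)%E.
  move=> H u0 v0; have [h|h] := leP u v; first exact: H.
  by rewrite addeC [X in (_ * X)%E]addeC; apply: H => //; exact: ltW.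
move=> u0 v0; apply: (@le_trans _ _ ((2%:E * v) `^ q)%E).
  apply: ge0_le_poweR; [exact: ltW|exact: adde_ge0|].
  by rewrite mule_natl mule2n leeD2r.
rewrite poweRM// poweR_EFin; apply: lee_wpmul2l; first by rewrite lee_fin powR_ge0.
by rewrite leeDr// poweR_ge0.
Qed.

(** The three parts of [kser_upper_split] with k = 1/2 - s. The open intervals of
admissible exponents t in the two uses of [hardy] are nonempty exactly under the
last two hypotheses; t is taken in the middle. *)
Lemma strong_type a s p q : -1 < a -> 0 < s -> s < a + 1 -> 1 < p -> p < q ->
  2 * s = p^-1 - q^-1 -> 0 < a + 1 / 2 + 1 - p^-1 -> 0 < a + 1 / 2 + q^-1 ->
  exists2 C : R, 0 < C &
  forall F, measurable_fun [set: R] F -> (forall y, 0 <= F y) ->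
  (\int[mu]_y (F y `^ p)%:E <= 1)%E ->
  (\int[mu]_(x in Rpos R) (pos_potential a s F x `^ q) <= C%:E)%E.
Proof.
move=> a1 s0 sa p1 pq spq; set b := a + 1 / 2 => bp bq.
have p0 : 0 < p by lra. have q0 : 0 < q by lra. have pm0 : 0 < p - 1 by lra.
have s2 : s < 1 / 2.
  have : p^-1 < 1 by rewrite invf_lt1.
  have : 0 < q^-1 by rewrite invr_gt0.
  by move: spq; lra.
pose k := 1 / 2 - s.
have k01 : 0 < k < 1 by rewrite /k; apply/andP; split; lra.
pose p' := p / (p - 1); have p'0 : 0 < p' by rewrite divr_gt0.
have [C C0 HC] := kser_upper_split a1 s0 sa k01 (lexx _).
have [C1 C10 H1] := hardy_littlewood_sobolev p1 pq.
have p'E : p'^-1 = 1 - p^-1 by rewrite /p'; field; rewrite !gt_eqF.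
have p'1 : (1 - p^-1) * p' = 1 by rewrite -p'E mulVf ?gt_eqF.
have pV0 : 0 < 1 - p^-1 by rewrite -p'E invr_gt0.
have pV : 0 < p^-1 by rewrite invr_gt0.
have qV : 0 < q^-1 by rewrite invr_gt0.
have [C2 C20 H2] : exists2 C2 : R, 0 < C2 & forall F, measurable_fun [set: R] F ->
  (forall y, 0 <= F y) -> (\int[mu]_y (F y `^ p)%:E <= 1)%E ->
  (\int[mu]_(x in Rpos R)
     ((\int[mu]_y (if hrange true x y then x `^ (p^-1 - q^-1 - 1 - b) * y `^ b * F y else 0)%:E)
        `^ q) <= C2%:E)%E.
  pose t := (- b / p + (b + 1) * (1 - p^-1)) / 2.
  apply: (@hardy R true p q b t) => //; rewrite -/p' /=.
  - have -> : b * p' + 1 = (b + 1 - p^-1) * p' by rewrite -[X in _ + X = _]p'1; ring.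
    by rewrite mulr_gt0//; move: bp; lra.
  - have -> : b - t * p' + 1 = ((b + 1) * (1 - p^-1) - t) * p'.
      have -> : ((b + 1) * (1 - p^-1) - t) * p' = (b + 1) * ((1 - p^-1) * p') - t * p' by ring.
      by rewrite p'1; ring.
    by rewrite mulr_gt0// /t; move: bp; rewrite -/b; nra.
  - have -> : b + t * p = (b / p + t) * p by rewrite mulrDl divfK// gt_eqF.
    by rewrite mulr_gt0// /t; move: bp; rewrite -/b; nra.
pose r := 2 * s - 1 - b.
have [C3 C30 H3] : exists2 C3 : R, 0 < C3 & forall F, measurable_fun [set: R] F ->
  (forall y, 0 <= F y) -> (\int[mu]_y (F y `^ p)%:E <= 1)%E ->
  (\int[mu]_(x in Rpos R)
     ((\int[mu]_y (if hrange false x y then x `^ (p^-1 - q^-1 - 1 - r) * y `^ r * F y else 0)%:E)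
        `^ q) <= C3%:E)%E.
  have rp : r + 1 - p^-1 < 0 by rewrite /r; move: bq spq; rewrite -/b; lra.
  pose t := (- r / p + (r + 1) * (1 - p^-1)) / 2.
  apply: (@hardy R false p q r t) => //; rewrite -/p' /=.
  - have -> : r * p' + 1 = (r + 1 - p^-1) * p' by rewrite -[X in _ + X = _]p'1; ring.
    by rewrite pmulr_llt0.
  - have -> : r - t * p' + 1 = ((r + 1) * (1 - p^-1) - t) * p'.
      have -> : ((r + 1) * (1 - p^-1) - t) * p' = (r + 1) * ((1 - p^-1) * p') - t * p' by ring.
      by rewrite p'1; ring.
    by rewrite pmulr_llt0// /t; nra.
  - have -> : r + t * p = (r / p + t) * p by rewrite mulrDl divfK// gt_eqF.
    by rewrite pmulr_llt0// /t; nra.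
have Cq0 : 0 < C `^ q by exact: powR_gt0.
have D0 : 0 < 2 `^ q :> R by exact: powR_gt0.
exists (C `^ q * (2 `^ q * (C1 + 2 `^ q * (C2 + C3)))).
  by rewrite (mulr_gt0 Cq0 (mulr_gt0 D0 (addr_gt0 C10 (mulr_gt0 D0 (addr_gt0 C20 C30))))).
move=> F mF F0 F1.
have {}H1 := H1 F mF F0 F1; have {}H2 := H2 F mF F0 F1; have {}H3 := H3 F mF F0 F1.
pose g1 x y := `|x - y| `^ (p^-1 - q^-1 - 1) * F y.
pose g2 x y := if hrange true x y then x `^ (p^-1 - q^-1 - 1 - b) * y `^ b * F y else 0.
pose g3 x y := if hrange false x y then x `^ (p^-1 - q^-1 - 1 - r) * y `^ r * F y else 0.
pose G1 x := (\int[mu]_y (g1 x y)%:E)%E.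
pose G2 x := (\int[mu]_y (g2 x y)%:E)%E.
pose G3 x := (\int[mu]_y (g3 x y)%:E)%E.
have mFz : measurable_fun [set: R * R] (fun z => F z.2) by apply: (measurableT_comp mF).
have mh c : measurable_fun [set: R * R] (fun z => hrange c z.1 z.2) := @measurable_hrange R c.
have g10 x y : 0 <= g1 x y by rewrite (mulr_ge0 (powR_ge0 _ _) (F0 y)).
have g20 x y : 0 <= g2 x y.
  by rewrite /g2; case: ifP => // _; rewrite (mulr_ge0 (mulr_ge0 (powR_ge0 _ _) (powR_ge0 _ _)) (F0 y)).
have g30 x y : 0 <= g3 x y.
  by rewrite /g3; case: ifP => // _; rewrite (mulr_ge0 (mulr_ge0 (powR_ge0 _ _) (powR_ge0 _ _)) (F0 y)).
have mg1 : measurable_fun [set: R * R] (fun z => g1 z.1 z.2) by rewrite /g1; mfun.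
have mg2 : measurable_fun [set: R * R] (fun z => g2 z.1 z.2) by rewrite /g2; have mht := mh true; mfun.
have mg3 : measurable_fun [set: R * R] (fun z => g3 z.1 z.2) by rewrite /g3; have mht := mh false; mfun.
have mG (g : R -> R -> R) : measurable_fun [set: R * R] (fun z => g z.1 z.2) ->
    (forall x y, 0 <= g x y) -> measurable_fun [set: R] (fun x => (\int[mu]_y (g x y)%:E)%E).
  by move=> mg g0; apply: (@measurable_integral_in _ setT (fun x y => (g x y)%:E)) => //;
    exact/measurable_EFinP.
have mG1 : measurable_fun [set: R] G1 by exact: mG.
have mG2 : measurable_fun [set: R] G2 by exact: mG.
have mG3 : measurable_fun [set: R] G3 by exact: mG.
have G10 x : (0 <= G1 x)%E by apply: integral_ge0 => y _; rewrite lee_fin.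
have G20 x : (0 <= G2 x)%E by apply: integral_ge0 => y _; rewrite lee_fin.
have G30 x : (0 <= G3 x)%E by apply: integral_ge0 => y _; rewrite lee_fin.
have sec (g : R -> R -> R) x : measurable_fun [set: R * R] (fun z => g z.1 z.2) ->
    measurable_fun [set: R] (g x).
  by move=> mg; exact: (measurableT_comp mg (measurable_pair1 x)).
have bound x : 0 < x -> (pos_potential a s F x <= C%:E * (G1 x + (G2 x + G3 x)))%E.
  move=> x0; have s1 := sec _ x mg1; have s2' := sec _ x mg2; have s3 := sec _ x mg3.
  rewrite -ge0_integralD//; last 4 first.
  - by move=> y _; rewrite lee_fin.
  - by mfun.
  - by move=> y _; rewrite lee_fin.
  - by mfun.
  rewrite -ge0_integralD//; last 4 first.
  - by move=> y _; rewrite lee_fin.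
  - by mfun.
  - by move=> y _; rewrite -EFinD lee_fin (addr_ge0 (g20 x y) (g30 x y)).
  - by mfun.
  rewrite -ge0_integralZl_EFin ?(ltW C0)//; last 2 first.
  - by move=> y _; rewrite -!EFinD lee_fin (addr_ge0 (g10 x y) (addr_ge0 (g20 x y) (g30 x y))).
  - by mfun.
  have pos y : (0 <= C%:E * ((g1 x y)%:E + ((g2 x y)%:E + (g3 x y)%:E)))%E.
    by rewrite -!EFinD -EFinM lee_fin (mulr_ge0 (ltW C0) (addr_ge0 (g10 x y) (addr_ge0 (g20 x y) (g30 x y)))).
  apply: (@le_trans _ _ (\int[mu]_(y in Rpos R) (C%:E * ((g1 x y)%:E + ((g2 x y)%:E + (g3 x y)%:E))))%E).
    apply: ae_ge0_le_integral => //.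
    - by move=> y _; rewrite mule_ge0 ?lee_fin//; exact: kser_ge0.
    - have mk := measurable_kser2 a1 sa x; apply: measurable_funTS; apply: emeasurable_funM => //.
      exact/measurable_EFinP.
    - by apply: measurable_funTS; mfun.
    apply: filterS (ae_neq x) => y yx; rewrite RposE => y0.
    have xy : x != y by rewrite eq_sym.
    apply: (@le_trans _ _ (_ * (F y)%:E)%E).
      by apply: lee_wpmul2r; [rewrite lee_fin|exact: HC].
    rewrite -!EFinD -!EFinM lee_fin -mulrA; apply: ler_wpM2l; first exact: ltW.
    rewrite /near_kernel /g1 /g2 /g3 /hrange y0 /= -/b -/r -spq.
    have -> : 2 * s - 1 + 2 * k = 0 by rewrite /k; field.
    have -> : - (2 * k) = 2 * s - 1 by rewrite /k; field.
    have -> : 2 * s - 1 - r = b by rewrite /r subKr.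
    rewrite powRr0 mul1r [leLHS]mulrDl [X in X + _ <= _]mulrDl -addrA; apply: lerD; last first.
      by apply: lerD; case: ifP => _; rewrite ?mul0r.
    by case: ifP => _; rewrite ?mul0r// mulr_ge0 ?powR_ge0.
  apply: ge0_subset_integral => //.
  by mfun.
apply: (@le_trans _ _ (\int[mu]_(x in Rpos R) ((C `^ q)%:E *
   ((2 `^ q)%:E * (G1 x `^ q + (2 `^ q)%:E * (G2 x `^ q + G3 x `^ q)))))%E).
  apply: ge0_le_integral => //.
  - by move=> x _; exact: poweR_ge0.
  - by have mT := measurable_pos_potential a1 s0 sa mF F0; apply: measurable_funTS; mfun.
  - by apply: measurable_funTS; mfun.
  - move=> x; rewrite RposE => x0.
    apply: (@le_trans _ _ ((C%:E * (G1 x + (G2 x + G3 x))) `^ q)%E).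
      by apply: ge0_le_poweR; [exact: ltW|exact: pos_potential_ge0|exact: bound].
    rewrite poweRM ?lee_fin ?(ltW C0)//; last by do 2 apply: adde_ge0 => //.
    rewrite poweR_EFin; apply: lee_wpmul2l; first by rewrite lee_fin powR_ge0.
    apply: (le_trans (poweR_addl q0 _ _)) => //; first exact: adde_ge0.
    apply: lee_wpmul2l; first by rewrite lee_fin powR_ge0.
    by apply: leeD2l; exact: poweR_addl.
have G1q0 x : (0 <= G1 x `^ q)%E by exact: poweR_ge0.
have G2q0 x : (0 <= G2 x `^ q)%E by exact: poweR_ge0.
have G3q0 x : (0 <= G3 x `^ q)%E by exact: poweR_ge0.
have D0' := ltW D0.
rewrite ge0_integralZl_EFin//; last 3 first.
- by move=> x _; rewrite mule_ge0 ?lee_fin// adde_ge0// mule_ge0 ?lee_fin// adde_ge0.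
- by apply: measurable_funTS; mfun.
- exact: ltW.
rewrite EFinM; apply: lee_wpmul2l; first by rewrite lee_fin ltW.
rewrite ge0_integralZl_EFin//; last 2 first.
- by move=> x _; rewrite adde_ge0// mule_ge0 ?lee_fin// adde_ge0.
- by apply: measurable_funTS; mfun.
rewrite EFinM; apply: lee_wpmul2l; first by rewrite lee_fin.
rewrite ge0_integralD//; last 3 first.
- by apply: measurable_funTS; mfun.
- by move=> x _; rewrite mule_ge0 ?lee_fin// adde_ge0.
- by apply: measurable_funTS; mfun.
rewrite EFinD; apply: leeD.
  apply: le_trans H1; apply: ge0_subset_integral => //.
  by mfun.
rewrite ge0_integralZl_EFin//; last 2 first.
- by move=> x _; rewrite adde_ge0.
- by apply: measurable_funTS; mfun.
rewrite EFinM; apply: lee_wpmul2l; first by rewrite lee_fin.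
rewrite ge0_integralD//; last 2 first.
- by apply: measurable_funTS; mfun.
- by apply: measurable_funTS; mfun.
by rewrite EFinD; apply: leeD.
Qed.

End boundedness_sufficiency.

Section homogeneity.
#[local] Opaque powR expR ln integral.
Context {R : realType}.
Local Notation mu := (@lebesgue_measure R).
Implicit Types (a s x y p q r t : R) (c : bool) (f F : R -> R).

Lemma norm_pos_potential_le a s q f : -1 < a -> 0 < s -> s < a + 1 -> 0 < q ->
  measurable_fun [set: R] (f \_ (Rpos R)) ->
  (norm_pos q%:E (potential a s f) <=
   (\int[mu]_(x in Rpos R) (pos_potential a s (abs_pos f) x `^ q)) `^ q^-1)%E.
Proof.
move=> a1 s0 sa q0 mf; rewrite /norm_pos unlock.
apply: ge0_le_poweR; first by rewrite invr_ge0 ltW.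
  by apply: integral_ge0 => x _; exact: poweR_ge0.
rewrite [X in (_ <= X)%E]integral_mkcond; apply: ge0_integralT_mono => [x|x].
  exact: poweR_ge0.
rewrite !patchE; case: ifPn => [|_]; last by rewrite abse0 poweR_EFin powR0 ?gt_eqF.
rewrite mem_Rpos => x0.
by apply: ge0_le_poweR; [exact: ltW|exact: abse_ge0|exact: abse_potential_le].
Qed.

(** Homogeneity. Dividing by any c larger than the norm of f, rather than by the norm
itself, covers f = 0 as well. *)
Lemma bounded_of_strong_type a s p q : -1 < a -> 0 < s -> s < a + 1 -> 1 <= p -> 0 < q ->
  (exists2 C : R, 0 < C &
  forall F, measurable_fun [set: R] F -> (forall y, 0 <= F y) ->
  (\int[mu]_y (F y `^ p)%:E <= 1)%E ->
  (\int[mu]_(x in Rpos R) (pos_potential a s F x `^ q) <= C%:E)%E) ->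
  exists C : R, forall f : R -> R, Lp_pos p%:E f ->
    (norm_pos q%:E (potential a s f) <= C%:E * norm_pos p%:E (EFin \o f))%E.
Proof.
move=> a1 s0 sa p1 q0 [C C0 HC]; have p0 : 0 < p by exact: lt_le_trans p1.
pose D := C `^ q^-1; have D0 : 0 < D by exact: powR_gt0.
exists D => f /Lp_posP; rewrite lee_fin => /(_ p1) [mf].
rewrite /Lp_finite norm_pos_real.
have mF := measurable_abs_pos mf; have F0 := abs_pos_ge0 f.
set I := (\int[mu]_y _)%E => Ifin.
have I0 : (0 <= I)%E by apply: integral_ge0 => y _; rewrite lee_fin powR_ge0.
have [i IE] : exists i, I = i%:E.
  by exists (fine I); rewrite fineK// ge0_fin_numE.
rewrite IE poweR_EFin -EFinM; have i0 : 0 <= i by rewrite -lee_fin -IE.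
have key (c : R) : i `^ p^-1 < c -> (norm_pos q%:E (potential a s f) <= (D * c)%:E)%E.
  move=> ic; have c0 : 0 < c by apply: le_lt_trans ic; exact: powR_ge0.
  apply: (le_trans (norm_pos_potential_le a1 s0 sa q0 mf)).
  pose F y := c^-1 * abs_pos f y.
  have cV0 : 0 <= c^-1 by rewrite invr_ge0 ltW.
  have mF' : measurable_fun [set: R] F by rewrite /F; mfun.
  have F'0 y : 0 <= F y by rewrite (mulr_ge0 cV0 (F0 y)).
  have := HC F mF' F'0.
  have -> : (\int[mu]_y (F y `^ p)%:E = (c^-1 `^ p * i)%:E)%E.
    rewrite EFinM -IE -ge0_integralZ ?powR_ge0//; last 2 first.
    - by mfun.
    - by move=> y; exact: powR_ge0.
    by apply: eq_integral => y _; rewrite /F powRM.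
  have -> : ((c^-1 `^ p * i)%:E <= 1)%E.
    have iE : i = (i `^ p^-1) `^ p by rewrite -powRrM mulVf ?gt_eqF// powRr1.
    rewrite lee_fin [X in _ * X]iE -powRM ?powR_ge0//.
    have one : 1 `^ p = 1 :> R by rewrite powR1.
    rewrite -[leRHS]one ler_powRp ?(ltW p0)// ?mulr_ge0 ?powR_ge0//.
    by rewrite mulrC ler_pdivrMr// mul1r ltW.
  move=> /(_ isT).
  have mT := measurable_pos_potential a1 s0 sa mF F0.
  have T0 x := pos_potential_ge0 a1 s0 sa x F0.
  have -> : (\int[mu]_(x in Rpos R) (pos_potential a s F x `^ q) =
     (c^-1 `^ q)%:E * \int[mu]_(x in Rpos R) (pos_potential a s (abs_pos f) x `^ q))%E.
    rewrite -ge0_integralZl_EFin ?powR_ge0//; last 2 first.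
    - by move=> x _; exact: poweR_ge0.
    - by apply: measurable_funTS; mfun.
    apply: eq_integral => x _; rewrite -poweR_EFin -poweRM ?lee_fin//; congr (_ `^ _)%E.
    rewrite /pos_potential -ge0_integralZl_EFin//; last 2 first.
    - by move=> y _; rewrite mule_ge0 ?lee_fin//; exact: kser_ge0.
    - apply: measurable_funTS; apply: emeasurable_funM; first exact: measurable_kser2.
      exact/measurable_EFinP.
    by apply: eq_integral => y _; rewrite /F EFinM muleCA.
  set J := (\int[mu]_(x in Rpos R) (pos_potential a s (abs_pos f) x `^ q))%E.
  have J0 : (0 <= J)%E by apply: integral_ge0 => x _; exact: poweR_ge0.
  clearbody J => HJ.
  have : (J <= (c `^ q * C)%:E)%E.
    have -> : J = ((c `^ q)%:E * ((c^-1 `^ q)%:E * J))%E.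
      by rewrite muleA -EFinM -powRM ?(ltW c0)// mulfV ?gt_eqF// powR1 mul1e.
    by rewrite EFinM; apply: lee_wpmul2l => //; rewrite lee_fin powR_ge0.
  move=> HJ'; have Jfin : J \is a fin_num.
    by rewrite ge0_fin_numE//; apply: (le_lt_trans HJ'); exact: ltry.
  move: J0 HJ'; rewrite -(fineK Jfin) poweR_EFin !lee_fin => J0 HJ'.
  apply: (@le_trans _ _ ((c `^ q * C) `^ q^-1)).
    by rewrite ler_powRp// invr_ge0 ltW.
  rewrite powRM ?powR_ge0 ?(ltW C0)// -powRrM mulfV ?gt_eqF// powRr1 ?(ltW c0)//.
  by rewrite mulrC.
apply/lee_addgt0Pr => e e0; rewrite -EFinD.
have -> : D * i `^ p^-1 + e = D * (i `^ p^-1 + e / D) by rewrite mulrDr mulrCA mulfV ?mulr1// gt_eqF.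
by apply: key; rewrite ltrDl divr_gt0.
Qed.

Lemma potential_bounded_of_exponents a s p q : -1 < a -> 0 < s -> s < a + 1 -> 1 < p -> p < q ->
  2 * s = p^-1 - q^-1 -> 0 < a + 1 / 2 + 1 - p^-1 -> 0 < a + 1 / 2 + q^-1 ->
  potential_bounded a s p%:E q%:E.
Proof.
move=> a1 s0 sa p1 pq spq bp bq; have p0 : 0 < p by lra. have q0 : 0 < q by lra.
split; last by apply: bounded_of_strong_type => //; [exact: ltW|exact: strong_type].
have p1E : (1 <= p%:E)%E by rewrite lee_fin ltW.
move=> f /(Lp_posP f p1E)[mf Fp].
apply/(Dom_potentialP a1 s0 sa mf); apply: (domain_sufficient (p := p%:E)) => //.
- by rewrite /weight_cond eqe gt_eqF//= inver gt_eqF.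
- rewrite /weight_cond eqe gt_eqF//= inver gt_eqF//=.
  have -> : 2 * s - 1 - (a + 1 / 2) + 1 - p^-1 = - (a + 1 / 2 + q^-1) by rewrite spq; ring.
  by rewrite oppr_lt0.
- exact: measurable_abs_pos.
- exact: abs_pos_ge0.
Qed.

End homogeneity.

(** * Lower bounds for norms and potentials *)

Section test_functions.
#[local] Opaque powR expR ln integral.
Context {R : realType}.
Local Notation mu := (@lebesgue_measure R).
Implicit Types (a s x y z c : R) (p q : \bar R) (f F : R -> R).

Lemma ae_exists (A : set R) (P : R -> Prop) : measurable A -> (0 < mu A)%E ->
  {ae mu, forall x, P x} -> exists2 x, A x & P x.
Proof.
move=> mA A0 [N [mN N0 PN]]; apply: contrapT => H.
have : (mu A <= mu N)%E.
  apply: le_measure; rewrite ?inE// => x Ax; apply: PN => /= Px.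
  by apply: H; exists x.
by rewrite N0 leNgt A0.
Qed.

Lemma conjugate_exponentE p : (1 <= p)%E ->
  [/\ p^-1%E = (fine p^-1)%:E, 0 <= fine p^-1, fine p^-1 <= 1,
      (fine p^-1 == 1) = (p == 1%E) & 0 < fine p^-1 -> p = ((fine p^-1)^-1)%:E].
Proof.
case: p => [r| |]//=; last by rewrite ltxx eq_sym oner_eq0; split.
rewrite lee_fin => r1; have r0 : 0 < r by exact: lt_le_trans r1.
rewrite inver gt_eqF//= invr_ge0 (ltW r0) eqe; split => //; rewrite ?invrK//.
  by rewrite invf_le1.
by rewrite invr_eq1.
Qed.

Lemma abs_pos_id f : (forall y, 0 <= f y) -> (forall y, ~~ (0 < y) -> f y = 0) ->
  abs_pos f = f.
Proof.
move=> f0 fout; apply/funext => y; have [y0|y0] := boolP (0 < y).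
  by rewrite abs_posE// ger0_norm.
by rewrite abs_pos_out ?fout//; exact/negP.
Qed.

Lemma restrict_id f : (forall y, ~~ (0 < y) -> f y = 0) -> f \_ (Rpos R) = f.
Proof.
move=> fout; apply/funext => y; rewrite patchE; case: ifPn => //.
by rewrite mem_Rpos => /fout ->.
Qed.

Lemma Lp_pos_nonneg p f : (1 <= p)%E -> measurable_fun [set: R] f ->
  (forall y, 0 <= f y) -> (forall y, ~~ (0 < y) -> f y = 0) ->
  Lp_finite p f -> Lp_pos p f.
Proof.
by move=> p1 mf f0 fout fp; apply/Lp_posP => //; rewrite restrict_id// abs_pos_id.
Qed.

(** No measurability of g is assumed, as g will be a potential. *)
Lemma norm_pos_ge p (g : R -> \bar R) c u v : (1 <= p)%E -> 0 <= c -> 0 < u -> u < v ->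
  (forall x, u <= x <= v -> (c%:E <= g x)%E) ->
  ((c * (v - u) `^ (fine p^-1))%:E <= norm_pos p g)%E.
Proof.
move=> p1 c0 u0 uv H; have vu : 0 < v - u by rewrite subr_gt0.
have gE x : u <= x <= v -> (c%:E <= `|(g \_ (Rpos R)) x|)%E.
  move=> /andP[ux xv]; rewrite patchE mem_set; last by rewrite RposE; exact: lt_le_trans ux.
  by apply: (le_trans (H x _)); rewrite ?ux//; exact: lee_abs.
rewrite /norm_pos unlock; case: p p1 => [r| |]//.
  rewrite lee_fin => r1; have r0 : 0 < r by exact: lt_le_trans r1.
  rewrite inver gt_eqF//=.
  have rV : 0 <= r^-1 by rewrite invr_ge0 ltW.
  have cE : c * (v - u) `^ r^-1 = (c `^ r * (v - u)) `^ r^-1.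
    by rewrite powRM ?powR_ge0 ?(ltW vu)// -powRrM mulfV ?gt_eqF// powRr1.
  rewrite cE -poweR_EFin.
  apply: ge0_le_poweR => //; first by rewrite lee_fin mulr_ge0 ?powR_ge0// ltW.
  rewrite EFinM -(lebesgue_measure_segment uv) -integral_cst//= integral_mkcond.
  apply: ge0_integralT_mono => x; rewrite patchE; case: ifPn => //.
  - by rewrite lee_fin powR_ge0.
  - move=> /set_mem/=; rewrite in_itv/= => ux; rewrite -poweR_EFin.
    by apply: ge0_le_poweR; [exact: ltW|rewrite lee_fin|exact: gE].
  - by rewrite poweR_ge0.
move=> _; rewrite lebesgue_measure_setT_gt0 /= powRr0 mulr1 leNgt; apply/negP => Hlt.
have mI : measurable `[u, v]%classic by [].
have I0 : (0 < mu `[u, v]%classic)%E by rewrite lebesgue_measure_segment.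
have [x] := ae_exists mI I0 (ess_sup_ge mu (abse \o (g \_ (Rpos R)))).
rewrite /= in_itv/= => /gE h1 h2.
by have := le_lt_trans (le_trans h1 h2) Hlt; rewrite ltxx.
Qed.

Lemma integral_inv_shift z u v : z < u -> u < v ->
  (\int[mu]_(x in `[u, v]) ((x - z)^-1)%:E = (ln (v - z) - ln (u - z))%:E)%E.
Proof.
move=> zu uv; apply: (@integral_derive _ (fun x => ln (x - z))) => // x /andP[ux _];
  have xz : 0 < x - z by rewrite subr_gt0 (lt_le_trans zu).
  have H : is_derive x 1 (fun t : R => t - z) 1.
    by rewrite -[X in is_derive _ _ _ X]subr0; apply: is_deriveB.
  have := is_derive1_comp (f := @ln R) (g := fun t : R => t - z) (is_derive1_ln xz) H.
  by rewrite mulr1.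
apply: (@continuousV R R^o); first exact: lt0r_neq0.
by apply: continuousB; [exact: cvg_id|exact: cvg_cst].
Qed.

(** The function (x - z)^(-1/r) just fails to be in L^r near z. *)
Lemma norm_pos_log_ge (r z e c : R) (g : R -> \bar R) : 0 < r -> 0 <= z -> 0 < e -> e < 1 -> 0 <= c ->
  (forall x, z + e <= x <= z + 1 -> ((c * (x - z) `^ (- r^-1))%:E <= g x)%E) ->
  ((c * (- ln e) `^ r^-1)%:E <= norm_pos r%:E g)%E.
Proof.
move=> r0 z0 e0 e1 c0 H; rewrite /norm_pos unlock.
have rV : 0 <= r^-1 by rewrite invr_ge0 ltW.
have L0 : 0 <= - ln e by rewrite oppr_ge0 ln_le0// ltW.
have cE : c * (- ln e) `^ r^-1 = (c `^ r * - ln e) `^ r^-1.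
  by rewrite powRM ?powR_ge0// -powRrM mulfV ?gt_eqF// powRr1.
rewrite cE -poweR_EFin.
apply: ge0_le_poweR => //; first by rewrite lee_fin mulr_ge0 ?powR_ge0.
have ze : z < z + e by rewrite ltrDl.
have ze1 : z + e < z + 1 by rewrite ltrD2l.
have J := integral_inv_shift ze ze1.
have -> : - ln e = ln (z + 1 - z) - ln (z + e - z).
  by rewrite [z + 1]addrC [z + e]addrC !addrK ln1 sub0r.
rewrite EFinM -J -ge0_integralZl_EFin ?powR_ge0//; last 2 first.
- move=> x /=; rewrite in_itv/= => /andP[zx _]; rewrite lee_fin invr_ge0 subr_ge0.
  by apply: le_trans zx; exact: ltW.
- apply/measurable_EFinP.
  apply: (@eq_measurable_fun _ _ _ _ _ (fun x : R => (x - z) `^ (-1))); last first.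
    by apply: measurable_funTS; mfun.
  move=> x; rewrite inE/= in_itv/= => /andP[zx _]; rewrite powR_inv1// subr_ge0.
  by apply: le_trans zx; exact: ltW.
rewrite integral_mkcond; apply: ge0_integralT_mono => x; rewrite patchE; case: ifPn => //.
- move=> /set_mem/=; rewrite in_itv/= => /andP[zx _]; rewrite mule_ge0 ?lee_fin ?powR_ge0//.
  by rewrite invr_ge0 subr_ge0; apply: le_trans zx; exact: ltW.
- move=> /set_mem/=; rewrite in_itv/= => zx; have /andP[zx1 _] := zx.
  have xz : 0 < x - z by rewrite subr_gt0 (lt_le_trans ze).
  have -> : ((c `^ r)%:E * ((x - z)^-1)%:E = (c * (x - z) `^ (- r^-1))%:E `^ r)%E.
    rewrite -EFinM poweR_EFin powRM ?powR_ge0// -powRrM mulNr mulVf ?gt_eqF// powR_inv1 ?(ltW xz)//.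
  apply: ge0_le_poweR; [exact: ltW|by rewrite lee_fin mulr_ge0 ?powR_ge0|].
  rewrite patchE mem_set; last by rewrite RposE -(subrK z x); exact: ltr_wpDr.
  by apply: (le_trans (H x zx)); exact: lee_abs.
- by rewrite poweR_ge0.
Qed.

Lemma pos_potential_lower a s f x (A : set R) (g : R -> \bar R) :
  -1 < a -> 0 < s -> s < a + 1 -> (forall y, 0 <= f y) -> A `<=` Rpos R ->
  (forall y, A y -> (0 <= g y)%E) ->
  (forall y, A y -> (g y <= kser a s x y * (f y)%:E)%E) ->
  (\int[mu]_(y in A) g y <= pos_potential a s f x)%E.
Proof.
move=> a1 s0 sa f0 AR g0 gk; rewrite /pos_potential integral_mkcond [leRHS]integral_mkcond.
have k0 y : (0 <= kser a s x y * (f y)%:E)%E by rewrite mule_ge0 ?lee_fin ?kser_ge0.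
apply: ge0_integralT_mono => y; rewrite !patchE; first by case: ifPn => // /set_mem /g0.
case: ifPn => [/set_mem Ay|_]; last by case: ifPn.
by rewrite mem_set; [exact: gk|exact: AR].
Qed.

End test_functions.

(** * Scaling *)

Section boundedness_necessity.
#[local] Opaque powR expR ln integral.
Context {R : realType}.
Local Notation mu := (@lebesgue_measure R).
Implicit Types (a s x y z c u v : R) (p q : \bar R) (f F : R -> R).

Definition segment_ind u v y : R := if (u <= y) && (y <= v) then 1 else 0.

Lemma segment_ind_ge0 u v y : 0 <= segment_ind u v y.
Proof. by rewrite /segment_ind; case: ifP. Qed.

Lemma segment_ind_out u v y : 0 < u -> ~~ (0 < y) -> segment_ind u v y = 0.
Proof.
move=> u0 y0; rewrite /segment_ind ifF//; apply/negbTE; apply: contraNN y0 => /andP[uy _].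
exact: lt_le_trans uy.
Qed.

Lemma measurable_segment_ind u v : measurable_fun [set: R] (segment_ind u v).
Proof. by rewrite /segment_ind; mfun. Qed.

Lemma integral_segment_ind_powR u v r : 0 < r -> u < v ->
  (\int[mu]_y (segment_ind u v y `^ r)%:E = (v - u)%:E)%E.
Proof.
move=> r0 uv; rewrite -(lebesgue_measure_segment uv) -[RHS]mul1e -integral_cst//.
rewrite [RHS]integral_mkcond; apply: eq_integral => y _; rewrite patchE /segment_ind.
case: ifPn => h; first by rewrite mem_set/= ?in_itv// powR1.
by rewrite memNset/= ?in_itv/= ?powR0 ?gt_eqF//; exact/negP.
Qed.

Lemma segment_ind_Lp p u v : (1 <= p)%E -> 0 < u -> u < v ->
  Lp_pos p (segment_ind u v) /\
  (norm_pos p (EFin \o segment_ind u v) <= ((v - u) `^ (fine p^-1))%:E)%E.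
Proof.
move=> p1 u0 uv; have f0 := segment_ind_ge0 u v.
have fout y := @segment_ind_out u v y u0.
have mf := measurable_segment_ind u v.
split.
  apply: Lp_pos_nonneg => //; case: p p1 => [r| |]//=.
    rewrite lee_fin => r1; rewrite integral_segment_ind_powR ?ltry//.
    exact: lt_le_trans r1.
  by move=> _; exists 1; apply: aeW => y; rewrite /segment_ind; case: ifP.
case: p p1 => [r| |]//.
  rewrite lee_fin => r1; have r0 : 0 < r by exact: lt_le_trans r1.
  by rewrite norm_pos_real abs_pos_id// integral_segment_ind_powR// inver gt_eqF.
move=> _; rewrite powRr0 /norm_pos unlock lebesgue_measure_setT_gt0.
apply/ess_supP; apply: aeW => y; rewrite /= patchE; case: ifP => _; last by rewrite abse0 lee_fin.
by rewrite /= lee_fin /segment_ind; case: ifP => _; rewrite ?normr1 ?normr0.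
Qed.

Lemma potential_segment_ind_ge a s u v x m : -1 < a -> 0 < s -> s < a + 1 ->
  0 < x -> 0 < u -> u < v -> 0 <= m ->
  (forall y, u <= y <= v -> (m%:E <= kser a s x y)%E) ->
  ((m * (v - u))%:E <= potential a s (segment_ind u v) x)%E.
Proof.
move=> a1 s0 sa x0 u0 uv m0 H; rewrite ge0_potentialE//; last exact: segment_ind_ge0.
rewrite EFinM -(lebesgue_measure_segment uv) -integral_cst//.
apply: pos_potential_lower => //; first exact: segment_ind_ge0.
- by move=> y /=; rewrite in_itv/= RposE => /andP[h _]; exact: lt_le_trans h.
- by move=> y /=; rewrite in_itv/= => h; rewrite /segment_ind h mule1 H.
Qed.

(** Otherwise let l tend to 0 or to infinity. *)
Lemma power_bound_eq (A B c C : R) : 0 < c ->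
  (forall l, 0 < l -> c * l `^ A <= C * l `^ B) -> A = B.
Proof.
move=> c0 H; apply/eqP; apply: contraT => AB.
have BA : B - A != 0 by rewrite subr_eq0 eq_sym.
have C0 : 0 < C.
  by have := H 1 ltr01; rewrite !powR1 !mulr1; exact: lt_le_trans.
have K0 : 0 < c / (2 * C) by rewrite divr_gt0// mulr_gt0.
have := H _ (powR_gt0 (B - A)^-1 K0).
set l := (c / (2 * C)) `^ (B - A)^-1.
have l0 : 0 < l by exact: powR_gt0.
have -> : l `^ B = l `^ A * (c / (2 * C)).
  rewrite -[X in _ `^ X](subrK A) addrC powRDp//; congr (_ * _).
  by rewrite /l -powRrM mulVf// powRr1// ltW.
rewrite mulrCA [leRHS]mulrC -subr_ge0 -mulrBl pmulr_lge0 ?powR_gt0//.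
have -> : C * (c / (2 * C)) = c / 2 by field; rewrite gt_eqF.
by rewrite subr_ge0; lra.
Qed.

Lemma log_bound_false (c C t : R) : 0 < c -> 0 < t ->
  (forall e, 0 < e -> e < 1 / 2 -> c * (- ln e) `^ t <= C) -> False.
Proof.
move=> c0 t0 H; pose K := (`|C| + 1) / c.
have K0 : 0 < K by rewrite divr_gt0// ltr_wpDl.
pose L := 1 + K `^ t^-1.
have KL : 0 < K `^ t^-1 by exact: powR_gt0.
have L1 : 1 < L by rewrite ltrDl.
have e2 : expR (- L) < 1 / 2.
  rewrite expRN div1r ltf_pV2 ?posrE ?expR_gt0//.
  by apply: (@le_lt_trans _ _ (1 + L)); [lra|rewrite expR_gt1Dx// gt_eqF// (lt_trans ltr01)].
have := H _ (expR_gt0 _) e2; rewrite expRK opprK.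
apply/negP; rewrite -ltNge; apply: (@lt_le_trans _ _ (c * K)).
  by rewrite /K mulrC divfK ?gt_eqF//; apply: (le_lt_trans (ler_norm C)); rewrite ltrDl.
rewrite ler_pM2l// -[leLHS]powRr1 ?(ltW K0)// -(mulVf (lt0r_neq0 t0)) powRrM.
by rewrite ler_powRp ?(ltW t0)// ?(ltW KL)// /L lerDr.
Qed.

Lemma bounded_constant a s p q : potential_bounded a s p q -> exists2 C : R, 0 <= C &
  forall f (N : R), Lp_pos p f -> (norm_pos p (EFin \o f) <= N%:E)%E ->
  (norm_pos q (potential a s f) <= (C * N)%:E)%E.
Proof.
move=> [_ [C HC]]; have C0 : 0 <= Num.max C 0 by rewrite le_max lexx orbT.
exists (Num.max C 0) => // f N fL fN; apply: (le_trans (HC f fL)).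
apply: (@le_trans _ _ ((Num.max C 0)%:E * norm_pos p (EFin \o f))%E).
  by apply: lee_wpmul2r; [rewrite /norm_pos Lnorm_ge0|rewrite lee_fin le_max lexx].
by rewrite EFinM; apply: lee_wpmul2l; rewrite ?lee_fin.
Qed.

Section bounded.
Variables (a s : R) (p q : \bar R).
Hypotheses (a1 : -1 < a) (s0 : 0 < s) (sa : s < a + 1).
Hypotheses (p1 : (1 <= p)%E) (q1 : (1 <= q)%E).
Hypothesis bnd : potential_bounded a s p q.

(** Scaling: the potential of the indicator of [l, 2 l] is of order l^(2 s) on
[l, 2 l]. *)
Lemma bounded_exponents : fine p^-1 = 2 * s + fine q^-1.
Proof.
have [C C0 HC] := bounded_constant bnd.
have [c c0 Hc] := kser_lower a1 s0 sa.
set b := a + 1 / 2 in Hc; set e := 2 * s - 1 - b in Hc.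
pose d := c * (2 `^ (- `|e|) * 2 `^ (- `|b|)).
have d0 : 0 < d by rewrite (mulr_gt0 c0 (mulr_gt0 (powR_gt0 _ (ltr0Sn R 1)) (powR_gt0 _ (ltr0Sn R 1)))).
apply/esym; apply: (@power_bound_eq _ _ d C d0) => l l0.
have l2 : l < 2 * l by lra.
have lV : 2 * l - l = l by ring.
have [fL fN] := segment_ind_Lp p1 l0 l2.
have H := HC _ _ fL fN.
have K x y : l <= x <= 2 * l -> l <= y <= 2 * l -> (((d * l `^ (2 * s - 1)))%:E <= kser a s x y)%E.
  move=> hx hy; have x0 : 0 < x by move/andP: hx => [h _]; exact: lt_le_trans h.
  have y0 : 0 < y by move/andP: hy => [h _]; exact: lt_le_trans h.
  have [h1 h2] := Hc x y x0 y0.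
  have le12 : 1 <= 2 :> R by rewrite ler1n.
  have el : 2 * s - 1 = e + b by rewrite /e subrK.
  have bd w w' : l <= w <= 2 * l -> l <= w' <= 2 * l ->
      d * l `^ (2 * s - 1) <= c * (w `^ e * w' `^ b).
    move=> hw hw'; have /andP[we _] := powR_le_comparable e l0 le12 hw.
    have /andP[wb _] := powR_le_comparable b l0 le12 hw'.
    rewrite el powRDp// /d -mulrA ler_pM2l// mulrACA ler_pM//.
    - by rewrite (mulr_ge0 (powR_ge0 _ _) (powR_ge0 _ _)).
    - by rewrite (mulr_ge0 (powR_ge0 _ _) (powR_ge0 _ _)).
  have [yx|xy] := leP y x.
    by apply: le_trans (h1 yx); rewrite lee_fin bd.
  by apply: le_trans (h2 (ltW xy)); rewrite lee_fin [x `^ b * _]mulrC bd.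
clearbody d.
have lp : l `^ (2 * s - 1) * l = l `^ (2 * s).
  by rewrite -[X in _ * X = _](powRr1 (ltW l0)) -powRDp// subrK.
have dl : 0 <= d * l `^ (2 * s - 1) by rewrite (mulr_ge0 (ltW d0) (powR_ge0 _ _)).
have T x : l <= x <= 2 * l ->
    ((d * l `^ (2 * s))%:E <= potential a s (segment_ind l (2 * l)) x)%E.
  move=> hx; have x0 : 0 < x by move/andP: hx => [h _]; exact: lt_le_trans h.
  have := potential_segment_ind_ge a1 s0 sa x0 l0 l2 dl (fun y => K x y hx).
  by apply: le_trans; rewrite lee_fin lV -[leRHS]mulrA lp.
have dl' : 0 <= d * l `^ (2 * s) by rewrite (mulr_ge0 (ltW d0) (powR_ge0 _ _)).
have N := norm_pos_ge q1 dl' l0 l2 T; rewrite lV in N H.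
by rewrite powRDp// mulrA -lee_fin; exact: le_trans N H.
Qed.

End bounded.
End boundedness_necessity.

(** * Endpoint exponents *)

Section endpoint_necessity.
#[local] Opaque powR expR ln integral.
Context {R : realType}.
Local Notation mu := (@lebesgue_measure R).
Implicit Types (x y z c u v : R) (f F : R -> R).
Variables (a s : R).
Hypotheses (a1 : -1 < a) (s0 : 0 < s) (sa : s < a + 1).

(** Bumps of width e at 1, divided by e, tend to a Dirac mass, whose potential
|x - 1|^(2 s - 1) = |x - 1|^(-1/q) just fails to be in L^q. For q = +oo the bumps
themselves have unbounded potentials, by [kser_lower_log]. *)
Lemma unbounded_from_L1 (q : \bar R) : (1 <= q)%E -> ~ potential_bounded a s 1%E q.
Proof.
move=> q1 bnd; have [C C0 HC] := bounded_constant bnd.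
have p1 : (1 <= 1 :> \bar R)%E by [].
have expo := bounded_exponents a1 s0 sa p1 q1 bnd.
have [pE _ _ p1E _] := conjugate_exponentE p1.
have {pE p1E} p1E : fine (1%E : \bar R)^-1 = 1 by apply/eqP; rewrite p1E.
have [qE q0 _ _ qV] := conjugate_exponentE q1.
have test e : 0 < e -> [/\ 1 < 1 + e, Lp_pos 1%E (segment_ind 1 (1 + e)) &
    (norm_pos q (potential a s (segment_ind 1 (1 + e))) <= (C * e)%:E)%E].
  move=> e0; have h : 1 < 1 + e by rewrite ltrDl.
  have [fL fN] := segment_ind_Lp p1 ltr01 h; split => //.
  apply: HC => //; apply: (le_trans fN).
  by rewrite lee_fin p1E [1 + e]addrC addrK powRr1 ?(ltW e0).
move: q0; rewrite le_eqVlt => /predU1P[q0|q0].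
  have s2 : s = 1 / 2 by move: expo; rewrite p1E -q0; lra.
  have a2 : 1 / 2 < a + 1 by rewrite -s2.
  have [e /andP[e0 e1] He] := kser_lower_log a1 a2 (C + 1).
  have [h _ N] := test e e0.
  have C10 : 0 <= C + 1 by rewrite addr_ge0.
  have C1e : 0 <= (C + 1) * e by rewrite mulr_ge0// ltW.
  have T x : 1 <= x <= 1 + e ->
      (((C + 1) * e)%:E <= potential a s (segment_ind 1 (1 + e)) x)%E.
    move=> hx; have x0 : 0 < x by move/andP: hx => [k _]; exact: lt_le_trans k.
    have K y : 1 <= y <= 1 + e -> ((C + 1)%:E <= kser a s x y)%E.
      by move=> hy; rewrite s2; exact: He.
    have := potential_segment_ind_ge a1 s0 sa x0 ltr01 h C10 K.
    by rewrite [1 + e]addrC addrK addrC.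
  have := le_trans (norm_pos_ge q1 C1e ltr01 h T) N.
  rewrite -q0 powRr0 mulr1 lee_fin mulrDl mul1r gerDl.
  by rewrite leNgt e0.
have s2 : s < 1 / 2 by move: expo; rewrite p1E; lra.
have [c c0 Hc] := kser_lower_dist a1 s0 sa s2.
have qE' := qV q0; set u := fine q^-1 in q0 qE' expo.
have uE : 2 * s - 1 = - u by move: expo; rewrite p1E; lra.
apply: (@log_bound_false _ c C u c0 q0) => e e0 e12.
have e20 : 0 < e / 2 by rewrite divr_gt0.
have [h _ N] := test _ e20.
have T x : 1 + e <= x <= 1 + 1 ->
    ((c * (e / 2) * (x - 1) `^ (- (u^-1)^-1))%:E <= potential a s (segment_ind 1 (1 + e / 2)) x)%E.
  move=> /andP[hx1 hx2]; have x1 : 1 < x by lra.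
  have x0 : 0 < x by lra.
  have m0 : 0 <= c * (x - 1) `^ (- u) by rewrite (mulr_ge0 (ltW c0) (powR_ge0 _ _)).
  have K y : 1 <= y <= 1 + e / 2 -> ((c * (x - 1) `^ (- u))%:E <= kser a s x y)%E.
    move=> /andP[hy1 hy2]; have yx : y < x by lra.
    apply: (le_trans _ (Hc x y _ _ _)); last 3 first.
    - by apply/andP; split; lra.
    - by apply/andP; split; lra.
    - by rewrite gt_eqF.
    rewrite lee_fin ler_pM2l// uE gtr0_norm ?subr_gt0//.
    by apply: ler_powRn; rewrite ?oppr_le0 ?(ltW q0) ?subr_gt0// lerD2l lerN2.
  have := potential_segment_ind_ge a1 s0 sa x0 ltr01 h m0 K.
  by rewrite invrK [1 + e / 2]addrC addrK mulrAC.
have ce0 : 0 <= c * (e / 2) by rewrite (mulr_ge0 (ltW c0) (ltW e20)).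
have e1 : e < 1 by lra.
have := norm_pos_log_ge (etrans (invr_gt0 u) q0) ler01 e0 e1 ce0 T.
rewrite invrK -qE' => /le_trans/(_ N).
by rewrite lee_fin mulrAC ler_pM2r.
Qed.


(** The function (y - 1)^(-1/p) on [1 + e, 2] has a potential of order ln (1/e) at 1,
but its norm in L^p is only the power 1/p < 1 of ln (1/e). *)
Lemma unbounded_to_Loo (p : \bar R) : (1 <= p)%E -> p != 1%E ->
  ~ potential_bounded a s p +oo%E.
Proof.
move=> p1 pn1 bnd; have [C C0 HC] := bounded_constant bnd.
have q1 : (1 <= +oo :> \bar R)%E by exact: leey.
have expo := bounded_exponents a1 s0 sa p1 q1 bnd.
have [pE p0 p1' pn1' pV] := conjugate_exponentE p1.
set r := fine p^-1 in expo pE p0 p1' pn1' pV.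
have rE : r = 2 * s by rewrite expo [fine _](_ : _ = 0)// addr0.
have r0 : 0 < r by rewrite rE mulr_gt0.
have {p1' pn1' pn1} r1 : r < 1 by rewrite lt_neqAle p1' andbT pn1'.
have {}pV := pV r0.
have s2 : s < 1 / 2 by move: r1; rewrite rE; lra.
have [c c0 Hc] := kser_lower_dist a1 s0 sa s2.
have rV0 : 0 < r^-1 by rewrite invr_gt0.
have t0 : 0 < 1 - r by rewrite subr_gt0.
apply: (@log_bound_false _ c C _ c0 t0) => e e0 e12.
have e1 : 1 + e < 2 by lra.
have z1 : 1 < 1 + e by rewrite ltrDl.
have L0 : 0 < - ln e by rewrite oppr_gt0 ln_lt0// e0/=; lra.
have J : (\int[mu]_(x in `[(1 + e)%R, 2%R]) ((x - 1)^-1)%:E = (- ln e)%:E)%E.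
  rewrite integral_inv_shift//; have -> : 2 - 1 = 1 :> R by ring.
  by rewrite [1 + e]addrC addrK ln1 sub0r.
pose f y : R := if (1 + e <= y) && (y <= 2) then (y - 1) `^ (- r) else 0.
have f0 y : 0 <= f y by rewrite /f; case: ifP => // _; exact: powR_ge0.
have fout y : ~~ (0 < y) -> f y = 0.
  move=> y0; rewrite /f ifF//; apply/negbTE; apply: contraNN y0 => /andP[uy _].
  by apply: lt_le_trans uy; lra.
have mf : measurable_fun [set: R] f by rewrite /f; mfun.
have If : (\int[mu]_y (f y `^ r^-1)%:E = (- ln e)%:E)%E.
  rewrite -J [RHS]integral_mkcond; apply: eq_integral => y _; rewrite patchE /f.
  case: ifPn => h; last by rewrite memNset/= ?in_itv/= ?powR0 ?gt_eqF//; exact/negP.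
  have y1 : 0 < y - 1 by rewrite subr_gt0; move/andP: h => [h _]; exact: lt_le_trans h.
  by rewrite mem_set/= ?in_itv//= -powRrM mulNr mulfV ?gt_eqF// powR_inv1// ltW.
have fL : Lp_pos p f by apply: Lp_pos_nonneg => //; rewrite pV /= If ltry.
have fN : (norm_pos p (EFin \o f) <= ((- ln e) `^ r)%:E)%E.
  by rewrite pV norm_pos_real abs_pos_id// If invrK.
have N := HC f _ fL fN.
have h1 : 1 < 1 + e / 2 by lra.
have cL : 0 <= c * - ln e by rewrite mulr_ge0 ?(ltW c0)// ltW.
have T x : 1 <= x <= 1 + e / 2 -> ((c * - ln e)%:E <= potential a s f x)%E.
  move=> /andP[hx1 hx2]; have x0 : 0 < x by lra.
  rewrite ge0_potentialE// EFinM -J -ge0_integralZl_EFin ?(ltW c0)//; last 2 first.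
  - by move=> y /=; rewrite in_itv/= => /andP[hy _]; rewrite lee_fin invr_ge0; lra.
  - apply/measurable_EFinP.
    apply: (@eq_measurable_fun _ _ _ _ _ (fun x : R => (x - 1) `^ (-1))); last first.
      by apply: measurable_funTS; mfun.
    move=> y; rewrite inE/= in_itv/= => /andP[hy _]; rewrite powR_inv1// subr_ge0.
    by apply: le_trans hy; exact: ltW.
  apply: pos_potential_lower => //.
  - by move=> y /=; rewrite in_itv/= RposE => /andP[hy _]; lra.
  - by move=> y /=; rewrite in_itv/= => /andP[hy _]; rewrite mule_ge0 ?lee_fin ?(ltW c0)// invr_ge0; lra.
  move=> y /=; rewrite in_itv/= => hy; have /andP[hy1 hy2] := hy.
  have y1 : 0 < y - 1 by lra.
  have -> : f y = (y - 1) `^ (- r) by rewrite /f hy.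
  have -> : (y - 1)^-1 = (y - 1) `^ (2 * s - 1) * (y - 1) `^ (- r).
    by rewrite -powRDp// rE -(powR_inv1 (ltW y1)); congr (_ `^ _); ring.
  rewrite mulrC EFinM muleCA muleC; apply: lee_wpmul2r; first by rewrite lee_fin powR_ge0.
  have xy : x != y by rewrite lt_eqF//; lra.
  apply: (le_trans _ (Hc x y _ _ xy)); last 2 first.
  - by apply/andP; split; lra.
  - by apply/andP; split; lra.
  rewrite -EFinM lee_fin ler_pM2l//; apply: ler_powRn.
  - by move: r1; rewrite rE; lra.
  - by rewrite normr_gt0 subr_eq0.
  - by rewrite distrC gtr0_norm; lra.
have := le_trans (norm_pos_ge q1 cL ltr01 h1 T) N.
rewrite [fine _](_ : _ = 0)// powRr0 mulr1 lee_fin.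
have LE : (- ln e) `^ (1 - r) * (- ln e) `^ r = - ln e.
  by rewrite -powRDp// subrK powRr1// ltW.
by rewrite -{1}LE mulrA ler_pM2r// powR_gt0.
Qed.

(** The potential of a bump is of order x^(a + 1/2) at the origin, where it must be
in L^q. *)
Lemma bounded_at_origin p (q : R) : (1 <= p)%E -> 1 <= q ->
  potential_bounded a s p q%:E -> - (a + 1 / 2) < q^-1.
Proof.
move=> p1 q1 bnd; rewrite ltNge; apply/negP => H.
have [C C0 HC] := bounded_constant bnd.
have q0 : 0 < q by exact: lt_le_trans q1.
have [c c0 Hc] := kser_lower a1 s0 sa.
set b := a + 1 / 2 in Hc H; set e := 2 * s - 1 - b in Hc.
have h12 : 1 < 2 :> R by rewrite ltr1n.
have [fL fN] := segment_ind_Lp p1 ltr01 h12.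
have N := HC _ _ fL fN.
have qV0 : 0 < q^-1 by rewrite invr_gt0.
pose d := c * 2 `^ (- `|e|).
have d0 : 0 < d by rewrite (mulr_gt0 c0 (powR_gt0 _ (ltr0Sn R 1))).
apply: (@log_bound_false _ d _ _ d0 qV0) => t t0 t12.
have t1 : t < 1 by lra.
have T x : 0 + t <= x <= 0 + 1 ->
    ((d * (x - 0) `^ (- q^-1))%:E <= potential a s (segment_ind 1 2) x)%E.
  rewrite !add0r subr0 => /andP[tx x1]; have x0 : 0 < x by exact: lt_le_trans tx.
  have m0 : 0 <= d * x `^ (- q^-1) by rewrite (mulr_ge0 (ltW d0) (powR_ge0 _ _)).
  have K y : 1 <= y <= 2 -> ((d * x `^ (- q^-1))%:E <= kser a s x y)%E.
    move=> hy; have /andP[y1 y2] := hy; have y0 : 0 < y by exact: lt_le_trans y1.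
    have [_ /(_ (le_trans x1 y1))] := Hc x y x0 y0; apply: le_trans.
    rewrite lee_fin /d -mulrA ler_pM2l// mulrC; apply: ler_pM; rewrite ?powR_ge0//.
      have xb : 1 <= x^-1 by rewrite invf_ge1.
      have -> : b = - - b by rewrite opprK.
      rewrite -(powR_inv q^-1 (ltW x0)) -(powR_inv (- b) (ltW x0)).
      exact: ler_powR.
    have hy' : 1 <= y <= 2 * 1 by rewrite mulr1.
    have /andP[+ _] := powR_le_comparable e ltr01 (ltW h12) hy'.
    by rewrite powR1 mulr1.
  have := potential_segment_ind_ge a1 s0 sa x0 ltr01 h12 m0 K.
  have -> : 2 - 1 = 1 :> R by ring.
  by rewrite mulr1.
have := norm_pos_log_ge q0 (lexx 0) t0 t1 (ltW d0) T.
move=> /le_trans/(_ N); rewrite lee_fin; exact.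
Qed.

End endpoint_necessity.

(** * Necessary conditions for convergence *)

Section domain_necessity.
#[local] Opaque powR expR ln integral.
Context {R : realType}.
Local Notation mu := (@lebesgue_measure R).
Implicit Types (a s x y e Y t : R) (p : \bar R) (c : bool) (f F : R -> R).

Definition log_sign c : R := if c then -1 else 1.
(** Equal to 1 + |ln y| on [hrange c 1]. *)
Definition log_weight c y : R := 1 + log_sign c * ln y.
Definition log_range c Y : set R := if c then `[Y^-1, 1]%classic else `[1, Y]%classic.

Lemma log_sign_sqr c : log_sign c * log_sign c = 1.
Proof. by case: c; rewrite /log_sign ?mulrNN mulr1. Qed.

Lemma log_weight_ge1 c y : hrange c 1 y -> 1 <= log_weight c y.
Proof.
rewrite /log_weight lerDl; case: c => /= [/andP[y0 y1]|y1]; rewrite /log_sign.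
  by rewrite mulN1r oppr_ge0 ln_le0.
by rewrite mul1r ln_ge0.
Qed.

Lemma measurable_log_weight c : measurable_fun [set: R] (log_weight c).
Proof. by rewrite /log_weight; mfun. Qed.

Lemma log_range_hrange c Y y : 1 < Y -> log_range c Y y -> hrange c 1 y.
Proof.
move=> Y1; case: c; rewrite /log_range/= in_itv/= => /andP[h1 h2] //.
by rewrite h2 andbT; apply: lt_le_trans h1; rewrite invr_gt0 (lt_trans ltr01).
Qed.

Lemma measurable_log_range c Y : measurable (log_range c Y).
Proof. by case: c; exact: measurable_itv. Qed.

(** The substitution t = 1 + |ln y| on either side of 1. *)
Lemma integral_log_subst c (G g : R -> R) Y : 1 < Y ->
  (forall t, 1 <= t -> is_derive t 1 G (g t)) ->
  (forall t, 1 <= t -> {for t, continuous g}) ->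
  (\int[mu]_(y in log_range c Y) (y^-1 * g (log_weight c y))%:E = (G (1 + ln Y) - G 1)%:E)%E.
Proof.
move=> Y1 dG cg; have Y0 : 0 < Y by exact: lt_trans Y1.
pose F y := log_sign c * G (log_weight c y).
have dF y : hrange c 1 y -> is_derive y 1 F (y^-1 * g (log_weight c y)).
  move=> hy; have y0 := hrange_gt0 ltr01 hy.
  have D1 := is_deriveM (is_derive_cst (log_sign c) y 1) (is_derive1_ln y0).
  have D2 := is_deriveD (is_derive_cst (1 : R) y 1) D1.
  have D3 := is_derive1_comp (f := G) (dG _ (log_weight_ge1 hy)) D2.
  have D4 := is_deriveM (is_derive_cst (log_sign c) y 1) D3.
  apply: (is_derive_eq D4).
  rewrite !scaler0 !addr0 add0r /GRing.scale/= -[RHS]mul1r -(log_sign_sqr c).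
  by rewrite /cst; ring.
have cF y : hrange c 1 y -> {for y, continuous (fun y => y^-1 * g (log_weight c y))}.
  move=> hy; have y0 := hrange_gt0 ltr01 hy.
  have cl : {for y, continuous (@ln R)} by exact: continuous_ln.
  apply: (@continuousM R R); first exact: (inv_continuous (lt0r_neq0 y0)).
  apply: (@continuous_comp _ _ _ (log_weight c) g); last exact/cg/log_weight_ge1.
  apply: continuousD; first exact: cvg_cst.
  by apply: continuousM; [exact: cvg_cst|exact: cl].
case: c @F dF cF => F dF cF; rewrite /log_range.
  have Y1' : Y^-1 < 1 by rewrite invf_lt1.
  have -> : G (1 + ln Y) - G 1 = F 1 - F Y^-1.
    rewrite /F /log_weight /log_sign ln1 lnV ?posrE// mulr0 addr0 !mulN1r !opprK.
    by rewrite addrC.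
  apply: (@integral_derive _ F) => // y /andP[h1 h2];
    have hy : hrange true 1 y by rewrite /= h2 andbT; apply: lt_le_trans h1; rewrite invr_gt0.
    exact: dF.
  exact: cF.
have -> : G (1 + ln Y) - G 1 = F Y - F 1.
  by rewrite /F /log_weight /log_sign ln1 !mul1r addr0.
by apply: (@integral_derive _ F) => // y /andP[h1 h2]; [exact: dF|exact: cF].
Qed.

Lemma hrange_bigcup c : [set y | hrange c 1 y] = \bigcup_n log_range c n.+2%:R.
Proof.
apply/seteqP; split => y /= => [hy|[n _]]; last by apply: log_range_hrange; rewrite ltr1n.
have y0 := hrange_gt0 ltr01 hy.
case: c hy => /= [/andP[_ y1]|y1].
  exists (Num.truncn y^-1) => //; rewrite /log_range/= in_itv/= y1 andbT.
  rewrite -[leRHS]invrK lef_pV2 ?posrE ?invr_gt0//; apply: ltW.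
  by apply: (lt_le_trans (truncnS_gt _)); rewrite ler_nat.
exists (Num.truncn y) => //; rewrite /log_range/= in_itv/= y1/=; apply: ltW.
by apply: (lt_le_trans (truncnS_gt _)); rewrite ler_nat.
Qed.

Lemma integral_log_powR_le c (m : R) : 1 < m ->
  (\int[mu]_y (if hrange c 1 y then y^-1 * log_weight c y `^ (- m) else 0)%:E
    <= ((m - 1)^-1)%:E)%E.
Proof.
move=> m1; have m0 : 0 < m - 1 by rewrite subr_gt0.
pose g y := y^-1 * log_weight c y `^ (- m).
have -> : (\int[mu]_y (if hrange c 1 y then y^-1 * log_weight c y `^ (- m) else 0)%:E =
   \int[mu]_(y in \bigcup_n log_range c n.+2%:R) (g y)%:E)%E.
  rewrite -hrange_bigcup -(@integral_if _ setT [set y | hrange c 1 y] (hrange c 1) (fun y => (g y)%:E))//; last first.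
    by move=> y; split=> [h|[_ h]].
  by apply: eq_integral => y _; case: ifP.
have g0 n y : log_range c n.+2%:R y -> (0 <= (g y)%:E)%E.
  move=> /log_range_hrange => /(_ (ltr1n _ _)) /(hrange_gt0 ltr01) y0.
  by rewrite lee_fin mulr_ge0 ?powR_ge0// invr_ge0 ltW.
have mg n : measurable_fun (log_range c n.+2%:R) (fun y => (g y)%:E).
  apply: (@eq_measurable_fun _ _ _ _ _ (fun y => (y `^ (-1) * log_weight c y `^ (- m))%:E)).
    move=> y /set_mem /log_range_hrange => /(_ (ltr1n _ _)) /(hrange_gt0 ltr01) y0.
    by rewrite powR_inv1// ltW.
  by have ml := measurable_log_weight c; apply: measurable_funTS; mfun.
have nd : nondecreasing_seq (fun n : nat => log_range c n.+2%:R).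
  apply/nondecreasing_seqP => n; rewrite subsetEset => y; rewrite /log_range.
  case: c {g g0 mg}; rewrite /= !in_itv/= => /andP[h1 h2]; apply/andP; split => //.
    by apply: le_trans h1; rewrite lef_pV2 ?posrE// ler_nat.
  by apply: (le_trans h2); rewrite ler_nat.
have cF := @ge0_nondecreasing_set_cvg_integral _ (measurableTypeR R) R
  (fun n => log_range c n.+2%:R) (fun y => (g y)%:E) mu nd
  (fun n => measurable_log_range c _) mg g0.
rewrite -(cvg_lim _ cF)//; apply: lime_le; first by apply/cvg_ex; eexists; exact: cF.
apply: nearW => n; have n1 : 1 < n.+2%:R :> R by rewrite ltr1n.
have dG t : 1 <= t -> is_derive t 1 (fun t => - (m - 1)^-1 * t `^ (1 - m)) (t `^ (- m)).
  move=> t1; have t0 : 0 < t by exact: lt_le_trans t1.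
  have -> : t `^ (- m) = - (m - 1)^-1 * (1 - m) * t `^ (1 - m - 1).
    rewrite -[1 - m]opprB mulrNN mulVf ?mul1r ?gt_eqF//; congr (_ `^ _); ring.
  exact: is_derive_scale_powR.
have ct t : 1 <= t -> {for t, continuous (@powR R ^~ (- m))}.
  by move=> t1; apply: continuous_at_powR; exact: lt_le_trans t1.
rewrite (integral_log_subst c n1 dG ct) lee_fin powR1 mulr1 opprK gerDr mulNr oppr_le0.
by rewrite mulr_ge0 ?powR_ge0// invr_ge0 ltW.
Qed.

Lemma integral_log_inv c Y : 1 < Y ->
  (\int[mu]_(y in log_range c Y) (y^-1 * (log_weight c y)^-1)%:E = (ln (1 + ln Y))%:E)%E.
Proof.
move=> Y1; transitivity ((ln (1 + ln Y) - ln 1)%:E : \bar R); last by rewrite ln1 subr0.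
apply: (@integral_log_subst c (@ln R) (fun t => t^-1)) => // t t1.
  by apply: is_derive1_ln; exact: lt_le_trans t1.
by apply: inv_continuous; rewrite gt_eqF// (lt_le_trans ltr01).
Qed.

(** For p = 1 the witness is a power. For p > 1 it is y^(-1/p) / (1 + |ln y|), which
is in L^p although 1 / (y (1 + |ln y|)) is not integrable. *)
Lemma weight_necessary c p e : (1 <= p)%E -> ~~ weight_cond c p e ->
  exists f, [/\ measurable_fun [set: R] f, forall y, 0 <= f y,
    forall y, ~~ hrange c 1 y -> f y = 0, Lp_finite p f &
    forall y, hrange c 1 y -> y^-1 * (log_weight c y)^-1 <= y `^ e * f y].
Proof.
move=> p1; rewrite /weight_cond; have mh := measurable_hrange1 c (1 : R).
have ml := measurable_log_weight c.
have wle1 y : hrange c 1 y -> 0 <= (log_weight c y)^-1 <= 1.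
  move=> /log_weight_ge1 h; have h0 := lt_le_trans ltr01 h.
  by rewrite invr_ge0 (ltW h0) invf_le1.
case: ifPn => [/eqP ->|pn1] ce.
  exists (fun y => if hrange c 1 y then y `^ (- e - 1) else 0); split.
  - by mfun.
  - by move=> y; case: ifP => // _; exact: powR_ge0.
  - by move=> y /negbTE ->.
  - have se : hsign c (- e).
      by case: c ce {mh ml wle1} => /=; rewrite -ltNge ?oppr_gt0 ?oppr_lt0.
    rewrite /Lp_finite; apply: le_lt_trans (ltry (1 `^ (- e) / `|- e|)).
    apply: le_trans (integral_hrange ltr01 se); apply: le_of_eq.
    apply: eq_integral => y _; rewrite powRr1//.
    by case: ifP => // _; exact: powR_ge0.
  - move=> y hy; rewrite hy; have y0 := hrange_gt0 ltr01 hy.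
    rewrite -powRDp// (_ : e + (- e - 1) = -1) ?powR_inv1 ?(ltW y0)//; last by ring.
    by have /andP[_ w1] := wle1 y hy; rewrite ler_piMr// invr_ge0 ltW.
have [pE p0 p1' pn1' pV] := conjugate_exponentE p1.
set r := fine p^-1 in ce pE p0 p1' pn1' pV.
pose f y := if hrange c 1 y then y `^ (- r) * (log_weight c y) `^ (-1) else 0.
exists f; split.
- by rewrite /f; mfun.
- by move=> y; rewrite /f; case: ifP => // _; rewrite mulr_ge0 ?powR_ge0.
- by move=> y /negbTE h; rewrite /f h.
- have [r0|r0] := ltP 0 r.
    rewrite (pV r0) /Lp_finite; have rV1 : 1 < r^-1.
      by rewrite invf_gt1// lt_neqAle p1' andbT pn1'.
    apply: le_lt_trans (ltry (r^-1 - 1)^-1).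
    apply: le_trans (integral_log_powR_le c rV1); apply: le_of_eq.
    apply: eq_integral => y _; rewrite /f; case: ifP => hy; last by rewrite powR0// gt_eqF ?invr_gt0.
    have y0 := hrange_gt0 ltr01 hy.
    rewrite powRM ?powR_ge0// -!powRrM mulNr mulfV ?gt_eqF// mulN1r powR_inv1//.
    exact: ltW.
  have rE : r = 0 by apply/eqP; rewrite eq_le r0.
  have -> : p = +oo%E.
    case: p p1 {pn1 pE p1' pn1' pV} @r ce p0 @f r0 rE => [z| |]//.
    rewrite lee_fin => z1; have z0 : 0 < z by exact: lt_le_trans z1.
    by rewrite inver gt_eqF//= => _ _ _ /eqP; rewrite invr_eq0 gt_eqF.
  exists 1; apply: aeW => y; rewrite /f rE oppr0 powRr0 mul1r; case: ifP => // hy.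
  have /andP[w0 w1] := wle1 y hy.
  by rewrite powR_inv1// -invr_ge0.
move=> y hy; rewrite /f hy; have y0 := hrange_gt0 ltr01 hy.
have /andP[w0 w1] := wle1 y hy.
rewrite powR_inv1; last by rewrite -invr_ge0.
rewrite mulrA ler_wpM2r// -powRDp//.
rewrite -(powR_inv1 (ltW y0)).
case: c ce hy {wle1 ml mh f w0 w1} => /=; rewrite -leNgt => h.
  move=> /andP[_ y1]; rewrite -(powR_inv 1 (ltW y0)) -[e - r]opprK -(powR_inv _ (ltW y0)).
  by apply: ler_powR; [rewrite invf_ge1|lra].
by move=> y1; apply: ler_powR => //; lra.
Qed.

(** For x on the other side of 1, the whole of [hrange c 1] lies where the kernel is
bounded below by a multiple of the weight. *)
Lemma domain_necessary c a s p : -1 < a -> 0 < s -> s < a + 1 -> (1 <= p)%E ->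
  Lp_pos p `<=` Dom_potential a s ->
  weight_cond c p (if c then a + 1 / 2 else 2 * s - 1 - (a + 1 / 2)).
Proof.
move=> a1 s0 sa p1 sub; apply: contraT => /(weight_necessary p1).
set e := if c then _ else _ => -[f [mf f0 fh fp fe]].
have fout y : ~~ (0 < y) -> f y = 0.
  by move=> y0; apply: fh; apply: contraNN y0; exact: hrange_gt0.
have fL : Lp_pos p f by exact: Lp_pos_nonneg.
have mf' : measurable_fun [set: R] (f \_ (Rpos R)) by rewrite restrict_id.
have := (Dom_potentialP a1 s0 sa mf').1 (sub _ fL); rewrite abs_pos_id// => Hae.
(* an interval of points x adjacent to 1, opposite to hrange c 1 *)
pose u : R := if c then 1 else 1 / 2; pose v : R := if c then 2 else 1.
have uv : u < v by rewrite /u /v; case: (c); lra.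
have u0 : 0 < u by rewrite /u; case: (c); lra.
have I0 : (0 < mu `[u, v]%classic)%E by rewrite lebesgue_measure_segment// lte_fin subr_gt0.
have [x] := ae_exists (measurable_itv _) I0 Hae.
rewrite /= in_itv/= => /andP[ux xv] Hx; have x0 : 0 < x by exact: lt_le_trans ux.
have {}Hx : (pos_potential a s f x < +oo)%E by apply: Hx; rewrite RposE.
have [k k0 Hk] := kser_lower a1 s0 sa.
pose w := x `^ (if c then 2 * s - 1 - (a + 1 / 2) else a + 1 / 2).
have w0 : 0 < w by exact: powR_gt0.
have lower y : hrange c 1 y -> ((k * w * y `^ e)%:E <= kser a s x y)%E.
  move=> hy; have y0 := hrange_gt0 ltr01 hy; have [h1 h2] := Hk x y x0 y0.
  rewrite /w /e -mulrA; move: hy h1 h2 ux xv; rewrite /u /v; case: (c) => /=.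
    by move=> /andP[_ y1] h1 _ ux _; apply: h1; exact: le_trans ux.
  by move=> y1 _ h2 _ xv; apply: h2; exact: le_trans y1.
have kw0 : 0 < k * w by rewrite mulr_gt0.
clearbody w.
have big Y : 1 < Y -> ((k * w * ln (1 + ln Y))%:E <= pos_potential a s f x)%E.
  move=> Y1; rewrite EFinM -(integral_log_inv c Y1).
  have g0 y : log_range c Y y -> 0 <= y^-1 * (log_weight c y)^-1.
    move=> /(log_range_hrange Y1) hy; have y0 := hrange_gt0 ltr01 hy.
    by rewrite mulr_ge0 ?invr_ge0 ?(ltW y0)// (le_trans ler01)// log_weight_ge1.
  have mY := measurable_log_range c Y.
  have mg : measurable_fun (log_range c Y) (fun y => (y^-1 * (log_weight c y)^-1)%:E).
    apply: (@eq_measurable_fun _ _ _ _ _ (fun y => (y `^ (-1) * log_weight c y `^ (-1))%:E)).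
      move=> y /set_mem /(log_range_hrange Y1) hy; have y0 := hrange_gt0 ltr01 hy.
      by rewrite !powR_inv1 ?(ltW y0)// (le_trans ler01)// log_weight_ge1.
    by have ml := measurable_log_weight c; apply: measurable_funTS; mfun.
  rewrite -ge0_integralZl_EFin//; last exact: ltW.
  apply: pos_potential_lower => //.
  - by move=> y /(log_range_hrange Y1) /(hrange_gt0 ltr01); rewrite RposE.
  - by move=> y hy; rewrite mule_ge0 ?lee_fin ?(ltW kw0)//; exact: g0.
  move=> y hy; have h1 := log_range_hrange Y1 hy.
  apply: (@le_trans _ _ ((k * w * y `^ e)%:E * (f y)%:E)%E).
    by rewrite -!EFinM lee_fin -[leRHS]mulrA ler_pM2l// fe.
  by apply: lee_wpmul2r; [rewrite lee_fin|exact: lower].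
have T0 := pos_potential_ge0 a1 s0 sa x f0.
have Tfin : pos_potential a s f x \is a fin_num by rewrite ge0_fin_numE.
set T := fine (pos_potential a s f x).
pose K := (T + 1) / (k * w).
have Tn : 0 <= T by exact: fine_ge0.
have Y1 : 1 < expR (expR K) by rewrite expR_gt1 expR_gt0.
have := big _ Y1; rewrite -(fineK Tfin) lee_fin leNgt => /negP; case.
rewrite expRK; apply: (@lt_le_trans _ _ (k * w * K)).
  by rewrite /K mulrC divfK ?gt_eqF// ltrDl.
rewrite ler_pM2l// -{1}(expRK K) ler_ln ?posrE ?addr_gt0 ?expR_gt0//.
by rewrite lerDr.
Qed.

End domain_necessity.

(** * The characterizations *)

Section characterization.
#[local] Opaque powR expR ln integral.
Context {R : realType}.
Variables (a s : R) (p q : \bar R).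
Hypotheses (a1 : -1 < a) (s0 : 0 < s) (sa : s < a + 1).
Hypotheses (p1 : (1 <= p)%E) (q1 : (1 <= q)%E).

Lemma Lp_sub_DomP : Lp_pos p `<=` Dom_potential a s <->
  weight_cond true p (a + 1 / 2) /\ weight_cond false p (2 * s - 1 - (a + 1 / 2)).
Proof.
split=> [sub|[c1 c2] f /(Lp_posP f p1)[mf fp]].
  split; first exact: (domain_necessary true a1 s0 sa p1 sub).
  exact: (domain_necessary false a1 s0 sa p1 sub).
apply/(Dom_potentialP a1 s0 sa mf); apply: domain_sufficient c1 c2 _ _ fp => //.
  exact: measurable_abs_pos.
exact: abs_pos_ge0.
Qed.

Lemma weight_cond_infty : weight_cond false p (2 * s - 1 - (a + 1 / 2)) =
  (if p == 1%E then ((2 * s - a - 1 / 2)%:E <= p^-1)%E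
   else ((2 * s - a - 1 / 2)%:E < p^-1)%E).
Proof.
have [pE _ _ _ _] := conjugate_exponentE p1.
rewrite /weight_cond; case: ifPn => [/eqP ->|_].
  by rewrite inve1 lee_fin; apply/idP/idP; lra.
by rewrite pE lte_fin /=; apply/idP/idP; lra.
Qed.

Lemma weight_cond_zero : weight_cond true p (a + 1 / 2) =
  (if p == 1%E then (p^-1 <= (a + 3 / 2)%:E)%E else (p^-1 < (a + 3 / 2)%:E)%E).
Proof.
have [pE _ _ _ _] := conjugate_exponentE p1.
rewrite /weight_cond; case: ifPn => [/eqP ->|_].
  by rewrite inve1 lee_fin; apply/idP/idP; lra.
by rewrite pE lte_fin /=; apply/idP/idP; lra.
Qed.

(** Necessity collects the test functions above; the domain inclusion, contained in
boundedness, supplies the condition at the origin. *)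
Lemma potential_boundedP : potential_bounded a s p q <->
  [/\ (q^-1 = p^-1 - (2 * s)%:E)%E, (1 < p)%E, (q < +oo)%E,
      weight_cond true p (a + 1 / 2) & - (a + 1 / 2) < fine q^-1].
Proof.
have [pE p0 p1' pn1' pV] := conjugate_exponentE p1.
have [qE q0 q1' qn1' qV] := conjugate_exponentE q1.
split=> [bnd|[expo p1s qy wt bq]].
  have [/Lp_sub_DomP[wt _] _] := bnd.
  have expo := bounded_exponents a1 s0 sa p1 q1 bnd.
  have pn1 : p != 1%E.
    by apply/negP => /eqP pE1; apply: (unbounded_from_L1 a1 s0 sa q1); rewrite -pE1.
  have qn : q != +oo%E.
    by apply/negP => /eqP qE1; apply: (unbounded_to_Loo a1 s0 sa p1 pn1); rewrite -qE1.
  split => //.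
  - by rewrite pE qE -EFinB expo addrAC subrr add0r.
  - by rewrite lt_neqAle eq_sym pn1.
  - by rewrite ltey.
  move: qn q1 bnd; case: (q) => [r| |]// _; rewrite lee_fin => r1 bnd.
  have r0 : 0 < r by exact: lt_le_trans r1.
  rewrite inver gt_eqF//=; exact: (bounded_at_origin a1 s0 sa p1 r1 bnd).
have {}expo : fine q^-1 = fine p^-1 - 2 * s.
  by move: expo; rewrite {1}pE {1}qE -EFinB => -[].
have q0' : 0 < fine q^-1.
  move: q1 qy; case: (q) => [r| |]//; rewrite lee_fin => r1 _.
  have r0 : 0 < r by exact: lt_le_trans r1.
  by rewrite inver gt_eqF//= invr_gt0.
have qp : fine q^-1 < fine p^-1 by rewrite expo gtrBl mulr_gt0.
have p0' := lt_trans q0' qp.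
have pn1 : fine p^-1 != 1 by rewrite pn1' gt_eqF.
have p1'' : fine p^-1 < 1 by rewrite lt_neqAle pn1.
move: wt; rewrite /weight_cond -pn1' (negbTE pn1) /= => wt.
rewrite (pV p0') (qV q0').
move: (fine p^-1) (fine q^-1) p0' q0' qp p1'' wt bq expo => r u r0 u0 ur r1 wt bq expo.
apply: potential_bounded_of_exponents => //; rewrite ?invrK//.
- by rewrite invf_gt1.
- by rewrite ltf_pV2.
- by rewrite expo subKr.
- by rewrite -subr_gt0 opprK addrC in bq.
Qed.

End characterization.

Theorem corollary2p11 (R : realType) (alpha sigma : R) (p q : \bar R)
    (halpha : -1 < alpha) (hsigma0 : 0 < sigma) (hsigma : sigma < alpha + 1)
    (hp : (1 <= p)%E) (hq : (1 <= q)%E) :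
  (- (1 / 2) <= alpha ->
    (Lp_pos p `<=` Dom_potential alpha sigma <->
      (if p == 1%E then ((2 * sigma - alpha - 1 / 2)%:E <= p^-1)%E
       else ((2 * sigma - alpha - 1 / 2)%:E < p^-1)%E)) /\
    (potential_bounded alpha sigma p q <->
      [/\ (q^-1 = p^-1 - (2 * sigma)%:E)%E, (1 < p)%E & (q < +oo)%E])) /\
  (alpha < - (1 / 2) ->
    (Lp_pos p `<=` Dom_potential alpha sigma <->
      (if p == 1%E then
         ((2 * sigma - alpha - 1 / 2)%:E <= p^-1 <= (alpha + 3 / 2)%:E)%E
       else
         ((2 * sigma - alpha - 1 / 2)%:E < p^-1 < (alpha + 3 / 2)%:E)%E)) /\
    (potential_bounded alpha sigma p q <->
      [/\ (q^-1 = p^-1 - (2 * sigma)%:E)%E,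
          ((- alpha - 1 / 2)%:E < (hoelder_conjugate p)^-1)%E
        & ((- alpha - 1 / 2)%:E < q^-1)%E])).
Proof.
have DomP := Lp_sub_DomP halpha hsigma0 hsigma hp.
have BndP := potential_boundedP halpha hsigma0 hsigma hp hq.
rewrite (weight_cond_zero alpha hp) (weight_cond_infty alpha sigma hp) in DomP.
rewrite (weight_cond_zero alpha hp) in BndP.
have [pE p0 p1' pn1' pV] := conjugate_exponentE hp.
have [qE q0 q1' qn1' qV] := conjugate_exponentE hq.
have qltoo : 0 < fine q^-1 -> (q < +oo)%E by move=> /qV ->; rewrite ltry.
have zero_large : - (1 / 2) <= alpha ->
    if p == 1%E then (p^-1 <= (alpha + 3 / 2)%:E)%E else (p^-1 < (alpha + 3 / 2)%:E)%E.
  move=> ha; case: ifPn => [/eqP ->|pn1]; first by rewrite inve1 lee_fin; lra.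
  rewrite pE lte_fin; have : fine p^-1 < 1 by rewrite lt_neqAle p1' andbT pn1'.
  by move: ha; lra.
split=> ha.
  have z := zero_large ha; split.
    by split=> [/DomP[]//|H]; apply/DomP.
  split=> [/BndP[]//|[expo p1 qy]]; apply/BndP; split => //.
  have q0' : 0 < fine q^-1.
    move: hq qy; case: (q) => [r| |]//; rewrite lee_fin => r1 _.
    have r0 : 0 < r by exact: lt_le_trans r1.
    by rewrite inver gt_eqF//= invr_gt0.
  by move: ha; lra.
split.
  split=> [/DomP[]|H]; first by case: ifP => _ -> ->.
  by apply/DomP; move: H; case: ifP => _ /andP[].
have conjE : ((hoelder_conjugate p)^-1 = (1 - fine p^-1)%:E)%E.
  have pNy : (-oo < p)%E by apply: lt_le_trans hp; exact: ltNyr.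
  have pn0 : p != 0%E by rewrite gt_eqF// (lt_le_trans _ hp)// lte01.
  have := hoelder_conjugate_eq1 pNy pn0; rewrite {1}pE.
  case: ((hoelder_conjugate p)^-1)%E => [z| |]//; rewrite -EFinD => -[zE].
  by rewrite -zE addrAC subrr add0r.
rewrite conjE qE !lte_fin; split=> [/BndP[expo p1 qy z bq]|[expo bp bq]].
  split; [by rewrite -qE| |by move: bq; lra].
  by move: z; rewrite gt_eqF// pE lte_fin; lra.
have pn1 : (p == 1%E) = false.
  by rewrite -pn1'; apply/negbTE/negP => /eqP r1; move: bp ha; rewrite r1; lra.
apply/BndP; split.
- by rewrite qE.
- by rewrite lt_neqAle eq_sym pn1.
- by apply: qltoo; move: bq ha; lra.
- by rewrite pn1 pE lte_fin; move: bp; lra.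
- by move: bq; lra.
Qed.
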